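(* The quasicompact algebra $Q\mathcal{A}_p=(\mathcal{A}_p+\mathcal{K})\cap(\mathcal{A}_p^*+\mathcal{K})$ is strictly larger than $\mathcal{A}_p\cap\mathcal{A}_p^*+\mathcal{K}$, and $\mathcal{A}_p\cap\mathcal{A}_p^*+\mathcal{K}=\mathbb{C}I+\mathcal{K}$.
   Context: On $L^2(\mathbb{R})$ let $(M_\lambda f)(x)=e^{i\lambda x}f(x)$, $(D_\mu f)(x)=f(x-\mu)$. The parabolic algebra $\mathcal{A}_p$ is the weak operator topology closed algebra generated by $\{M_\lambda:\lambda\geq0\}\cup\{D_\mu:\mu\geq0\}$. $\mathcal{K}$ denotes the ideal of compact operators on $L^2(\mathbb{R})$ and $\mathcal{A}_p^*=\{A^*:A\in\mathcal{A}_p\}$. *)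

(* Defs.v *)
From mathcomp Require Import all_boot all_order all_algebra.
From mathcomp Require Import all_classical all_reals all_analysis.
From mathcomp Require Import complex.
Set Implicit Arguments. Unset Strict Implicit. Unset Printing Implicit Defensive.
Import Order.TTheory GRing.Theory Num.Theory.
Import numFieldNormedType.Exports.
Local Open Scope classical_set_scope.
Local Open Scope ring_scope.

(* L^2(R) (complex valued, w.r.t. Lebesgue measure) and bounded operators on
   it, modelled concretely: vectors are functions R -> R[i] that are
   square integrable; equality of vectors is a.e. equality; an operator is a
   map on functions that preserves L^2, respects a.e. equality, is linear
   modulo a.e. equality and is bounded.  Equality of operators is [opeq]. *)
Section L2.
Variable R : realType.
Local Notation mu := (@lebesgue_measure R).

Definition cfun := R -> R[i].

Definition csq (z : R[i]) : R := complex.Re z ^+ 2 + complex.Im z ^+ 2.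
Definition cabs (z : R[i]) : R := Num.sqrt (csq z).

Definition L2 (f : cfun) : Prop :=
  measurable_fun setT (fun x => complex.Re (f x)) /\
  measurable_fun setT (fun x => complex.Im (f x)) /\
  (\int[mu]_x ((csq (f x))%:E) < +oo)%E.

Definition l2norm (f : cfun) : R := Num.sqrt (\int[mu]_x csq (f x)).

(* integral of a complex-valued integrable function *)
Definition cint (h : R -> R[i]) : R[i] :=
  Complex (\int[mu]_x complex.Re (h x)) (\int[mu]_x complex.Im (h x)).

(* inner product <f, g> = \int f conj(g) *)
Definition ip (f g : cfun) : R[i] := cint (fun x => f x * (g x)^*).

Definition aeeq (f g : cfun) : Prop := {ae mu, forall x, f x = g x}.

Definition op := cfun -> cfun.

Definition is_bounded_op (T : op) : Prop :=
  (forall f, L2 f -> L2 (T f)) /\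
  (forall f g, L2 f -> L2 g -> aeeq f g -> aeeq (T f) (T g)) /\
  (forall (a : R[i]) f g, L2 f -> L2 g ->
      aeeq (T (fun x => a * f x + g x)) (fun x => a * T f x + T g x)) /\
  (exists C : R, forall f, L2 f -> l2norm (T f) <= C * l2norm f).

(* equality of operators on L^2 *)
Definition opeq (S T : op) : Prop := forall f, L2 f -> aeeq (S f) (T f).

Definition op_add (S T : op) : op := fun f x => S f x + T f x.
Definition op_scale (a : R[i]) (T : op) : op := fun f x => a * T f x.
Definition op_comp (S T : op) : op := fun f => S (T f).
Definition op_id : op := fun f => f.

(* (M_l f)(x) = e^{i l x} f(x) *)
Definition mult_op (l : R) : op :=
  fun f x => Complex (cos (l * x)) (sin (l * x)) * f x.
(* (D_m f)(x) = f(x - m) *)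
Definition transl_op (m : R) : op := fun f x => f (x - m).

(* the (non-closed) algebra generated by {M_l : l >= 0} u {D_m : m >= 0} *)
Inductive gen_alg : op -> Prop :=
  | ga_M l : 0 <= l -> gen_alg (mult_op l)
  | ga_D m : 0 <= m -> gen_alg (transl_op m)
  | ga_add S T : gen_alg S -> gen_alg T -> gen_alg (op_add S T)
  | ga_scale a T : gen_alg T -> gen_alg (op_scale a T)
  | ga_comp S T : gen_alg S -> gen_alg T -> gen_alg (op_comp S T).

(* closure in the weak operator topology of B(L^2(R)) *)
Definition wot_closure (P : op -> Prop) (T : op) : Prop :=
  is_bounded_op T /\
  forall (n : nat) (fs gs : nat -> cfun) (eps : R), 0 < eps ->
    (forall i, L2 (fs i) /\ L2 (gs i)) ->
    exists S, P S /\ forall i, (i < n)%N ->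
      cabs (ip (T (fs i)) (gs i) - ip (S (fs i)) (gs i)) < eps.

(* the parabolic algebra A_p *)
Definition Ap : op -> Prop := wot_closure gen_alg.

(* B is (a representative of) the adjoint of A *)
Definition is_adjoint (A B : op) : Prop :=
  is_bounded_op B /\
  forall f g, L2 f -> L2 g -> ip (A f) g = ip f (B g).

(* A_p^* *)
Definition Apstar (B : op) : Prop := exists A, Ap A /\ is_adjoint A B.

(* compact operators: the image of the unit ball is totally bounded *)
Definition compact_op (K : op) : Prop :=
  is_bounded_op K /\
  forall eps : R, 0 < eps ->
    exists (n : nat) (hs : nat -> cfun), (forall i, L2 (hs i)) /\
      forall f, L2 f -> l2norm f <= 1 ->
        exists i, (i < n)%N /\ l2norm (fun x => K f x - hs i x) < eps.

(* P + K *)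
Definition plusK (P : op -> Prop) (T : op) : Prop :=
  is_bounded_op T /\ exists A K, P A /\ compact_op K /\ opeq T (op_add A K).

(* QA_p = (A_p + K) n (A_p^* + K) *)
Definition QAp (T : op) : Prop := plusK Ap T /\ plusK Apstar T.

(* A_p n A_p^* *)
Definition Ap_cap_Apstar (T : op) : Prop := Ap T /\ Apstar T.

(* C I + K *)
Definition scalar_plusK (T : op) : Prop :=
  is_bounded_op T /\
  exists (c : R[i]) K, compact_op K /\ opeq T (op_add (op_scale c op_id) K).

End L2.

(* Main.v *)
(* The self-adjoint part is scalar: let A be in A_p with T = A^* in A_p.  Both preserve the
   functions vanishing on x < t for every t, so A commutes with the indicators of half-lines and,
   by uniform approximation, with multiplication by resolvents 1/(x - a).  The generators preserve
   the span of the functions e^{i l x}/(x - a) with l >= 0 and Im a < 0, all of which integrate to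
   zero against 1/(x - b) for Im b < 0; this forces the integrals of A(1/(x + i)) against all
   resolvents to be a fixed multiple of those of 1/(x + i), and these integrals determine a
   function in L^2 through its Poisson integrals.

   Strictness: let B_a f(x) be the mean of f(x - a t) over t in [0, 1], and b(y) the mean of
   e^{i t y}.  For Q = (1/N) sum_{j < N} B_{2^j} and h(x) = (1/N) sum_{j < N} b(2^j d (x - c)),
   the operator A = h Q lies in A_p.  As N grows and d shrinks, A - A^* tends to zero in norm: the
   differences B_{2^j} - B_{2^j}^* are almost orthogonal, h is almost real and slowly varying.
   Adding up such blocks A_n, centred at points c_n that go to infinity rapidly and with summable
   errors, gives T in A_p whose difference from T^* is a norm limit of compact operators.  On
   wide bumps at c_n, T has entries bounded below, while on bumps away from all the c_n it is
   small, so T is not a scalar plus a compact operator. *)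

Require Import Defs.
From mathcomp Require Import all_boot all_order all_algebra.
From mathcomp Require Import all_classical all_reals all_analysis.
From mathcomp Require Import complex measurable_realfun.
From mathcomp Require Import ring lra.
Set Implicit Arguments. Unset Strict Implicit. Unset Printing Implicit Defensive.
Import Order.TTheory GRing.Theory Num.Theory.
Import numFieldNormedType.Exports.
Local Open Scope classical_set_scope.
Local Open Scope ring_scope.

(** * Complex modulus and measurability *)

(** Since the algebra meets its adjoint only in scalars, strictness needs elements that are almost,
    but not exactly, self-adjoint. Both factors of a block come from one mechanism. The skew parts
    of the averages at scales a < b have product of norm at most 8a/b, so N of them at dyadic scales
    add up to norm of order sqrt N, and the mean over j leaves N^(-1/2); likewise the imaginary part
    of b(v) is at most a constant times min(|v|, 1/|v|), whose dyadic sum is bounded, which leaves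
    64/N. The commutator of h and Q costs the Lipschitz constant of h times the range of Q, that is
    d 4^N, so N is fixed before d. The factor h is there because Q is translation invariant, hence
    not compact; h vanishes at infinity and makes every block compact.

    The weak closure is reached by duality: on finitely many pairs of vectors the generated algebra
    fills a subspace, so an operator lies in the closure once it satisfies every linear relation
    valid on that algebra, and such relations survive means and weak limits. Contour integration is
    replaced by a discrete Cauchy-Riemann estimate summed over small vertical steps. *)

Section Complex.
Variable R : realType.
Implicit Types (z w : R[i]) (a b : R).

Lemma cabs_normc z : cabs z = ComplexField.Normc.normc z.
Proof. by case: z. Qed.

Lemma csq_ge0 z : 0 <= csq z.
Proof. by rewrite addr_ge0 // sqr_ge0. Qed.

Lemma cabs_ge0 z : 0 <= cabs z.
Proof. exact: sqrtr_ge0. Qed.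

Lemma cabs_sq z : cabs z ^+ 2 = csq z.
Proof. by rewrite sqr_sqrtr // csq_ge0. Qed.

Lemma cabs0 : cabs 0 = 0 :> R.
Proof. by rewrite cabs_normc ComplexField.Normc.normc0. Qed.

Lemma cabs0_eq0 z : cabs z = 0 -> z = 0.
Proof. by rewrite cabs_normc => /ComplexField.Normc.eq0_normc. Qed.

Lemma cabsD z w : cabs (z + w) <= cabs z + cabs w.
Proof. by rewrite !cabs_normc; exact: le_normcD. Qed.

Lemma cabsN z : cabs (- z) = cabs z.
Proof. by rewrite !cabs_normc normcN. Qed.

Lemma cabsB z w : cabs (z - w) = cabs (w - z).
Proof. by rewrite -cabsN opprB. Qed.

Lemma cabsM z w : cabs (z * w) = cabs z * cabs w.
Proof. by rewrite !cabs_normc ComplexField.Normc.normcM. Qed.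

Lemma cabsV z : cabs z^-1 = (cabs z)^-1.
Proof. by rewrite !cabs_normc ComplexField.Normc.normcV. Qed.

Lemma csqM z w : csq (z * w) = csq z * csq w.
Proof. by rewrite -!cabs_sq cabsM exprMn. Qed.

Lemma cabs_conj z : cabs z^* = cabs z.
Proof. by case: z => a b; rewrite /cabs /csq /= sqrrN. Qed.

Lemma csq_conj z : csq z^* = csq z.
Proof. by rewrite -!cabs_sq cabs_conj. Qed.

Lemma cRe_conj z : complex.Re z^* = complex.Re z.
Proof. by case: z. Qed.

Lemma cIm_conj z : complex.Im z^* = - complex.Im z.
Proof. by case: z. Qed.

Lemma cReD z w : complex.Re (z + w) = complex.Re z + complex.Re w.
Proof. by case: z w => [? ?] [? ?]. Qed.

Lemma cImD z w : complex.Im (z + w) = complex.Im z + complex.Im w.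
Proof. by case: z w => [? ?] [? ?]. Qed.

Lemma cReN z : complex.Re (- z) = - complex.Re z.
Proof. by case: z. Qed.

Lemma cImN z : complex.Im (- z) = - complex.Im z.
Proof. by case: z. Qed.

Lemma cReM z w : complex.Re (z * w) =
  complex.Re z * complex.Re w - complex.Im z * complex.Im w.
Proof. by case: z w => [? ?] [? ?]. Qed.

Lemma cImM z w : complex.Im (z * w) =
  complex.Re z * complex.Im w + complex.Im z * complex.Re w.
Proof. by case: z w => [? ?] [? ?]. Qed.

Definition cE := (cReD, cImD, cReN, cImN, cReM, cImM, cRe_conj, cIm_conj).

Lemma complex_eq z w :
  complex.Re z = complex.Re w -> complex.Im z = complex.Im w -> z = w.
Proof. by case: z w => [? ?] [? ?] /= -> ->. Qed.

Lemma Re_le_cabs z : `|complex.Re z| <= cabs z.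
Proof.
by rewrite -sqrtr_sqr ler_wsqrtr // lerDl sqr_ge0.
Qed.

Lemma Im_le_cabs z : `|complex.Im z| <= cabs z.
Proof.
by rewrite -sqrtr_sqr ler_wsqrtr // lerDr sqr_ge0.
Qed.

Lemma cabs_le_ReIm z : cabs z <= `|complex.Re z| + `|complex.Im z|.
Proof.
rewrite -(@ler_pXn2r _ 2) ?nnegrE ?addr_ge0 ?sqrtr_ge0 //.
rewrite cabs_sq /csq sqrrD -!normrX !(ger0_norm (sqr_ge0 _)).
have : 0 <= `|complex.Re z| * `|complex.Im z| by rewrite mulr_ge0.
by rewrite mulr2n; lra.
Qed.

Lemma cabs_real (a : R) : cabs (Complex a 0) = `|a|.
Proof. by rewrite /cabs /csq /= expr0n addr0 sqrtr_sqr. Qed.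

Lemma csq_real (a : R) : csq (Complex a 0) = a ^+ 2.
Proof. by rewrite /csq /= expr0n addr0. Qed.

Lemma cabs1 : cabs 1 = 1 :> R.
Proof. by rewrite cabs_normc ComplexField.Normc.normc1. Qed.

Lemma cabs_neq0 z : z != 0 -> 0 < cabs z.
Proof.
by move=> z0; rewrite lt_neqAle cabs_ge0 andbT eq_sym; apply: contra_neq z0 => /cabs0_eq0.
Qed.

Lemma csqD_le z w : csq (z + w) <= 2 * csq z + 2 * csq w.
Proof.
case: z w => [a b] [c d]; rewrite /csq /=.
have := sqr_ge0 (a - c); have := sqr_ge0 (b - d); rewrite !expr2; lra.
Qed.

Lemma mulc_conj z : z * z^* = Complex (csq z) 0.
Proof. by apply: complex_eq; rewrite !cE /csq /=; ring. Qed.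

Lemma cabs_le_csq z (c : R) : 0 <= c -> csq z <= c ^+ 2 -> cabs z <= c.
Proof. by move=> c0; rewrite -cabs_sq ler_pXn2r // nnegrE cabs_ge0. Qed.

Lemma cabs_sum (I : Type) (r : seq I) (P : pred I) (F : I -> R[i]) :
  cabs (\sum_(i <- r | P i) F i) <= \sum_(i <- r | P i) cabs (F i).
Proof.
elim/big_rec2: _ => [|i y z _ h]; first by rewrite cabs0.
by rewrite (le_trans (cabsD _ _))// lerD2l.
Qed.

Lemma cRe_sum (I : Type) (r : seq I) (P : pred I) (F : I -> R[i]) :
  complex.Re (\sum_(i <- r | P i) F i) = \sum_(i <- r | P i) complex.Re (F i).
Proof. by elim/big_rec2: _ => // i y z _ h; rewrite !cE h. Qed.

Lemma cIm_sum (I : Type) (r : seq I) (P : pred I) (F : I -> R[i]) :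
  complex.Im (\sum_(i <- r | P i) F i) = \sum_(i <- r | P i) complex.Im (F i).
Proof. by elim/big_rec2: _ => // i y z _ h; rewrite !cE h. Qed.

End Complex.

Section ComplexMeasurable.
Context {d} {T : measurableType d} {R : realType}.
Implicit Types f g : T -> R[i].

Definition cmeas f :=
  measurable_fun setT (fun x => complex.Re (f x)) /\
  measurable_fun setT (fun x => complex.Im (f x)).

Lemma cmeas_cst (c : R[i]) : cmeas (fun _ => c).
Proof. by split; exact: measurable_cst. Qed.

Lemma cmeasD f g : cmeas f -> cmeas g -> cmeas (fun x => f x + g x).
Proof.
move=> [f1 f2] [g1 g2]; split.
  by under eq_fun do rewrite cReD; exact: measurable_funD.
by under eq_fun do rewrite cImD; exact: measurable_funD.
Qed.

Lemma cmeasN f : cmeas f -> cmeas (fun x => - f x).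
Proof.
move=> [f1 f2]; split.
  by under eq_fun do rewrite cReN; exact: measurableT_comp.
by under eq_fun do rewrite cImN; exact: measurableT_comp.
Qed.

Lemma cmeasB f g : cmeas f -> cmeas g -> cmeas (fun x => f x - g x).
Proof. by move=> mf mg; apply: cmeasD => //; exact: cmeasN. Qed.

Lemma cmeasM f g : cmeas f -> cmeas g -> cmeas (fun x => f x * g x).
Proof.
move=> [f1 f2] [g1 g2]; split.
  by under eq_fun do rewrite cReM; apply: measurable_funB; exact: measurable_funM.
by under eq_fun do rewrite cImM; apply: measurable_funD; exact: measurable_funM.
Qed.

Lemma cmeas_conj f : cmeas f -> cmeas (fun x => (f x)^*).
Proof.
move=> [f1 f2]; split; first by under eq_fun do rewrite cRe_conj.
by under eq_fun do rewrite cIm_conj; exact: measurableT_comp.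
Qed.

Lemma cmeas_sum (I : Type) (r : seq I) (F : I -> T -> R[i]) :
  (forall i, cmeas (F i)) -> cmeas (fun x => \sum_(i <- r) F i x).
Proof.
move=> mF; elim: r => [|i r ih].
  by under eq_fun do rewrite big_nil; exact: cmeas_cst.
by under eq_fun do rewrite big_cons; exact: cmeasD.
Qed.

Lemma measurable_csq f : cmeas f -> measurable_fun setT (fun x => csq (f x)).
Proof. by move=> [f1 f2]; apply: measurable_funD; exact: measurable_funX. Qed.

Lemma measurable_cabs f : cmeas f -> measurable_fun setT (fun x => cabs (f x)).
Proof.
move=> mf; rewrite /cabs; apply: (measurableT_comp _ (measurable_csq mf)).
apply: continuous_measurable_fun; exact: sqrt_continuous.
Qed.

Lemma cmeas_real (h : T -> R) :
  measurable_fun setT h -> cmeas (fun x => Complex (h x) 0).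
Proof. by move=> mh; split => //=; exact: measurable_cst. Qed.

Lemma cmeas_limit (F : nat -> T -> R[i]) f : (forall n, cmeas (F n)) ->
  (forall x, complex.Re (F n x) @[n --> \oo] --> complex.Re (f x)) ->
  (forall x, complex.Im (F n x) @[n --> \oo] --> complex.Im (f x)) -> cmeas f.
Proof.
move=> mF r i; split.
  by apply: (measurable_fun_cvg (h := fun n x => complex.Re (F n x))) => // n; case: (mF n).
by apply: (measurable_fun_cvg (h := fun n x => complex.Im (F n x))) => // n; case: (mF n).
Qed.

End ComplexMeasurable.

Lemma cmeas_comp d d' (T : measurableType d) (T' : measurableType d') (R : realType)
    (f : T' -> R[i]) (g : T -> T') :
  cmeas f -> measurable_fun setT g -> cmeas (fun x => f (g x)).
Proof. by move=> [f1 f2] mg; split; [exact: (measurableT_comp f1 mg)|exact: (measurableT_comp f2 mg)]. Qed.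

Lemma cmeas_shift (R : realType) (f : R -> R[i]) (b : R) :
  cmeas f -> cmeas (fun x : R => f (x - b)).
Proof. by move=> mf; apply: (cmeas_comp mf); exact: measurable_funB. Qed.

(** * Integrals on the line *)

Section Substitution.
Variable R : realType.
Local Notation mu := (@lebesgue_measure R).

Let affine (a b : R) (x : measurableTypeR R) : measurableTypeR R := a * x + b.

Let measurable_affine a b : measurable_fun setT (affine a b).
Proof.
by apply: measurable_funD => //; apply: measurable_funM => //; exact: measurable_id.
Qed.

(** The pushforward of [mu] under the affine map, scaled by [a], agrees with [mu] on the intervals
    []u, v]], and these determine Lebesgue measure. *)
Lemma lebesgue_measure_affine (a b : R) (A : set R) : 0 < a -> measurable A ->
  (mu A = a%:E * mu ((fun x => a * x + b)%R @^-1` A))%E.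
Proof.
move=> a0 mA; have a0' : 0 <= a by exact: ltW.
pose pm := measure_function_pushforward__canonical__measure_function_Measure mu
    (measurable_affine a b).
transitivity (mscale (NngNum a0') pm A); last by rewrite /mscale /=.
apply: (@lebesgue_measure_unique R (mscale (NngNum a0') pm)) => // _ [[u v]] _ <-.
change (mu `]u, v]%classic = a%:E * mu (affine a b @^-1` `]u, v]))%E.
have -> : affine a b @^-1` `]u, v] = `](u - b) / a, (v - b) / a]%classic.
  apply/seteqP; split => x; rewrite /affine /= !in_itv /= => /andP[h1 h2]; apply/andP; split.
  - by rewrite ltr_pdivrMr // mulrC; lra.
  - by rewrite ler_pdivlMr // mulrC; lra.
  - by move: h1; rewrite ltr_pdivrMr // mulrC; lra.
  - by move: h2; rewrite ler_pdivlMr // mulrC; lra.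
rewrite !lebesgue_measure_itv /= !lte_fin ltr_pM2r ?invr_gt0 // ltrD2r.
case: ifPn => _; last by rewrite mule0.
by rewrite -!EFinB -EFinM; congr EFin; field; rewrite gt_eqF.
Qed.

Lemma ge0_integral_affine (a b : R) (f : R -> \bar R) : 0 < a ->
  measurable_fun setT f -> (forall x, (0 <= f x)%E) ->
  (\int[mu]_x f x = a%:E * \int[mu]_x f (a * x + b)%R)%E.
Proof.
move=> a0 mf f0; have a0' : 0 <= a by exact: ltW.
pose pm := measure_function_pushforward__canonical__measure_function_Measure mu
    (measurable_affine a b).
transitivity (\int[mscale (NngNum a0') pm]_x f x)%E.
  by apply: eq_measure_integral => // A mA _; exact: lebesgue_measure_affine.
rewrite ge0_integral_mscale //.
by rewrite ge0_integral_pushforward // preimage_setT.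
Qed.

Lemma ge0_integral_oppr (f : R -> \bar R) :
  measurable_fun setT f -> (forall x, (0 <= f x)%E) ->
  (\int[mu]_x f x = \int[mu]_x f (- x)%R)%E.
Proof.
move=> mf f0.
have mN : measurable_fun setT ((-%R : _ -> measurableTypeR R) : measurableTypeR R -> _).
  exact: measurable_funN (@measurable_id _ (measurableTypeR R) setT).
pose pm := measure_function_pushforward__canonical__measure_function_Measure mu mN.
transitivity (\int[pm]_x f x)%E.
  by apply: eq_measure_integral => // A mA _; rewrite -[LHS]lebesgue_measureN.
by rewrite ge0_integral_pushforward // preimage_setT.
Qed.

Lemma integral_shift (b : R) (f : R -> \bar R) : measurable_fun setT f ->
  (\int[mu]_x f (x - b)%R = \int[mu]_x f x)%E.
Proof.
move=> mf; rewrite integralE [RHS]integralE.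
rewrite (ge0_integral_affine (- b) ltr01 (measurable_funepos mf)) //.
rewrite (ge0_integral_affine (- b) ltr01 (measurable_funeneg mf)) //.
by rewrite !mul1e; congr (_ - _)%E; apply: eq_integral => x _; rewrite (funeposE, funenegE) [in RHS](funeposE, funenegE) mul1r.
Qed.

Lemma ge0_integral_scale (a : R) (f : R -> \bar R) : a != 0 ->
  measurable_fun setT f -> (forall x, (0 <= f x)%E) ->
  (\int[mu]_x f x = `|a|%:E * \int[mu]_x f (a * x)%R)%E.
Proof.
move=> a0 mf f0; have [ap|an] := ltP 0 a.
  rewrite (ge0_integral_affine 0 ap) // gtr0_norm //.
  by under eq_integral do rewrite addr0.
have {}an : 0 < - a by rewrite oppr_gt0 lt_neqAle a0.
rewrite (ge0_integral_affine 0 an) // ltr0_norm -?oppr_gt0 //; congr (_ * _)%E.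
rewrite [RHS]ge0_integral_oppr //.
  by apply: eq_integral => x _; rewrite addr0 mulNr mulrN.
by apply: measurableT_comp => //; apply: measurable_funM.
Qed.

End Substitution.

Section ComplexIntegral.
Variable R : realType.
Local Notation mu := (@lebesgue_measure R).
Implicit Types (h k : R -> R[i]) (F G : R -> R).

Definition rinteg F := mu.-integrable setT (EFin \o F).

Definition cinteg h :=
  rinteg (fun x => complex.Re (h x)) /\ rinteg (fun x => complex.Im (h x)).

Lemma rinteg_measurable F : rinteg F -> measurable_fun setT F.
Proof. by move=> /measurable_int /measurable_EFinP. Qed.

Lemma rinteg_le F G : measurable_fun setT F -> rinteg G ->
  (forall x, `|F x| <= G x) -> rinteg F.
Proof.
move=> mF iG FG; apply: le_integrable iG => //; first exact/measurable_EFinP.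
by move=> x _ /=; rewrite lee_fin (le_trans (FG x)) // ler_norm.
Qed.

Lemma rintegD F G : rinteg F -> rinteg G -> rinteg (fun x => F x + G x).
Proof. by move=> iF iG; exact: (integrableD measurableT iF iG). Qed.

Lemma rintegB F G : rinteg F -> rinteg G -> rinteg (fun x => F x - G x).
Proof. by move=> iF iG; exact: (integrableB measurableT iF iG). Qed.

Lemma rintegZ (a : R) F : rinteg F -> rinteg (fun x => a * F x).
Proof. by move=> iF; exact: (integrableZl measurableT a iF). Qed.

Lemma rinteg_lty F : measurable_fun setT F -> (forall x, 0 <= F x) ->
  (\int[mu]_x (F x)%:E < +oo)%E -> rinteg F.
Proof.
move=> mF F0 Foo; apply/integrableP; split; first exact/measurable_EFinP.
by under eq_integral do rewrite /= ger0_norm //.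
Qed.

Lemma rinteg_fin F : rinteg F -> (\int[mu]_x (F x)%:E)%E = (\int[mu]_x F x)%:E.
Proof. by move=> iF; rewrite /Rintegral fineK //; exact: integrable_fin_num. Qed.

Lemma Rint_le F G : rinteg F -> rinteg G -> (forall x, F x <= G x) ->
  \int[mu]_x F x <= \int[mu]_x G x.
Proof. by move=> iF iG FG; apply: le_Rintegral. Qed.

Lemma cinteg_meas h : cinteg h -> cmeas h.
Proof. by case=> /rinteg_measurable ? /rinteg_measurable ?; split. Qed.

Lemma cinteg_cabs h : cinteg h -> rinteg (fun x => cabs (h x)).
Proof.
move=> ih; apply: (rinteg_le _ (rintegD (integrable_norm ih.1) (integrable_norm ih.2))).
  exact/measurable_cabs/cinteg_meas.
by move=> x; rewrite ger0_norm ?cabs_ge0 //; exact: cabs_le_ReIm.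
Qed.

Lemma cinteg_le h G : cmeas h -> rinteg G -> (forall x, cabs (h x) <= G x) -> cinteg h.
Proof.
move=> [m1 m2] iG hG; split; apply: rinteg_le iG _ => // x.
  exact: le_trans (Re_le_cabs _) _.
exact: le_trans (Im_le_cabs _) _.
Qed.

Lemma cinteg_lty h : cmeas h -> (\int[mu]_x (cabs (h x))%:E < +oo)%E -> cinteg h.
Proof.
move=> mh hoo; apply: (cinteg_le mh (G := fun x => cabs (h x))) => //.
by apply: rinteg_lty => //; [exact: measurable_cabs|move=> x; exact: cabs_ge0].
Qed.

Lemma cintegD h k : cinteg h -> cinteg k -> cinteg (fun x => h x + k x).
Proof.
move=> [h1 h2] [k1 k2]; split.
  by under eq_fun do rewrite cReD; exact: rintegD.
by under eq_fun do rewrite cImD; exact: rintegD.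
Qed.

Lemma cintegZ (a : R[i]) h : cinteg h -> cinteg (fun x => a * h x).
Proof.
move=> [h1 h2]; split.
  by under eq_fun do rewrite cReM; apply: rintegB; exact: rintegZ.
by under eq_fun do rewrite cImM; apply: rintegD; exact: rintegZ.
Qed.

Lemma cintegN h : cinteg h -> cinteg (fun x => - h x).
Proof. by move/(cintegZ (-1)); under eq_fun do rewrite mulN1r. Qed.

Lemma cintegB h k : cinteg h -> cinteg k -> cinteg (fun x => h x - k x).
Proof. by move=> ih /cintegN; exact: cintegD. Qed.

Lemma cinteg0 : cinteg (fun=> 0).
Proof. by split; exact: integrable0. Qed.

Lemma cinteg_sum (I : Type) (r : seq I) (H : I -> R -> R[i]) :
  (forall i, cinteg (H i)) -> cinteg (fun x => \sum_(i <- r) H i x).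
Proof.
move=> iH; elim: r => [|i r ih].
  by under eq_fun do rewrite big_nil; exact: cinteg0.
by under eq_fun do rewrite big_cons; exact: cintegD.
Qed.

Lemma cint0 : cint (fun=> 0) = 0 :> R[i].
Proof. by rewrite /cint Rintegral_cst //= mul0r. Qed.

Lemma cint_ext h k : (forall x, h x = k x) -> cint h = cint k.
Proof. by move=> /funext ->. Qed.

Lemma cintD h k : cinteg h -> cinteg k -> cint (fun x => h x + k x) = cint h + cint k.
Proof.
move=> [h1 h2] [k1 k2]; apply: complex_eq; rewrite cE /=.
  by under eq_Rintegral do rewrite cReD; rewrite RintegralD.
by under eq_Rintegral do rewrite cImD; rewrite RintegralD.
Qed.

Lemma cintZ (a : R[i]) h : cinteg h -> cint (fun x => a * h x) = a * cint h.
Proof.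
move=> [h1 h2]; apply: complex_eq; rewrite cE /=.
  under eq_Rintegral do rewrite cReM.
  by rewrite RintegralB // ?RintegralZl //; exact: rintegZ.
under eq_Rintegral do rewrite cImM.
by rewrite RintegralD // ?RintegralZl //; exact: rintegZ.
Qed.

Lemma cintN h : cinteg h -> cint (fun x => - h x) = - cint h.
Proof. by move=> ih; rewrite -mulN1r -cintZ //; apply: cint_ext => x; rewrite mulN1r. Qed.

Lemma cintB h k : cinteg h -> cinteg k -> cint (fun x => h x - k x) = cint h - cint k.
Proof. by move=> ih ik; rewrite cintD ?cintN //; exact: cintegN. Qed.

Lemma cint_conj h : cinteg h -> cint (fun x => (h x)^*) = (cint h)^*.
Proof.
move=> [h1 h2]; apply: complex_eq; rewrite cE /=.
  by under eq_Rintegral do rewrite cRe_conj.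
by under eq_Rintegral do rewrite cIm_conj -mulN1r; rewrite RintegralZl // mulN1r.
Qed.

Lemma cint_sum (I : Type) (r : seq I) (H : I -> R -> R[i]) :
  (forall i, cinteg (H i)) ->
  cint (fun x => \sum_(i <- r) H i x) = \sum_(i <- r) cint (H i).
Proof.
move=> iH; elim: r => [|i r ih].
  by rewrite big_nil -[RHS]cint0; apply: cint_ext => x; rewrite big_nil.
rewrite big_cons -ih -cintD //; last exact: cinteg_sum.
by apply: cint_ext => x; rewrite big_cons.
Qed.

(** With [z] the integral, multiplying the integrand by the conjugate of [z] makes the integral
    equal to |z|^2; its real part is at most |z| times the integral of the modulus. *)
Lemma cabs_cint h : cinteg h -> cabs (cint h) <= \int[mu]_x cabs (h x).
Proof.
move=> ih; set z := cint h.
have [z0|z0] := eqVneq z 0.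
  by rewrite z0 cabs0; apply: Rintegral_ge0 => x _; exact: cabs_ge0.
rewrite -(ler_pM2l (cabs_neq0 z0)) -expr2 cabs_sq.
have -> : csq z = complex.Re (cint (fun x => z^* * h x)).
  by rewrite cintZ // mulrC mulc_conj.
rewrite -RintegralZl //; last exact: cinteg_cabs.
apply: le_trans (Rint_le (cintegZ z^* ih).1 (rintegZ (cabs z) (cinteg_cabs ih)) _).
  by [].
by move=> x; rewrite (le_trans (ler_norm _)) // (le_trans (Re_le_cabs _)) // cabsM cabs_conj.
Qed.

Lemma cabs_cint_le h G : cmeas h -> rinteg G -> (forall x, cabs (h x) <= G x) ->
  cabs (cint h) <= \int[mu]_x G x.
Proof.
move=> mh iG hG; have ih := cinteg_le mh iG hG.
by apply: le_trans (cabs_cint ih) (Rint_le _ _ _) => //; exact: cinteg_cabs.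
Qed.

Lemma ae_mono (P Q : R -> Prop) : (forall x, P x -> Q x) ->
  {ae mu, forall x, P x} -> {ae mu, forall x, Q x}.
Proof.
move=> PQ [N [mN N0 sub]]; exists N; split => //.
by apply: subset_trans sub; apply: subsetC => x; exact: PQ.
Qed.

Lemma ae_mono2 (P Q S : R -> Prop) : (forall x, P x -> Q x -> S x) ->
  {ae mu, forall x, P x} -> {ae mu, forall x, Q x} -> {ae mu, forall x, S x}.
Proof.
move=> PQS [N [mN N0 sN]] [M [mM M0 sM]]; exists (N `|` M); split => //.
- exact: measurableU.
- by rewrite null_set_setU.
- move=> x /= Sx; apply: contrapT => /not_orP[NNx NMx]; apply: Sx; apply: PQS.
    by apply: contrapT => Px; exact/NNx/sN.
  by apply: contrapT => Qx; exact/NMx/sM.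
Qed.

Lemma cint_ae h k : cmeas h -> cmeas k -> aeeq h k -> cint h = cint k.
Proof.
move=> [mh1 mh2] [mk1 mk2] hk; rewrite /cint /Rintegral; congr (Complex (fine _) (fine _)).
  apply: ae_eq_integral => //; [exact/measurable_EFinP|exact/measurable_EFinP|].
  by apply: ae_mono hk => x /= -> _.
apply: ae_eq_integral => //; [exact/measurable_EFinP|exact/measurable_EFinP|].
by apply: ae_mono hk => x /= -> _.
Qed.

Lemma cint_shift h (b : R) : cmeas h -> cint (fun x => h (x - b)) = cint h.
Proof.
by move=> [m1 m2]; rewrite /cint /Rintegral;
  congr (Complex (fine _) (fine _)); apply: (integral_shift b (f := EFin \o _));
  exact/measurable_EFinP.
Qed.

Lemma cinteg_shift h (b : R) : cinteg h -> cinteg (fun x => h (x - b)).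
Proof.
move=> ih; apply: cinteg_lty; first exact/cmeas_shift/cinteg_meas.
rewrite (integral_shift b (f := fun x => (cabs (h x))%:E)).
  by rewrite rinteg_fin ?ltry //; exact: cinteg_cabs.
exact/measurable_EFinP/measurable_cabs/cinteg_meas.
Qed.

Lemma cvg0P (f : nat -> R) : f @ \oo --> 0 <->
  forall e, 0 < e -> exists N, forall n, (N <= n)%N -> `|f n| < e.
Proof.
split => [/cvgrPdist_lt h e e0|h].
  have [N _ hN] := h e e0; exists N => n Nn.
  by have := hN n Nn; rewrite /= sub0r normrN.
apply/cvgrPdist_lt => e e0; have [N hN] := h e e0.
by exists N => // n /= Nn; rewrite sub0r normrN; exact: hN.
Qed.

(** The limit inherits the majorant [G], so [H n - h] is dominated by [2 * G] and the real dominated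
    convergence theorem applies to its modulus. *)
Lemma dominated_cint (H : nat -> R -> R[i]) h G :
  (forall n, cmeas (H n)) -> cmeas h -> rinteg G ->
  (forall n x, cabs (H n x) <= G x) ->
  (forall x, (fun n => cabs (H n x - h x)) @ \oo --> 0) ->
  (fun n => cabs (cint (H n) - cint h)) @ \oo --> 0.
Proof.
move=> mH mh iG HG Hh.
have hG x : cabs (h x) <= G x.
  apply/ler_addgt0Pr => e e0.
  have [N /(_ N (leqnn N))] := (cvg0P _).1 (Hh x) e e0.
  rewrite ger0_norm ?cabs_ge0 // cabsB => /ltW hN.
  have -> : h x = (h x - H N x) + H N x by rewrite subrK.
  by rewrite (le_trans (cabsD _ _)) // addrC lerD.
have iH n : cinteg (H n) by exact: cinteg_le (mH n) iG (HG n).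
have ih : cinteg h by exact: cinteg_le mh iG hG.
have iHh n : rinteg (fun x => cabs (H n x - h x)).
  by apply: cinteg_cabs; exact: cintegB.
have : (fun n => \int[mu]_x cabs (H n x - h x)) @ \oo --> 0.
  pose F n x := (cabs (H n x - h x))%:E.
  have FD n : measurable_fun setT (F n) := measurable_int mu (iHh n).
  have F0 : {ae mu, forall x, setT x -> F ^~ x @ \oo --> cst 0%E x}.
    by apply: aeW => x _; apply: cvg_EFin; [exact: nearW|exact: Hh].
  have FG : {ae mu, forall x n, setT x -> (`|F n x| <= (2 * G x)%:E)%E}.
    apply: aeW => x n _; rewrite /F /= lee_fin ger0_norm ?cabs_ge0 //.
    by rewrite (le_trans (cabsD _ _)) // cabsN mulr_natl mulr2n lerD.
  have [_ _] := @dominated_convergence _ _ _ mu setT measurableT F (cst 0%E) _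
    FD (measurable_cst _) F0 (rintegZ 2 iG) FG.
  by rewrite integral0 => /fine_cvgP[].
move=> /cvg0P I0; apply/cvg0P => e e0; have [N hN] := I0 e e0; exists N => n Nn.
rewrite ger0_norm ?cabs_ge0 // -cintB //.
apply: le_lt_trans (cabs_cint (cintegB (iH n) ih)) _.
by apply: le_lt_trans (hN n Nn); exact: ler_norm.
Qed.

End ComplexIntegral.

(** * Square integrable functions *)

Section L2Theory.
Variable R : realType.
Local Notation mu := (@lebesgue_measure R).
Implicit Types (f g h : cfun R).

(** The squared norm in the extended reals. [l2norm] passes through [fine] and is 0 when the
    integral is infinite, so finiteness has to be settled here before a bound on the norm has
    content. *)
Definition nsq f : \bar R := (\int[mu]_x (csq (f x))%:E)%E.

Lemma L2_cmeas f : L2 f -> cmeas f.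
Proof. by case=> ? [? _]. Qed.

Lemma nsq_lty f : L2 f -> (nsq f < +oo)%E.
Proof. by case=> _ []. Qed.

Lemma L2_csq f : L2 f -> rinteg (fun x => csq (f x)).
Proof.
move=> Lf; apply: rinteg_lty (nsq_lty Lf); first exact/measurable_csq/L2_cmeas.
by move=> x; exact: csq_ge0.
Qed.

Lemma l2norm_ge0 f : 0 <= l2norm f.
Proof. exact: sqrtr_ge0. Qed.

Lemma l2norm_sq f : l2norm f ^+ 2 = \int[mu]_x csq (f x).
Proof. by rewrite sqr_sqrtr //; apply: Rintegral_ge0 => x _; exact: csq_ge0. Qed.

Lemma nsqE f : L2 f -> nsq f = (l2norm f ^+ 2)%:E.
Proof. by move=> Lf; rewrite l2norm_sq -rinteg_fin //; exact: L2_csq. Qed.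

Lemma nsq_le f (C : R) : cmeas f -> 0 <= C -> (nsq f <= (C ^+ 2)%:E)%E ->
  L2 f /\ l2norm f <= C.
Proof.
move=> mf C0 h; have Lf : L2 f.
  by case: mf => m1 m2; split=> //; split=> //; apply: le_lt_trans h (ltry _).
split=> //; rewrite -(@ler_pXn2r _ 2) ?nnegrE ?l2norm_ge0 //.
by rewrite -lee_fin -nsqE.
Qed.

Lemma nsq_dom f g (C : R) : cmeas f -> cmeas g ->
  (forall x, cabs (f x) <= C * cabs (g x)) -> (nsq f <= (C ^+ 2)%:E * nsq g)%E.
Proof.
move=> mf mg fg; rewrite /nsq -ge0_integralZl //; first last.
- by rewrite lee_fin sqr_ge0.
- by move=> x _; rewrite lee_fin csq_ge0.
- exact/measurable_EFinP/measurable_csq.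
apply: ge0_le_integral => //.
- by move=> x _; rewrite lee_fin csq_ge0.
- exact/measurable_EFinP/measurable_csq.
- by apply/measurable_EFinP/measurable_funM => //; exact: measurable_csq.
move=> x _; rewrite -EFinM lee_fin -!cabs_sq -exprMn.
by rewrite ler_pXn2r ?nnegrE ?cabs_ge0 // (le_trans _ (fg x)) ?cabs_ge0.
Qed.

Lemma L2_dom f g (C : R) : cmeas f -> L2 g -> 0 <= C ->
  (forall x, cabs (f x) <= C * cabs (g x)) -> L2 f /\ l2norm f <= C * l2norm g.
Proof.
move=> mf Lg C0 fg; apply: nsq_le => //; first by rewrite mulr_ge0 ?l2norm_ge0.
by rewrite exprMn EFinM -nsqE //; apply: nsq_dom => //; exact: L2_cmeas.
Qed.

Lemma l2norm_le f g : cmeas f -> L2 g -> (forall x, cabs (f x) <= cabs (g x)) ->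
  l2norm f <= l2norm g.
Proof.
move=> mf Lg fg; rewrite -[leRHS]mul1r.
by apply: (L2_dom mf Lg ler01 _).2 => x; rewrite mul1r.
Qed.

Lemma L2D f g : L2 f -> L2 g -> L2 (fun x => f x + g x).
Proof.
move=> Lf Lg; have mf := L2_cmeas Lf; have mg := L2_cmeas Lg.
have [m1 m2] := cmeasD mf mg; split=> //; split=> //.
have iG : rinteg (fun x => 2 * csq (f x) + 2 * csq (g x)).
  by apply: rintegD; apply: rintegZ; exact: L2_csq.
apply: le_lt_trans (integrable_lty measurableT iG); apply: ge0_le_integral => //.
- by move=> x _; rewrite lee_fin csq_ge0.
- exact/measurable_EFinP/measurable_csq/cmeasD.
- by apply/measurable_EFinP/measurable_funD;
    apply: measurable_funM => //; exact: measurable_csq.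
- by move=> x _; rewrite lee_fin csqD_le.
Qed.

Lemma L2M (u : R -> R[i]) (C : R) f : cmeas u -> (forall x, cabs (u x) <= C) ->
  L2 f -> L2 (fun x => u x * f x) /\ l2norm (fun x => u x * f x) <= C * l2norm f.
Proof.
move=> mu_ uC Lf; apply: L2_dom => //; first by apply: cmeasM => //; exact: L2_cmeas.
  exact: le_trans (cabs_ge0 (u 0)) (uC 0).
by move=> x; rewrite cabsM ler_wpM2r ?cabs_ge0.
Qed.

Lemma L2Z (a : R[i]) f : L2 f -> L2 (fun x => a * f x).
Proof. by move=> Lf; apply: (L2M (u := fun=> a) (C := cabs a) _ _ Lf).1 => //; exact: cmeas_cst. Qed.

Lemma l2normZ (a : R[i]) f : L2 f -> l2norm (fun x => a * f x) = cabs a * l2norm f.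
Proof.
move=> Lf; rewrite /l2norm.
under eq_Rintegral do rewrite csqM.
rewrite RintegralZl //; last exact: L2_csq.
by rewrite sqrtrM ?csq_ge0.
Qed.

Lemma L2N f : L2 f -> L2 (fun x => - f x).
Proof. by move/(L2Z (-1)); under eq_fun do rewrite mulN1r. Qed.

Lemma l2normN f : l2norm (fun x => - f x) = l2norm f.
Proof. by rewrite /l2norm; under eq_Rintegral do rewrite -cabs_sq cabsN cabs_sq. Qed.

Lemma L2B f g : L2 f -> L2 g -> L2 (fun x => f x - g x).
Proof. by move=> Lf /L2N; exact: L2D. Qed.

Lemma L2_0 : L2 (fun=> 0 : R[i]).
Proof.
split; first exact: measurable_cst.
split; first exact: measurable_cst.
by under eq_integral do rewrite -cabs_sq cabs0 expr0n; rewrite integral0 ltry.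
Qed.

Lemma l2norm0 : l2norm (fun=> 0 : R[i]) = 0.
Proof.
by rewrite /l2norm; under eq_Rintegral do rewrite -cabs_sq cabs0 expr0n;
  rewrite Rintegral_cst // mul0r sqrtr0.
Qed.

Lemma L2_sum (I : Type) (r : seq I) (F : I -> cfun R) :
  (forall i, L2 (F i)) -> L2 (fun x => \sum_(i <- r) F i x).
Proof.
move=> LF; elim: r => [|i r ih].
  by under eq_fun do rewrite big_nil; exact: L2_0.
by under eq_fun do rewrite big_cons; exact: L2D.
Qed.

Lemma L2_shift f (b : R) : L2 f -> L2 (fun x => f (x - b)).
Proof.
move=> Lf; have [m1 m2] := cmeas_shift b (L2_cmeas Lf); split=> //; split=> //.
rewrite (integral_shift b (f := fun x => (csq (f x))%:E)); last first.
  exact/measurable_EFinP/measurable_csq/L2_cmeas.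
exact: nsq_lty.
Qed.

Lemma l2norm_shift f (b : R) : cmeas f -> l2norm (fun x => f (x - b)) = l2norm f.
Proof.
move=> mf; rewrite /l2norm /Rintegral.
rewrite (integral_shift b (f := fun x => (csq (f x))%:E)) //.
exact/measurable_EFinP/measurable_csq.
Qed.

Lemma L2_conj f : L2 f -> L2 (fun x => (f x)^*).
Proof.
move=> Lf; have [m1 m2] := cmeas_conj (L2_cmeas Lf); split=> //; split=> //.
by under eq_integral do rewrite csq_conj; exact: nsq_lty.
Qed.

Lemma nsq_ae f g : cmeas f -> cmeas g -> aeeq f g -> nsq f = nsq g.
Proof.
move=> mf mg fg; apply: ae_eq_integral => //;
  [exact/measurable_EFinP/measurable_csq|exact/measurable_EFinP/measurable_csq|].
by apply: ae_mono fg => x /= -> _.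
Qed.

Lemma l2norm_ae f g : cmeas f -> cmeas g -> aeeq f g -> l2norm f = l2norm g.
Proof. by move=> mf mg fg; congr (Num.sqrt (fine _)); exact: nsq_ae. Qed.

Lemma aeeq_refl f : aeeq f f.
Proof. exact: aeW. Qed.

Lemma l2norm_eq0 f : L2 f -> l2norm f = 0 -> aeeq f (fun=> 0).
Proof.
move=> Lf f0; have : nsq f = 0%E by rewrite nsqE // f0 expr0n.
rewrite /nsq; under eq_integral do rewrite -[csq _]ger0_norm ?csq_ge0 // -abse_EFin.
move/(ae_eq_integral_abs mu measurableT (measurable_int mu (L2_csq Lf))).1.
apply: ae_mono => x /(_ I) [].
by rewrite -cabs_sq => /eqP; rewrite sqrf_eq0 => /eqP /cabs0_eq0.
Qed.

Lemma L2_mul f g : L2 f -> L2 g -> rinteg (fun x => cabs (f x) * cabs (g x)).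
Proof.
move=> Lf Lg; apply: rinteg_le (rintegD (L2_csq Lf) (L2_csq Lg)) _.
  by apply: measurable_funM; apply: measurable_cabs; exact: L2_cmeas.
move=> x; rewrite ger0_norm ?mulr_ge0 ?cabs_ge0 // -!cabs_sq.
have := sqr_ge0 (cabs (f x) - cabs (g x)); have := cabs_ge0 (f x).
by have := cabs_ge0 (g x); nra.
Qed.

Lemma quadratic_ge0 (A B P : R) : 0 <= A ->
  (forall t, 0 <= t ^+ 2 * A - 2 * t * P + B) -> P ^+ 2 <= A * B.
Proof.
rewrite le_eqVlt => /predU1P[<-|A0] h.
  rewrite mul0r; have [->|P0] := eqVneq P 0; first by rewrite expr0n.
  (* With A = 0 the quadratic is affine in t, and this t brings it to -1. *)
  have := h ((B + 1) / (2 * P)); rewrite mulr0 add0r.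
  have -> : 2 * ((B + 1) / (2 * P)) * P = B + 1 by field.
  by lra.
have := h (P / A); have -> : (P / A) ^+ 2 * A - 2 * (P / A) * P + B = B - P ^+ 2 / A.
  by field; rewrite gt_eqF.
by rewrite subr_ge0 ler_pdivrMr // mulrC.
Qed.

Lemma cauchy_schwarz_abs f g : L2 f -> L2 g ->
  \int[mu]_x (cabs (f x) * cabs (g x)) <= l2norm f * l2norm g.
Proof.
move=> Lf Lg; set P := \int[mu]_x _.
have P0 : 0 <= P by apply: Rintegral_ge0 => x _; rewrite mulr_ge0 ?cabs_ge0.
rewrite -(@ler_pXn2r _ 2) ?nnegrE ?mulr_ge0 ?l2norm_ge0 // exprMn !l2norm_sq.
apply: quadratic_ge0 => [|t]; first by rewrite -l2norm_sq sqr_ge0.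
have I1 := rintegZ (t ^+ 2) (L2_csq Lf); have I2 := rintegZ (2 * t) (L2_mul Lf Lg).
have -> : t ^+ 2 * \int[mu]_x csq (f x) - 2 * t * P + \int[mu]_x csq (g x) =
    \int[mu]_x (t ^+ 2 * csq (f x) - 2 * t * (cabs (f x) * cabs (g x)) + csq (g x)).
  rewrite [RHS]RintegralD //; [|exact: rintegB|exact: L2_csq].
  by rewrite [X in _ = X + _]RintegralB // !RintegralZl //; [exact: L2_mul|exact: L2_csq].
apply: Rintegral_ge0 => x _; rewrite -!cabs_sq.
by have := sqr_ge0 (t * cabs (f x) - cabs (g x)); nra.
Qed.

Lemma cinteg_ip f g : L2 f -> L2 g -> cinteg (fun x => f x * (g x)^*).
Proof.
move=> Lf Lg; apply: cinteg_le (L2_mul Lf Lg) _.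
  by apply: cmeasM; [|apply: cmeas_conj]; exact: L2_cmeas.
by move=> x; rewrite cabsM cabs_conj.
Qed.

Lemma cauchy_schwarz f g : L2 f -> L2 g -> cabs (ip f g) <= l2norm f * l2norm g.
Proof.
move=> Lf Lg; apply: le_trans (cauchy_schwarz_abs Lf Lg).
apply: cabs_cint_le (L2_mul Lf Lg) _; first exact/cinteg_meas/cinteg_ip.
by move=> x; rewrite cabsM cabs_conj.
Qed.

Lemma ipDl f g h : L2 f -> L2 g -> L2 h ->
  ip (fun x => f x + g x) h = ip f h + ip g h.
Proof.
move=> Lf Lg Lh; rewrite /ip -cintD; [|exact: cinteg_ip..].
by apply: cint_ext => x; rewrite mulrDl.
Qed.

Lemma ipZl (a : R[i]) f h : L2 f -> L2 h -> ip (fun x => a * f x) h = a * ip f h.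
Proof.
move=> Lf Lh; rewrite /ip -cintZ; last exact: cinteg_ip.
by apply: cint_ext => x; rewrite mulrA.
Qed.

Lemma ipC f g : L2 f -> L2 g -> ip g f = (ip f g)^*.
Proof.
move=> Lf Lg; rewrite /ip -cint_conj; last exact: cinteg_ip.
by apply: cint_ext => x; rewrite rmorphM /= conjCK mulrC.
Qed.

Lemma ipDr f g h : L2 f -> L2 g -> L2 h ->
  ip h (fun x => f x + g x) = ip h f + ip h g.
Proof.
move=> Lf Lg Lh; rewrite ipC //; last exact: L2D.
by rewrite ipDl // rmorphD /= -!ipC.
Qed.

Lemma ipZr (a : R[i]) f h : L2 f -> L2 h -> ip h (fun x => a * f x) = a^* * ip h f.
Proof.
move=> Lf Lh; rewrite ipC //; last exact: L2Z.
by rewrite ipZl // rmorphM /= -ipC.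
Qed.

Lemma ipBl f g h : L2 f -> L2 g -> L2 h ->
  ip (fun x => f x - g x) h = ip f h - ip g h.
Proof.
move=> Lf Lg Lh; rewrite -mulN1r -ipZl // -ipDl //; last exact: L2Z.
by congr ip; apply/funext => x; rewrite mulN1r.
Qed.

Lemma ipBr f g h : L2 f -> L2 g -> L2 h ->
  ip h (fun x => f x - g x) = ip h f - ip h g.
Proof.
move=> Lf Lg Lh; rewrite ipC //; last exact: L2B.
by rewrite ipBl // rmorphB /= -!ipC.
Qed.

Lemma ip_ae f g f' g' : L2 f -> L2 g -> cmeas f' -> cmeas g' ->
  aeeq f f' -> aeeq g g' -> ip f g = ip f' g'.
Proof.
move=> Lf Lg mf mg ff gg; apply: cint_ae; first exact/cinteg_meas/cinteg_ip.
  by apply: cmeasM => //; exact: cmeas_conj.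
by apply: ae_mono2 ff gg => x -> ->.
Qed.

Lemma ipff f : ip f f = Complex (l2norm f ^+ 2) 0.
Proof.
rewrite l2norm_sq /ip /cint; under eq_Rintegral do rewrite mulc_conj /=.
congr Complex; under eq_Rintegral do rewrite mulc_conj /=.
by rewrite Rintegral_cst // mul0r.
Qed.

Lemma ip_suml (I : Type) (r : seq I) (F : I -> cfun R) g : (forall i, L2 (F i)) -> L2 g ->
  ip (fun x => \sum_(i <- r) F i x) g = \sum_(i <- r) ip (F i) g.
Proof.
move=> LF Lg; elim: r => [|i r ih].
  rewrite big_nil -[RHS]cint0; apply: cint_ext => x; by rewrite big_nil mul0r.
rewrite big_cons -ih -ipDl //; last exact: L2_sum.
by congr ip; apply/funext => x; rewrite big_cons.
Qed.

Lemma ip_sumr (I : Type) (r : seq I) (F : I -> cfun R) g : (forall i, L2 (F i)) -> L2 g ->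
  ip g (fun x => \sum_(i <- r) F i x) = \sum_(i <- r) ip g (F i).
Proof.
move=> LF Lg; rewrite ipC //; last exact: L2_sum.
rewrite ip_suml // rmorph_sum; apply: eq_bigr => i _; by rewrite /= -ipC.
Qed.

Lemma l2normD_sq f g : L2 f -> L2 g -> l2norm (fun x => f x + g x) ^+ 2 =
  l2norm f ^+ 2 + 2 * complex.Re (ip f g) + l2norm g ^+ 2.
Proof.
move=> Lf Lg; transitivity (complex.Re (ip (fun x => f x + g x) (fun x => f x + g x))).
  by rewrite ipff.
rewrite ipDl ?ipDr //; [|exact: L2D..].
by rewrite (ipC Lf Lg) !ipff !cE /=; ring.
Qed.

Lemma l2normD f g : L2 f -> L2 g -> l2norm (fun x => f x + g x) <= l2norm f + l2norm g.
Proof.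
move=> Lf Lg; rewrite -(@ler_pXn2r _ 2) ?nnegrE ?addr_ge0 ?l2norm_ge0 //.
have := cauchy_schwarz Lf Lg; have := Re_le_cabs (ip f g).
move=> /(le_trans (ler_norm _)) h1 /(le_trans h1).
by rewrite l2normD_sq // sqrrD => h; rewrite mulr2n; lra.
Qed.

Lemma l2normB f g : L2 f -> L2 g -> l2norm (fun x => f x - g x) <= l2norm f + l2norm g.
Proof. by move=> Lf Lg; rewrite -[l2norm g]l2normN; apply: l2normD => //; exact: L2N. Qed.

Lemma l2norm_sum (I : Type) (r : seq I) (F : I -> cfun R) : (forall i, L2 (F i)) ->
  l2norm (fun x => \sum_(i <- r) F i x) <= \sum_(i <- r) l2norm (F i).
Proof.
move=> LF; elim: r => [|i r ih].
  by rewrite big_nil; under eq_fun do rewrite big_nil; rewrite l2norm0.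
rewrite big_cons; under eq_fun do rewrite big_cons.
by rewrite (le_trans (l2normD _ _)) ?lerD2l //; exact: L2_sum.
Qed.

Lemma cvg_cabs (z : nat -> R[i]) (w : R[i]) :
  (fun n => cabs (z n - w)) @ \oo --> 0 -> (fun n => cabs (z n)) @ \oo --> cabs w.
Proof.
move=> /cvg0P h; apply/cvgrPdist_lt => e e0; have [N hN] := h e e0.
exists N => // n /= /hN; rewrite ger0_norm ?cabs_ge0 //; apply: le_lt_trans.
have h1 := cabsD (z n - w) w; have h2 := cabsD (w - z n) (z n).
by move: h1 h2; rewrite !subrK (cabsB w) => h1 h2; rewrite ler_norml; apply/andP; split; lra.
Qed.

(** Fatou on the squared moduli. Membership in L^2 comes out together with the bound, so a pointwise
    limit needs no separate argument to be an element of the space. *)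
Lemma fatou_l2 (F : nat -> cfun R) f (C : R) : (forall n, L2 (F n)) -> cmeas f ->
  (forall n, l2norm (F n) <= C) ->
  (forall x, (fun n => cabs (F n x - f x)) @ \oo --> 0) ->
  L2 f /\ l2norm f <= C.
Proof.
move=> LF mf FC Ff; have C0 : 0 <= C := le_trans (l2norm_ge0 _) (FC 0%N).
apply: nsq_le => //.
have cv x : (csq (F n x))%:E @[n --> \oo] --> (csq (f x))%:E.
  suff cvf : (fun n => csq (F n x)) @ \oo --> csq (f x).
    by apply: cvg_EFin; [exact: nearW|exact: cvf].
  have -> : (fun n => csq (F n x)) = (fun n => cabs (F n x) * cabs (F n x)).
    by apply/funext => n; rewrite -cabs_sq expr2.
  by rewrite -cabs_sq expr2; apply: cvgM; exact: cvg_cabs.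
rewrite /nsq.
have -> : (\int[mu]_x (csq (f x))%:E = \int[mu]_x limn_einf (fun n => (csq (F n x))%:E))%E.
  by apply: eq_integral => x _; rewrite (cvg_limn_einf_sup (cv x)).1.
apply: le_trans (fatou _ _ _ _) _ => //.
- by move=> n; exact/measurable_EFinP/measurable_csq/L2_cmeas.
- by move=> n x _; rewrite lee_fin csq_ge0.
rewrite limn_einf_lim; apply: lime_le; first exact: is_cvg_einfs.
apply: nearW => n; apply: le_trans (_ : nsq (F n) <= _)%E.
  by apply: ereal_inf_lbound; exists n => /=.
by rewrite nsqE // lee_fin ler_pXn2r // nnegrE l2norm_ge0.
Qed.

End L2Theory.

(** * Fubini *)

Section ParametricIntegral.
Variable R : realType.
Local Notation mu := (@lebesgue_measure R).

Lemma measurable_int_param (F : R * R -> \bar R) : measurable_fun setT F ->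
  (forall p, (0 <= F p)%E) -> measurable_fun setT (fun x => \int[mu]_t F (x, t))%E.
Proof. by move=> mF F0; exact: (measurable_fun_fubini_tonelli_F (m2 := mu) F mF F0). Qed.

Lemma measurable_Rint_param (F : R * R -> R) : measurable_fun setT F ->
  measurable_fun setT (fun x => \int[mu]_t F (x, t)).
Proof.
move=> mF; have mE : measurable_fun setT (EFin \o F) by exact/measurable_EFinP.
rewrite /Rintegral; apply: (measurableT_comp (@fine_measurable R setT measurableT)).
rewrite (_ : (fun x => _) = (fun x => \int[mu]_t ((EFin \o F)^\+ (x, t)) -
    \int[mu]_t ((EFin \o F)^\- (x, t)))%E).
  by apply: emeasurable_funB;
    [exact: (measurable_int_param (measurable_funepos mE))
    |exact: (measurable_int_param (measurable_funeneg mE))].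
apply/funext => x; rewrite integralE; congr (_ - _)%E; apply: eq_integral => t _;
  by rewrite ?(funeposE, funenegE).
Qed.

Lemma cmeas_cint_param (F : R * R -> R[i]) : cmeas F ->
  cmeas (fun x => cint (fun t => F (x, t))).
Proof.
by move=> [m1 m2]; split; [exact: (measurable_Rint_param m1)|exact: (measurable_Rint_param m2)].
Qed.

Lemma cmeas_pair1 (F : R * R -> R[i]) (x : R) : cmeas F -> cmeas (fun t => F (x, t)).
Proof. by move=> mF; apply: (cmeas_comp mF); exact: pair1_measurable. Qed.

Lemma cmeas_pair2 (F : R * R -> R[i]) (t : R) : cmeas F -> cmeas (fun x => F (x, t)).
Proof. by move=> mF; apply: (cmeas_comp mF); exact: pair2_measurable. Qed.

Lemma cmeas_swap (F : R * R -> R[i]) : cmeas F -> cmeas (fun p => F (p.2, p.1)).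
Proof. by move=> mF; apply: (cmeas_comp mF); exact: measurable_fun_pair. Qed.

Section Fubini.
Variable F : R * R -> R.
Hypothesis mF : measurable_fun setT F.
Hypothesis Foo : (\int[mu]_x \int[mu]_t `|F (x, t)|%:E < +oo)%E.

Let iF : (mu \x mu)%E.-integrable setT (EFin \o F).
Proof. by apply/integrable12ltyP => //; exact/measurable_EFinP. Qed.

Let ae1 : {ae mu, forall x, rinteg (fun t => F (x, t))} := ae_integrable1 iF.

(** Only almost every section is integrable, so the real-valued inner integral, which passes through
    [fine], matches the extended one almost everywhere. *)
Let inner1 : ae_eq mu setT (fun x => \int[mu]_t (EFin \o F) (x, t))%E
  (fun x => (\int[mu]_t F (x, t))%:E).
Proof. by apply: ae_mono ae1 => x ix _; rewrite -rinteg_fin. Qed.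

Let ae2 : {ae mu, forall t, rinteg (fun x => F (x, t))} := ae_integrable2 iF.

Let inner2 : ae_eq mu setT (fun t => \int[mu]_x (EFin \o F) (x, t))%E
  (fun t => (\int[mu]_x F (x, t))%:E).
Proof. by apply: ae_mono ae2 => x ix _; rewrite -rinteg_fin. Qed.

Let mS : measurable_fun setT (fun t => \int[mu]_x F (x, t)).
Proof.
apply: (measurable_Rint_param (F := fun p => F (p.2, p.1))).
by apply: (measurableT_comp mF); exact: measurable_fun_pair.
Qed.

Lemma rinteg_fubini : rinteg (fun x => \int[mu]_t F (x, t)).
Proof.
have mI := measurable_Rint_param mF.
apply/integrableP; split; first exact/measurable_EFinP.
have /integrableP[mFF hlt] := integrable_fubini_F iF; apply: le_lt_trans hlt.
rewrite le_eqVlt; apply/orP; left; apply/eqP/ae_eq_integral => //.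
- by apply: measurableT_comp => //; exact/measurable_EFinP.
- exact: measurableT_comp.
- by apply: ae_mono inner1 => x /(_ I) h _; rewrite /fubini_F h.
Qed.

Lemma rfubini : \int[mu]_x \int[mu]_t F (x, t) = \int[mu]_t \int[mu]_x F (x, t).
Proof.
have mI := measurable_Rint_param mF; rewrite /Rintegral; congr fine.
transitivity (\int[mu]_x fubini_F mu (EFin \o F) x)%E.
  apply/esym/ae_eq_integral => //; first exact: (measurable_fubini_F iF).
  exact/measurable_EFinP.
transitivity (\int[mu]_t fubini_G mu (EFin \o F) t)%E; first exact: (Fubini iF).
apply/ae_eq_integral => //; first exact: (measurable_fubini_G iF).
exact/measurable_EFinP.
Qed.

End Fubini.

Section ComplexFubini.
Variable F : R * R -> R[i].
Hypothesis mF : cmeas F.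
Hypothesis Foo : (\int[mu]_x \int[mu]_t (cabs (F (x, t)))%:E < +oo)%E.

Let mabs : measurable_fun setT (fun p => (cabs (F p))%:E).
Proof. exact/measurable_EFinP/measurable_cabs. Qed.

Let dom (G : R * R -> R) : measurable_fun setT G -> (forall p, `|G p| <= cabs (F p)) ->
  (\int[mu]_x \int[mu]_t `|G (x, t)|%:E < +oo)%E.
Proof.
move=> mG GF; apply: le_lt_trans Foo.
have mG' : measurable_fun setT (fun p => `|G p|%:E).
  by apply/measurable_EFinP; exact: measurableT_comp.
apply: ge0_le_integral => //.
- by move=> x _; apply: integral_ge0.
- apply: (measurable_int_param mG') => p; by rewrite lee_fin.
- by apply: (measurable_int_param mabs) => p; rewrite lee_fin cabs_ge0.
move=> x _; apply: ge0_le_integral => //.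
- by apply: (measurableT_comp mG'); exact: pair1_measurable.
- by apply: (measurableT_comp mabs); exact: pair1_measurable.
- by move=> t _; rewrite lee_fin GF.
Qed.

Lemma cinteg_fubini : cinteg (fun x => cint (fun t => F (x, t))).
Proof.
case: mF => m1 m2; split.
  exact: (rinteg_fubini m1 (dom m1 (fun p => Re_le_cabs (F p)))).
exact: (rinteg_fubini m2 (dom m2 (fun p => Im_le_cabs (F p)))).
Qed.

Lemma cfubini : cint (fun x => cint (fun t => F (x, t))) =
  cint (fun t => cint (fun x => F (x, t))).
Proof.
case: mF => m1 m2; apply: complex_eq.
  exact: (rfubini m1 (dom m1 (fun p => Re_le_cabs (F p)))).
exact: (rfubini m2 (dom m2 (fun p => Im_le_cabs (F p)))).
Qed.

End ComplexFubini.

Lemma cabs_cint_e (h : R -> R[i]) : cmeas h ->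
  ((cabs (cint h))%:E <= \int[mu]_x (cabs (h x))%:E)%E.
Proof.
move=> mh; have [hoo|] := ltP (\int[mu]_x (cabs (h x))%:E)%E +oo%E; last first.
  by rewrite leye_eq => /eqP ->; rewrite leey.
have ih := cinteg_lty mh hoo.
by rewrite rinteg_fin ?lee_fin ?cabs_cint //; exact: cinteg_cabs.
Qed.

End ParametricIntegral.

(** * Averages over the unit interval *)

Section Average.
Variable R : realType.
Local Notation mu := (@lebesgue_measure R).

Definition ibox (t : R) : R := \1_(`[0%R, 1%R]%classic) t.

Definition box (t : R) : R[i] := Complex (ibox t) 0.

(** Weighting by the indicator keeps every integral on the whole line, so that the results on
    [cint], [ip] and translation apply directly. *)
Definition avg (F : R -> R[i]) : R[i] := cint (fun t => box t * F t).

Lemma ibox_ge0 t : 0 <= ibox t.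
Proof. by rewrite /ibox indicE. Qed.

Lemma ibox_in t : 0 <= t <= 1 -> ibox t = 1.
Proof. by move=> h; rewrite /ibox indicE mem_set //= in_itv. Qed.

Lemma ibox_out t : ~~ (0 <= t <= 1) -> ibox t = 0.
Proof. by move=> h; rewrite /ibox indicE memNset //= in_itv /=; exact/negP. Qed.

Lemma ibox_sq t : ibox t ^+ 2 = ibox t.
Proof.
by have [h|h] := boolP (0 <= t <= 1); rewrite ?(ibox_in h) ?(ibox_out h) ?expr1n ?expr0n.
Qed.

Lemma measurable_ibox : measurable_fun setT ibox.
Proof. exact: measurable_indic. Qed.

Lemma cmeas_box : cmeas box.
Proof. exact: (cmeas_real measurable_ibox). Qed.

Lemma cabs_box t : cabs (box t) = ibox t.
Proof. by rewrite cabs_real ger0_norm ?ibox_ge0. Qed.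

Lemma csq_box t : csq (box t) = ibox t.
Proof. by rewrite csq_real ibox_sq. Qed.

Lemma int_ibox : (\int[mu]_t (ibox t)%:E = 1)%E.
Proof.
rewrite integral_indic // setIT.
have := @lebesgue_measure_itv R `[0%R, 1%R].
by rewrite /= lte_fin ltr01 oppr0 adde0.
Qed.

Lemma rinteg_ibox : rinteg ibox.
Proof.
apply: rinteg_lty; [exact: measurable_ibox|exact: ibox_ge0|].
by rewrite int_ibox ltry.
Qed.

Lemma Rint_ibox : \int[mu]_t ibox t = 1.
Proof. by rewrite /Rintegral int_ibox. Qed.

Lemma L2_box : L2 box.
Proof.
have [m1 m2] := cmeas_box; split=> //; split=> //.
by under eq_integral do rewrite csq_box; rewrite int_ibox ltry.
Qed.

Lemma l2norm_box : l2norm box = 1.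
Proof. by rewrite /l2norm; under eq_Rintegral do rewrite csq_box; rewrite Rint_ibox sqrtr1. Qed.

Lemma measurable_boxM (F : R -> R) : measurable_fun setT F ->
  measurable_fun setT (fun t => ibox t * F t).
Proof. by move=> mF; apply: measurable_funM => //; exact: measurable_ibox. Qed.

(** Cauchy-Schwarz against [box], which has norm 1: the square of a mean is at most the mean of the
    squares. The extended reals let the case of an infinite right-hand side pass trivially. *)
Lemma jensen_box (F : R -> R[i]) (a : R) : cmeas F -> 0 <= a ->
  (a%:E <= \int[mu]_t (ibox t * cabs (F t))%:E)%E ->
  ((a ^+ 2)%:E <= \int[mu]_t (ibox t * csq (F t))%:E)%E.
Proof.
move=> mF a0 ha; pose k t := box t * F t.
have kE t : csq (k t) = ibox t * csq (F t) by rewrite csqM csq_box.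
have [joo|] := ltP (\int[mu]_t (ibox t * csq (F t))%:E)%E +oo%E; last first.
  by rewrite leye_eq => /eqP ->; rewrite leey.
have mk : cmeas k by apply: cmeasM => //; exact: cmeas_box.
have Lk : L2 k.
  have [m1 m2] := mk; split=> //; split=> //.
  by under eq_integral do rewrite kE.
have <- : nsq k = (\int[mu]_t (ibox t * csq (F t))%:E)%E.
  by apply: eq_integral => t _; rewrite kE.
rewrite nsqE // lee_fin ler_pXn2r ?nnegrE ?l2norm_ge0 //.
rewrite -[l2norm k]mulr1 -l2norm_box; apply: le_trans (cauchy_schwarz_abs Lk L2_box).
rewrite -lee_fin -rinteg_fin; last by apply: L2_mul => //; exact: L2_box.
apply: le_trans ha _; rewrite le_eqVlt; apply/orP; left; apply/eqP/eq_integral => t _.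
by rewrite cabsM !cabs_box mulrAC -expr2 ibox_sq.
Qed.

(** Minkowski's inequality for a mean of functions: Jensen at each [x], then Tonelli. Only a
    pointwise inequality ties [g] to [Phi], so the bound serves commutators as well as averages. *)
Lemma avg_dom (g : cfun R) (Phi : R * R -> R[i]) (C : R) :
  cmeas g -> cmeas Phi -> 0 <= C ->
  (forall t, 0 <= t <= 1 -> (nsq (fun x => Phi (x, t)) <= (C ^+ 2)%:E)%E) ->
  (forall x, ((cabs (g x))%:E <= \int[mu]_t (ibox t * cabs (Phi (x, t)))%:E)%E) ->
  L2 g /\ l2norm g <= C.
Proof.
move=> mg mPhi C0 hPhi hg; apply: nsq_le => //.
have mJ : measurable_fun setT (fun p : R * R => (ibox p.2 * csq (Phi p))%:E).
  apply/measurable_EFinP; apply: measurable_funM; last exact: measurable_csq.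
  by apply: (measurableT_comp measurable_ibox); exact: measurable_snd.
have J0 (p : R * R) : (0 <= (ibox p.2 * csq (Phi p))%:E)%E.
  by rewrite lee_fin mulr_ge0 ?ibox_ge0 ?csq_ge0.
apply: (@le_trans _ _ (\int[mu]_x \int[mu]_t (ibox t * csq (Phi (x, t)))%:E)%E).
  apply: ge0_le_integral => //.
  - by move=> x _; rewrite lee_fin csq_ge0.
  - exact/measurable_EFinP/measurable_csq.
  - exact: (measurable_int_param mJ J0).
  move=> x _; rewrite -cabs_sq; apply: jensen_box (hg x); last exact: cabs_ge0.
  exact: cmeas_pair1.
have /= -> := fubini_tonelli (m1 := mu) (m2 := mu) _ mJ J0.
apply: (@le_trans _ _ (\int[mu]_t (ibox t * C ^+ 2)%:E)%E).
  apply: ge0_le_integral => //.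
  - by move=> t _; apply: integral_ge0 => x _; exact: (J0 (x, t)).
  - exact: (measurable_fun_fubini_tonelli_G (m1 := mu) _ mJ J0).
  - by apply/measurable_EFinP; exact: measurable_boxM.
  move=> t _; have mP := cmeas_pair2 t mPhi.
  have -> : (\int[mu]_x (ibox t * csq (Phi (x, t)))%:E =
      (ibox t)%:E * nsq (fun x => Phi (x, t)))%E.
    rewrite /nsq -ge0_integralZl //; last by rewrite lee_fin ibox_ge0.
      exact/measurable_EFinP/measurable_csq.
    by move=> x _; rewrite lee_fin csq_ge0.
  have [h|h] := boolP (0 <= t <= 1); last by rewrite (ibox_out h) mul0e mul0r.
  by rewrite (ibox_in h) mul1e mul1r; exact: hPhi.
under eq_integral do rewrite mulrC EFinM.
rewrite ge0_integralZl_EFin ?int_ibox ?mule1 ?sqr_ge0 //.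
  by move=> t _; rewrite lee_fin ibox_ge0.
by apply/measurable_EFinP; exact: measurable_ibox.
Qed.

Lemma cmeas_avg (Phi : R * R -> R[i]) : cmeas Phi -> cmeas (fun x => avg (fun t => Phi (x, t))).
Proof.
move=> mPhi; apply: (cmeas_cint_param (F := fun p => box p.2 * Phi p)).
by apply: cmeasM => //; apply: (cmeas_comp cmeas_box); exact: measurable_snd.
Qed.

Lemma avg_le_e (F : R -> R[i]) : cmeas F ->
  ((cabs (avg F))%:E <= \int[mu]_t (ibox t * cabs (F t))%:E)%E.
Proof.
move=> mF; apply: le_trans (cabs_cint_e (cmeasM cmeas_box mF)) _.
rewrite le_eqVlt; apply/orP; left; apply/eqP/eq_integral => t _.
by rewrite cabsM cabs_box.
Qed.

Lemma L2_avg (Phi : R * R -> R[i]) (C : R) : cmeas Phi -> 0 <= C ->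
  (forall t, 0 <= t <= 1 -> (nsq (fun x => Phi (x, t)) <= (C ^+ 2)%:E)%E) ->
  L2 (fun x => avg (fun t => Phi (x, t))) /\
  l2norm (fun x => avg (fun t => Phi (x, t))) <= C.
Proof.
move=> mPhi C0 hPhi; apply: (avg_dom _ mPhi C0 hPhi); first exact: cmeas_avg.
by move=> x; apply: avg_le_e; exact: cmeas_pair1.
Qed.

Lemma cinteg_box (F : R -> R[i]) : L2 F -> cinteg (fun t => box t * F t).
Proof.
move=> LF; have := cinteg_ip L2_box (L2_conj LF); under eq_fun do rewrite conjCK.
by [].
Qed.

Lemma cinteg_box_bounded (F : R -> R[i]) (C : R) : cmeas F ->
  (forall t, 0 <= t <= 1 -> cabs (F t) <= C) -> cinteg (fun t => box t * F t).
Proof.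
move=> mF FC; apply: (cinteg_le (G := fun t => C * ibox t)).
- by apply: cmeasM => //; exact: cmeas_box.
- exact: (rintegZ _ rinteg_ibox).
move=> t; rewrite cabsM cabs_box mulrC.
have [h|h] := boolP (0 <= t <= 1); last by rewrite (ibox_out h) !mulr0.
by rewrite (ibox_in h) !mulr1; exact: FC.
Qed.

Lemma avg_le (F : R -> R[i]) (C : R) : cmeas F ->
  (forall t, 0 <= t <= 1 -> cabs (F t) <= C) -> cabs (avg F) <= C.
Proof.
move=> mF FC.
have -> : C = \int[mu]_t (C * ibox t).
  by rewrite RintegralZl ?Rint_ibox ?mulr1 //; exact: rinteg_ibox.
apply: cabs_cint_le; [by apply: cmeasM => //; exact: cmeas_box|exact: (rintegZ _ rinteg_ibox)|].
move=> t; rewrite cabsM cabs_box mulrC.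
have [h|h] := boolP (0 <= t <= 1); last by rewrite (ibox_out h) !mulr0.
by rewrite (ibox_in h) !mulr1; exact: FC.
Qed.

Lemma avgD (F G : R -> R[i]) : cinteg (fun t => box t * F t) ->
  cinteg (fun t => box t * G t) -> avg (fun t => F t + G t) = avg F + avg G.
Proof. by move=> iF iG; rewrite /avg -cintD //; apply: cint_ext => t; rewrite mulrDr. Qed.

Lemma avgZ (a : R[i]) (F : R -> R[i]) : cinteg (fun t => box t * F t) ->
  avg (fun t => a * F t) = a * avg F.
Proof. by move=> iF; rewrite /avg -cintZ //; apply: cint_ext => t; rewrite mulrCA. Qed.

Lemma avgB (F G : R -> R[i]) : cinteg (fun t => box t * F t) ->
  cinteg (fun t => box t * G t) -> avg (fun t => F t - G t) = avg F - avg G.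
Proof. by move=> iF iG; rewrite /avg -cintB //; apply: cint_ext => t; rewrite mulrBr. Qed.

Lemma conj_box t : (box t)^* = box t.
Proof. by apply: complex_eq; rewrite cE //= oppr0. Qed.

Lemma avg_conj (F : R -> R[i]) : cinteg (fun t => box t * F t) ->
  (avg F)^* = avg (fun t => (F t)^*).
Proof.
by move=> iF; rewrite /avg -cint_conj //; apply: cint_ext => t; rewrite rmorphM /= conj_box.
Qed.

Lemma avg_eq (F G : R -> R[i]) : (forall t, 0 <= t <= 1 -> F t = G t) -> avg F = avg G.
Proof.
move=> FG; apply: cint_ext => t; have [h|h] := boolP (0 <= t <= 1); first by rewrite FG.
have -> : box t = 0 by rewrite /box ibox_out.
by rewrite !mul0r.
Qed.

Lemma avg_cst (a : R[i]) : avg (fun=> a) = a.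
Proof.
have ib : cinteg box by split; [exact: rinteg_ibox|exact: integrable0].
rewrite /avg; under cint_ext do rewrite mulrC.
rewrite cintZ // -[RHS]mulr1; congr (_ * _); apply: complex_eq; rewrite /= ?Rint_ibox //.
by rewrite Rintegral_cst // mul0r.
Qed.

(** Fubini, justified by Cauchy-Schwarz in [x] for each [t]. Through this exchange a mean of
    operators inherits the linear relations and the adjoints of the operators averaged. *)
Lemma ip_avg (Phi : R * R -> R[i]) (C : R) (g : cfun R) : cmeas Phi -> 0 <= C ->
  (forall t, 0 <= t <= 1 -> (nsq (fun x => Phi (x, t)) <= (C ^+ 2)%:E)%E) ->
  (forall x, cinteg (fun t => box t * Phi (x, t))) -> L2 g ->
  cinteg (fun t => box t * ip (fun x => Phi (x, t)) g) /\
  ip (fun x => avg (fun t => Phi (x, t))) g = avg (fun t => ip (fun x => Phi (x, t)) g).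
Proof.
move=> mPhi C0 hPhi iPhi Lg; have mg := L2_cmeas Lg.
pose F (p : R * R) := box p.2 * (Phi p * (g p.1)^*).
have mF : cmeas F.
  apply: cmeasM; first by apply: (cmeas_comp cmeas_box); exact: measurable_snd.
  apply: cmeasM => //; apply: (cmeas_conj (cmeas_comp mg _)); exact: measurable_fst.
have mabs : measurable_fun setT (fun p => (cabs (F p))%:E).
  exact/measurable_EFinP/measurable_cabs.
have abs0 p : (0 <= (cabs (F p))%:E)%E by rewrite lee_fin cabs_ge0.
have LP t : 0 <= t <= 1 -> L2 (fun x => Phi (x, t)) /\ l2norm (fun x => Phi (x, t)) <= C.
  by move=> h; apply: nsq_le => //; [exact: cmeas_pair2|exact: hPhi].
have hoo : (\int[mu]_t \int[mu]_x (cabs (F (x, t)))%:E < +oo)%E.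
  apply: (@le_lt_trans _ _ (\int[mu]_t (C * l2norm g * ibox t)%:E)%E); last first.
    rewrite rinteg_fin ?ltry //; exact: (rintegZ _ rinteg_ibox).
  apply: ge0_le_integral => //.
  - by move=> t _; apply: integral_ge0 => x _; exact: abs0.
  - exact: (measurable_fun_fubini_tonelli_G (m1 := mu) _ mabs abs0).
  - by apply/measurable_EFinP; apply: measurable_funM => //; exact: measurable_ibox.
  move=> t _; rewrite /F /=; have [h|h] := boolP (0 <= t <= 1); last first.
    have -> : box t = 0 by rewrite /box ibox_out.
    rewrite ibox_out // mulr0.
    by under eq_integral do rewrite mul0r cabs0; rewrite integral0.
  have [Lt tC] := LP t h.
  rewrite ibox_in // mulr1.
  have -> : (\int[mu]_x (cabs (box t * (Phi (x, t) * (g x)^*)))%:E =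
      \int[mu]_x (cabs (Phi (x, t)) * cabs (g x))%:E)%E.
    by apply: eq_integral => x _; rewrite !cabsM cabs_box ibox_in // mul1r cabs_conj.
  rewrite rinteg_fin; last exact: L2_mul.
  rewrite lee_fin; apply: le_trans (cauchy_schwarz_abs Lt Lg) _.
  by rewrite ler_wpM2r ?l2norm_ge0.
have inner t : cint (fun x => F (x, t)) = box t * ip (fun x => Phi (x, t)) g.
  rewrite /F /=; have [h|h] := boolP (0 <= t <= 1); last first.
    have -> : box t = 0 by rewrite /box ibox_out.
    by rewrite mul0r; under cint_ext do rewrite mul0r; rewrite cint0.
  have -> : box t = 1 by rewrite /box ibox_in.
  by rewrite mul1r; apply: cint_ext => x; rewrite mul1r.
have hoo' : (\int[mu]_x \int[mu]_t (cabs (F (x, t)))%:E < +oo)%E.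
  by have /= -> := fubini_tonelli (m1 := mu) (m2 := mu) _ mabs abs0.
split.
  have := cinteg_fubini (cmeas_swap mF) hoo; rewrite /=.
  by under eq_fun do rewrite inner.
rewrite /avg; under [RHS]cint_ext do rewrite -inner.
rewrite -(cfubini mF hoo'); apply: cint_ext => x.
rewrite /F /= mulrC -cintZ //; apply: cint_ext => t.
by rewrite mulrCA mulrA mulrAC !mulrA [_ * (g x)^*]mulrC mulrA.
Qed.

End Average.

(** * Averaging operators *)

Section StrongOp.
Variable R : realType.
Local Notation mu := (@lebesgue_measure R).
Implicit Types (S T : op R) (f g : cfun R).

(* Linearity holds everywhere rather than almost everywhere; every operator built below has
   this property, and it makes the a.e. clauses of [is_bounded_op] automatic. *)
Definition strong_op T (C : R) : Prop :=
  [/\ 0 <= C,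
      forall (a : R[i]) f g, L2 f -> L2 g ->
        T (fun x => a * f x + g x) = (fun x => a * T f x + T g x),
      forall f, L2 f -> L2 (T f) &
      forall f, L2 f -> l2norm (T f) <= C * l2norm f].

Lemma strong_L2 T C f : strong_op T C -> L2 f -> L2 (T f).
Proof. by case=> _ _ h _; exact: h. Qed.

Lemma strong_norm T C f : strong_op T C -> L2 f -> l2norm (T f) <= C * l2norm f.
Proof. by case=> _ _ _ h; exact: h. Qed.

Lemma strong0 T C : strong_op T C -> T (fun=> 0) = (fun=> 0).
Proof.
move=> [_ h _ _]; have := h (-1) _ _ (L2_0 R) (L2_0 R).
under eq_fun do rewrite mulr0 addr0; move=> ->.
by apply/funext => x; rewrite mulN1r addNr.
Qed.

Lemma strongZ T C (a : R[i]) f : strong_op T C -> L2 f ->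
  T (fun x => a * f x) = (fun x => a * T f x).
Proof.
move=> sT Lf; have [_ h _ _] := sT; have := h a _ _ Lf (L2_0 R).
under eq_fun do rewrite addr0; move=> ->.
by apply/funext => x; rewrite (strong0 sT) addr0.
Qed.

Lemma strongB T C f g : strong_op T C -> L2 f -> L2 g ->
  T (fun x => f x - g x) = (fun x => T f x - T g x).
Proof.
move=> sT Lf Lg; have [_ h _ _] := sT; have := h (-1) _ _ Lg Lf.
under eq_fun do rewrite mulN1r addrC; move=> ->; apply/funext => x.
by rewrite mulN1r addrC.
Qed.

Lemma strong_bounded T C : strong_op T C -> is_bounded_op T.
Proof.
move=> sT; have [C0 lT LT bT] := sT; split => //; split; last split.
- move=> f g Lf Lg fg.
  have Lfg := L2B Lf Lg.
  have n0 : l2norm (fun x => f x - g x) = 0.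
    rewrite -(l2norm0 R); apply: l2norm_ae; [exact: L2_cmeas|exact/L2_cmeas/L2_0|].
    by apply: ae_mono fg => x ->; rewrite subrr.
  have : aeeq (T (fun x => f x - g x)) (fun=> 0).
    apply: l2norm_eq0; first exact: LT.
    by apply/eqP; rewrite eq_le l2norm_ge0 andbT (le_trans (bT _ Lfg)) // n0 mulr0.
  rewrite (strongB sT) //; apply: ae_mono => x /eqP.
  by rewrite subr_eq0 => /eqP.
- by move=> a f g Lf Lg; rewrite lT //; exact: aeeq_refl.
- by exists C.
Qed.

Lemma strong_add S T C D : strong_op S C -> strong_op T D ->
  strong_op (fun f x => S f x + T f x) (C + D).
Proof.
move=> [C0 lS LS bS] [D0 lT LT bT]; split.
- exact: addr_ge0.
- move=> a f g Lf Lg; rewrite lS // lT //; apply/funext => x; ring.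
- by move=> f Lf; apply: L2D; [exact: LS|exact: LT].
- move=> f Lf; rewrite mulrDl (le_trans (l2normD (LS f Lf) (LT f Lf))) //.
  by rewrite lerD ?bS ?bT.
Qed.

Lemma strong_scale T C (a : R[i]) : strong_op T C ->
  strong_op (fun f x => a * T f x) (cabs a * C).
Proof.
move=> [C0 lT LT bT]; split.
- by rewrite mulr_ge0 ?cabs_ge0.
- move=> b f g Lf Lg; rewrite lT //; apply/funext => x; ring.
- by move=> f Lf; apply: L2Z; exact: LT.
- move=> f Lf; rewrite l2normZ; last exact: LT.
  by rewrite -mulrA ler_wpM2l ?cabs_ge0 ?bT.
Qed.

Lemma strong_sub S T C D : strong_op S C -> strong_op T D ->
  strong_op (fun f x => S f x - T f x) (C + D).
Proof.
move=> sS /(strong_scale (-1)); rewrite cabsN cabs1 mul1r => sT.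
by have := strong_add sS sT; under eq_fun do under eq_fun do rewrite mulN1r.
Qed.

Lemma strong_comp S T C D : strong_op S C -> strong_op T D ->
  strong_op (fun f => S (T f)) (C * D).
Proof.
move=> [C0 lS LS bS] [D0 lT LT bT]; split.
- exact: mulr_ge0.
- by move=> a f g Lf Lg; rewrite lT // lS //; exact: LT.
- by move=> f Lf; apply/LS/LT.
- move=> f Lf; rewrite (le_trans (bS _ (LT f Lf))) // -mulrA ler_wpM2l //; exact: bT.
Qed.

Lemma strong_zero : strong_op (fun _ _ => 0) 0.
Proof.
split => //.
- by move=> a f g _ _; apply/funext => x; rewrite mulr0 addr0.
- by move=> f _; exact: L2_0.
- by move=> f _; rewrite l2norm0 mul0r.
Qed.

Lemma strong_sum (F : nat -> op R) (C : nat -> R) N : (forall j, strong_op (F j) (C j)) ->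
  strong_op (fun f x => \sum_(j < N) F j f x) (\sum_(j < N) C j).
Proof.
move=> sF; elim: N => [|N ih].
  rewrite big_ord0; under eq_fun do under eq_fun do rewrite big_ord0; exact: strong_zero.
rewrite big_ord_recr; under eq_fun do under eq_fun do rewrite big_ord_recr /=.
exact: strong_add.
Qed.

Definition Mop (u : R -> R[i]) : op R := fun f x => u x * f x.

Lemma strong_Mop u C : cmeas u -> (forall x, cabs (u x) <= C) -> strong_op (Mop u) C.
Proof.
move=> mu_ uC; split.
- exact: le_trans (cabs_ge0 (u 0)) (uC 0).
- by move=> a f g _ _; apply/funext => x; rewrite /Mop mulrDr mulrCA.
- by move=> f Lf; exact: (L2M mu_ uC Lf).1.
- by move=> f Lf; exact: (L2M mu_ uC Lf).2.
Qed.

Lemma strong_transl (b : R) : strong_op (transl_op b) 1.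
Proof.
split => // f Lf; first exact: L2_shift.
by rewrite mul1r l2norm_shift //; exact: L2_cmeas.
Qed.

Lemma ip_transl (b : R) f g : L2 f -> L2 g ->
  ip (fun x => f (x - b)) g = ip f (fun x => g (x + b)).
Proof.
move=> Lf Lg; rewrite /ip -(@cint_shift _ (fun x => f x * (g (x + b))^*) b).
  by apply: cint_ext => x; rewrite subrK.
apply: cmeasM; first exact: L2_cmeas.
by apply: cmeas_conj; have := cmeas_shift (- b) (L2_cmeas Lg); under eq_fun do rewrite opprK.
Qed.

End StrongOp.

(** * Averages of translates along a segment *)

Section BoxOperators.
Variable R : realType.
Local Notation mu := (@lebesgue_measure R).
Implicit Types (f g : cfun R).

Definition Bop (c : R) : op R := fun f x => avg (fun t => f (x - c * t)).

Lemma cmeas_affine f (x c : R) : cmeas f -> cmeas (fun t : R => f (x - c * t)).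
Proof.
move=> mf; apply: (cmeas_comp mf); apply: measurable_funB => //.
Qed.

Lemma nsq_affine f (x c : R) : c != 0 -> cmeas f ->
  (`|c|%:E * nsq (fun t => f (x - c * t)%R) = nsq f)%E.
Proof.
move=> c0 mf; have c0' : - c != 0 by rewrite oppr_eq0.
have mf' : cmeas (fun y => f (x + y)).
  by have := cmeas_shift (- x) mf; under eq_fun do rewrite opprK addrC.
transitivity (nsq (fun y => f (x + y))).
  rewrite /nsq [RHS](ge0_integral_scale c0') ?normrN.
  - by congr (_ * _)%E; apply: eq_integral => t _; rewrite mulNr.
  - exact/measurable_EFinP/measurable_csq.
  - by move=> y; rewrite lee_fin csq_ge0.
rewrite /nsq -[RHS](integral_shift (- x)); last exact/measurable_EFinP/measurable_csq.
by apply: eq_integral => y _; rewrite opprK addrC.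
Qed.

Lemma L2_affine f (x c : R) : c != 0 -> L2 f -> L2 (fun t => f (x - c * t)).
Proof.
move=> c0 Lf; have [m1 m2] := cmeas_affine x c (L2_cmeas Lf); split=> //; split=> //.
have := nsq_lty Lf; rewrite -(nsq_affine x c0 (L2_cmeas Lf)).
have cp : 0 < `|c| by rewrite normr_gt0.
rewrite /nsq; case: (integral _ _ _) => [r _| |] //; first exact: ltry.
by rewrite gt0_muley // lte_fin.
Qed.

Lemma l2norm_affine f (x c : R) : 1 <= `|c| -> L2 f ->
  l2norm (fun t => f (x - c * t)) <= l2norm f.
Proof.
move=> c1 Lf; have c0 : c != 0 by rewrite -normr_gt0 (lt_le_trans ltr01).
rewrite -(@ler_pXn2r _ 2) ?nnegrE ?l2norm_ge0 // -lee_fin -!nsqE //; last exact: L2_affine.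
rewrite -(nsq_affine x c0 (L2_cmeas Lf)) nsqE; last exact: L2_affine.
by rewrite -EFinM lee_fin ler_peMl ?sqr_ge0.
Qed.

(** Cauchy-Schwarz on an interval of length |c|, at least 1. Values at points are thus bounded
    functionals, which gives both the finite rank approximations and the pointwise convergence of
    the series of blocks. *)
Lemma Bop_pointwise (c : R) f x : 1 <= `|c| -> L2 f -> cabs (Bop c f x) <= l2norm f.
Proof.
move=> c1 Lf; have c0 : c != 0 by rewrite -normr_gt0 (lt_le_trans ltr01).
have LF := L2_affine x c0 Lf.
have -> : Bop c f x = ip (fun t => f (x - c * t)) (@box R).
  by apply: cint_ext => t; rewrite conj_box mulrC.
apply: le_trans (cauchy_schwarz LF (L2_box R)) _.
by rewrite l2norm_box mulr1 l2norm_affine.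
Qed.

Let Phi (c : R) f (p : R * R) := f (p.1 - c * p.2).

Let cmeas_Phi c f : cmeas f -> cmeas (Phi c f).
Proof.
move=> mf; apply: (cmeas_comp mf); apply: measurable_funB; first exact: measurable_fst.
by apply: measurable_funM => //; exact: measurable_snd.
Qed.

Let nsq_Phi c f t : L2 f -> (nsq (fun x => Phi c f (x, t)) <= (l2norm f ^+ 2)%:E)%E.
Proof.
move=> Lf; rewrite nsqE; last exact: (L2_shift (c * t) Lf).
by rewrite (l2norm_shift (c * t)) //; exact: L2_cmeas.
Qed.

Lemma strong_Bop (c : R) : c != 0 -> strong_op (Bop c) 1.
Proof.
move=> c0; split => //.
- move=> a f g Lf Lg; apply/funext => x; rewrite /Bop avgD ?avgZ //.
  + exact/cinteg_box/L2_affine.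
  + exact/cinteg_box/L2Z/L2_affine.
  + exact/cinteg_box/L2_affine.
- move=> f Lf; exact: (L2_avg (cmeas_Phi c (L2_cmeas Lf)) (l2norm_ge0 f) (fun t _ => nsq_Phi c t Lf)).1.
- move=> f Lf; rewrite mul1r.
  exact: (L2_avg (cmeas_Phi c (L2_cmeas Lf)) (l2norm_ge0 f) (fun t _ => nsq_Phi c t Lf)).2.
Qed.

Lemma ip_Bop_avg (c : R) f g : c != 0 -> L2 f -> L2 g ->
  cinteg (fun t => box t * ip (transl_op (c * t) f) g) /\
  ip (Bop c f) g = avg (fun t => ip (transl_op (c * t) f) g).
Proof.
move=> c0 Lf Lg.
apply: (ip_avg (cmeas_Phi c (L2_cmeas Lf)) (l2norm_ge0 f) (fun t _ => nsq_Phi c t Lf)) => // x; exact/cinteg_box/L2_affine.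
Qed.

Lemma ip_Bop (c : R) f g : c != 0 -> L2 f -> L2 g -> ip (Bop c f) g = ip f (Bop (- c) g).
Proof.
move=> c0 Lf Lg; have c0' : - c != 0 by rewrite oppr_eq0.
have [i1 ->] := ip_Bop_avg c0 Lf Lg; have [i2 e2] := ip_Bop_avg c0' Lg Lf.
rewrite [RHS](ipC (strong_L2 (strong_Bop c0') Lg) Lf) e2 (avg_conj i2); apply: avg_eq => t _.
rewrite -(ipC (L2_shift (- c * t) Lg) Lf) /transl_op (ip_transl (c * t) Lf Lg); congr ip; apply/funext => x.
by rewrite mulNr opprK.
Qed.

Lemma ibox_sym (t : R) : ibox (1 - t) = ibox t :> R.
Proof.
have [h|h] := boolP (0 <= t <= 1).
  by rewrite !ibox_in //; move: h => /andP[? ?]; apply/andP; split; lra.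
rewrite !ibox_out //; apply: contra h => /andP[? ?]; apply/andP; split; lra.
Qed.

Lemma cint_oppr (h : R -> R[i]) : cmeas h -> cint (fun x => h (- x)) = cint h.
Proof.
have E (F : R -> R) : measurable_fun setT F ->
    (\int[mu]_x (F (- x))%:E = \int[mu]_x (F x)%:E)%E.
  move=> /measurable_EFinP mF; rewrite integralE [RHS]integralE.
  rewrite (ge0_integral_oppr (measurable_funepos mF)) //.
  rewrite (ge0_integral_oppr (measurable_funeneg mF)) //.
  by congr (_ - _)%E; apply: eq_integral => x _; rewrite ?(funeposE, funenegE).
move=> [m1 m2]; rewrite /cint /Rintegral; congr (Complex (fine _) (fine _)).
  exact: (E (fun x => complex.Re (h x)) m1).
exact: (E (fun x => complex.Im (h x)) m2).
Qed.

(** The reflection t -> 1 - t turns the backward average into a forward one taken from the other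
    end, so estimates for [Bop c] carry over to its adjoint up to a shift. *)
Lemma Bop_opp (c : R) f x : c != 0 -> L2 f -> Bop (- c) f x = Bop c f (x + c).
Proof.
move=> c0 Lf; have mF : cmeas (fun t => box t * f (x + c - c * t)).
  by apply: cmeasM; [exact: cmeas_box|exact/cmeas_affine/L2_cmeas].
rewrite /Bop [RHS]/avg -(cint_oppr mF) -(@cint_shift _ (fun x0 : R => _) 1).
  apply: cint_ext => t; congr (_ * _).
    by rewrite /box opprB ibox_sym.
  by congr f; ring.
by apply: (cmeas_comp mF); exact: measurable_funN.
Qed.

Lemma cint_affine (h : R -> R[i]) (x c : R) : 0 < c -> cinteg h ->
  cint h = Complex c 0 * cint (fun s => h (x - c * s)).
Proof.
move=> c0; have c0' : - c != 0 by rewrite oppr_eq0 gt_eqF.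
have P (G : R -> \bar R) : measurable_fun setT G -> (forall x, (0 <= G x)%E) ->
    (\int[mu]_x G x = c%:E * \int[mu]_s G (x - c * s)%R)%E.
  move=> mG G0; rewrite -(integral_shift (- x) mG) (ge0_integral_scale c0') //.
  - rewrite normrN gtr0_norm //; congr (_ * _)%E; apply: eq_integral => s _.
    by rewrite opprK addrC mulNr.
  - by apply: (measurableT_comp mG); apply: measurable_funB.
have E (F : R -> R) : rinteg F -> \int[mu]_x F x = c * \int[mu]_s F (x - c * s).
  move=> iF; have /measurable_EFinP mF := rinteg_measurable iF.
  have mA : measurable_fun setT (fun s : R => x - c * s).
    apply: measurable_funB => //; apply: measurable_funM => //; exact: measurable_id.
  have iF' : rinteg (fun s => F (x - c * s)).
    apply/integrableP; split; first exact: (measurableT_comp mF).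
    have /integrableP[_] := iF; rewrite (P (fun x => `|(EFin \o F) x|)%E (measurableT_comp (@abse_measurable _ _) mF)) //=.
    case: (integral _ _ _) => [r _| |] //; first exact: ltry.
    by rewrite gt0_muley // lte_fin.
  apply: EFin_inj; rewrite EFinM -!rinteg_fin //.
  rewrite integralE [X in _ = (_ * X)%E]integralE muleBr //; last first.
    exact: integrable_add_def.
  rewrite (P _ (measurable_funepos mF)) // (P _ (measurable_funeneg mF)) //.
  by congr (_ * _ - _ * _)%E; apply: eq_integral => s _; rewrite ?(funeposE, funenegE).
move=> [i1 i2]; apply: complex_eq; rewrite !cE /= mul0r ?subr0 ?addr0; exact: E.
Qed.

End BoxOperators.

(** * Almost orthogonality of the skew parts at dyadic scales *)

Section NearSelfAdjoint.
Variable R : realType.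
Local Notation mu := (@lebesgue_measure R).
Implicit Types (f g : cfun R).

(** For positive [c], the indicator of the interval from [z - c] to [z], oriented so that u = z - c
    t turns an integral against it into [c] times [Bop c f z]. *)
Definition wbox (z c u : R) : R[i] := box ((z - u) / c).

Lemma wboxE (z c u : R) : wbox z c u = box (z / c - c^-1 * u).
Proof. by rewrite /wbox mulrBl [c^-1 * u]mulrC. Qed.

Lemma L2_wbox (z c : R) : c != 0 -> L2 (wbox z c).
Proof.
move=> c0; rewrite (_ : wbox z c = fun u => box (z / c - c^-1 * u)); last first.
  by apply/funext => u; rewrite wboxE.
by apply: L2_affine; [rewrite invr_eq0|exact: L2_box].
Qed.

Lemma cinteg_wbox (z c : R) f : c != 0 -> L2 f -> cinteg (fun u => wbox z c u * f u).
Proof.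
move=> c0 Lf; have := cinteg_ip (L2_wbox z c0) (L2_conj Lf).
by under eq_fun do rewrite conjCK.
Qed.

Lemma Bop_wbox (z c : R) f : 0 < c -> L2 f ->
  cint (fun u => wbox z c u * f u) = Complex c 0 * Bop c f z.
Proof.
move=> c0 Lf; have c0' : c != 0 by rewrite gt_eqF.
rewrite (cint_affine z c0 (cinteg_wbox z c0' Lf)); congr (_ * _).
apply: cint_ext => s; congr (box _ * _); field; exact: c0'.
Qed.

(** The two windows have length [b] and right ends within [a] of [x]. A point in just one of them is
    within [a] of [x] or of [x - b], and the right-hand side is the sum of the indicators of these
    two intervals of length [2 * a]. *)
Lemma ibox_diff (x a b y y' u : R) : 0 < a -> 0 < b ->
  x - a <= y <= x + a -> x - a <= y' <= x + a ->
  `|ibox ((y - u) / b) - ibox ((y' - u) / b)| <=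
    ibox ((x + a - u) / (2 * a)) + ibox ((x - b + a - u) / (2 * a)).
Proof.
move=> a0 b0 /andP[y1 y2] /andP[z1 z2].
have I (z c : R) : 0 < c -> (0 <= (z - u) / c <= 1) = (z - c <= u <= z).
  move=> c0; rewrite ler_pdivlMr // ler_pdivrMr // mul0r mul1r.
  by rewrite subr_ge0 andbC [z - u <= c]lerBlDr [z - c <= u]lerBlDr addrC.
have a20 : 0 < 2 * a by lra.
have P1 (z c : R) : 0 < c -> z - c <= u <= z -> ibox ((z - u) / c) = 1.
  by move=> c0 h; rewrite ibox_in // I.
have P0 (z c : R) : 0 < c -> ~~ (z - c <= u <= z) -> ibox ((z - u) / c) = 0.
  by move=> c0 h; rewrite ibox_out // I.
have pos : 0 <= ibox ((x + a - u) / (2 * a)) + ibox ((x - b + a - u) / (2 * a)).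
  by rewrite addr_ge0 ?ibox_ge0.
have key (p q : R) : x - a <= p -> p <= x + a -> x - a <= q -> q <= x + a ->
    p - b <= u <= p -> ~~ (q - b <= u <= q) ->
    1 <= ibox ((x + a - u) / (2 * a)) + ibox ((x - b + a - u) / (2 * a)).
  move=> p1 p2 q1 q2 /andP[u1 u2]; rewrite negb_and -!ltNge => /orP[v|v].
    rewrite [X in _ <= _ + X]P1 //; first by rewrite lerDr ibox_ge0.
    by apply/andP; split; lra.
  rewrite [X in _ <= X + _]P1 //; first by rewrite lerDl ibox_ge0.
  by apply/andP; split; lra.
have [h1|h1] := boolP (y - b <= u <= y); have [h2|h2] := boolP (y' - b <= u <= y').
- by rewrite (P1 _ _ b0 h1) (P1 _ _ b0 h2) subrr normr0.
- by rewrite (P1 _ _ b0 h1) (P0 _ _ b0 h2) subr0 normr1; exact: key h1 h2.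
- by rewrite (P0 _ _ b0 h1) (P1 _ _ b0 h2) sub0r normrN normr1; exact: key h2 h1.
- by rewrite (P0 _ _ b0 h1) (P0 _ _ b0 h2) subrr normr0.
Qed.

Definition absf f : cfun R := fun x => Complex (cabs (f x)) 0.

Lemma cabs_absf f x : cabs (absf f x) = cabs (f x).
Proof. by rewrite cabs_real ger0_norm ?cabs_ge0. Qed.

Lemma cmeas_absf f : cmeas f -> cmeas (absf f).
Proof. by move=> mf; exact/cmeas_real/measurable_cabs. Qed.

Lemma L2_absf f : L2 f -> L2 (absf f).
Proof.
move=> Lf; apply: (L2_dom (cmeas_absf (L2_cmeas Lf)) Lf ler01 _).1 => x.
by rewrite mul1r cabs_absf.
Qed.

Lemma l2norm_absf f : l2norm (absf f) = l2norm f.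
Proof. by rewrite /l2norm; under eq_Rintegral do rewrite -cabs_sq cabs_absf cabs_sq. Qed.

(** Sliding the window changes it only near its two ends, on length [2 * a] each, whence the ratio
    2a/b. The end contributions are again values of an average, of the modulus of [f], so the
    estimate can be taken in L^2 norm. *)
Lemma Bop_diff (x a b y y' : R) f : 0 < a -> 0 < b -> L2 f ->
  x - a <= y <= x + a -> x - a <= y' <= x + a ->
  cabs (Bop b f y - Bop b f y') <= (2 * a / b) *
    (cabs (Bop (2 * a) (absf f) (x + a)) + cabs (Bop (2 * a) (absf f) (x - b + a))).
Proof.
move=> a0 b0 Lf hy hy'; have b0' : b != 0 by rewrite gt_eqF.
have a20 : 0 < 2 * a by lra.
have a20' : 2 * a != 0 by rewrite gt_eqF.
have LF := L2_absf Lf.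
rewrite mulrAC ler_pdivlMr // mulrC.
have -> : b * cabs (Bop b f y - Bop b f y') =
    cabs (cint (fun u => (wbox y b u - wbox y' b u) * f u)).
  have -> : cint (fun u => (wbox y b u - wbox y' b u) * f u) =
      Complex b 0 * (Bop b f y - Bop b f y').
    rewrite mulrBr -!Bop_wbox // -cintB; [|exact: cinteg_wbox..].
    by apply: cint_ext => u; rewrite mulrBl.
  by rewrite cabsM cabs_real gtr0_norm.
pose G u := wbox (x + a) (2 * a) u * absf f u + wbox (x - b + a) (2 * a) u * absf f u.
have iG : cinteg G by apply: cintegD; exact: cinteg_wbox.
have GE : cint G = Complex (2 * a) 0 * Bop (2 * a) (absf f) (x + a) +
    Complex (2 * a) 0 * Bop (2 * a) (absf f) (x - b + a).
  by rewrite /G cintD ?Bop_wbox //; exact: cinteg_wbox.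
apply: (@le_trans _ _ (complex.Re (cint G))).
  apply: cabs_cint_le iG.1 _.
    apply: cmeasM; last exact: L2_cmeas.
    by apply: cmeasB; apply: L2_cmeas; exact: L2_wbox.
  move=> u; rewrite cabsM /G /wbox /box /absf !cE /= ?mulr0 ?mul0r ?subr0 -mulrDl.
  rewrite ler_wpM2r ?cabs_ge0 //.
  have -> : Complex (ibox ((y - u) / b)) 0 - Complex (ibox ((y' - u) / b)) 0 =
      Complex (ibox ((y - u) / b) - ibox ((y' - u) / b)) 0 :> R[i].
    by apply: complex_eq; rewrite cE //= subr0.
  by rewrite cabs_real; exact: ibox_diff.
apply: le_trans (ler_norm _) _; apply: le_trans (Re_le_cabs _) _.
rewrite GE -mulrDr cabsM cabs_real gtr0_norm // ler_wpM2l ?(ltW a20) //.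
exact: cabsD.
Qed.

(** Twice the skew-adjoint part of [Bop a], as [Bop (- a)] is its adjoint. *)
Definition Xop (a : R) : op R := fun f x => Bop a f x - Bop (- a) f x.

Lemma strong_Xop a : a != 0 -> strong_op (Xop a) 2.
Proof.
move=> a0; have -> : 2 = 1 + 1 :> R by [].
by apply: strong_sub; apply: strong_Bop; rewrite ?oppr_eq0.
Qed.

(** [Bop (2 * a)] is a contraction, so each of the two end terms has norm at most that of [f], and
    twice 2a/b is 4a/b. The function [g] is kept arbitrary because the same bound later controls the
    sampling error in the compactness argument. *)
Lemma Bop_diff_norm (g : cfun R) (a b : R) f : 0 < a -> 0 < b -> L2 f -> cmeas g ->
  (forall x, cabs (g x) <= (2 * a / b) *
    (cabs (Bop (2 * a) (absf f) (x + a)) + cabs (Bop (2 * a) (absf f) (x - b + a)))) ->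
  l2norm g <= 4 * a / b * l2norm f.
Proof.
move=> a0 b0 Lf mg gG.
have a20' : 2 * a != 0 by rewrite mulf_neq0 // ?pnatr_eq0 // gt_eqF.
have LG := strong_L2 (strong_Bop a20') (L2_absf Lf); set G := Bop (2 * a) _ in LG gG *.
pose H : cfun R := fun x => Complex (2 * a / b) 0 *
  (absf G (x - (- a)) + absf G (x - (b - a))).
have LH1 := L2_shift (- a) (L2_absf LG); have LH2 := L2_shift (b - a) (L2_absf LG).
have LH : L2 H by apply: L2Z; exact: L2D.
have ab0 : 0 <= 2 * a / b by rewrite divr_ge0 // ?mulr_ge0 // ltW.
apply: (@le_trans _ _ (l2norm H)).
  apply: l2norm_le => // x; apply: le_trans (gG x) _.
  rewrite /H cabsM cabs_real ger0_norm // ler_wpM2l // /absf opprK opprB.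
  have -> : x + (a - b) = x - b + a by ring.
  have -> : Complex (cabs (G (x + a))) 0 + Complex (cabs (G (x - b + a))) 0 =
    Complex (cabs (G (x + a)) + cabs (G (x - b + a))) 0 :> R[i].
    by apply: complex_eq; rewrite cE //= addr0.
  by rewrite cabs_real ger0_norm // addr_ge0 ?cabs_ge0.
rewrite /H l2normZ; last exact: L2D.
rewrite cabs_real ger0_norm //.
have -> : 4 * a / b * l2norm f = 2 * a / b * (l2norm f + l2norm f) by ring.
rewrite ler_wpM2l //.
have Gf : l2norm G <= l2norm f.
  rewrite -(l2norm_absf f) -[leRHS]mul1r.
  exact: (strong_norm (strong_Bop a20') (L2_absf Lf)).
apply: le_trans (l2normD LH1 LH2) _.
by rewrite (l2norm_shift (- a) (L2_cmeas (L2_absf LG)))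
  (l2norm_shift (b - a) (L2_cmeas (L2_absf LG))) !l2norm_absf lerD.
Qed.

(** [Xop a] at [x] averages differences of values at x - at and x + at, both within [a] of [x],
    where an average at scale [b] hardly moves. *)
Lemma Xop_Bop (a b : R) f : 0 < a -> 0 < b -> L2 f ->
  l2norm (Xop a (Bop b f)) <= 4 * a / b * l2norm f.
Proof.
move=> a0 b0 Lf; have a0' : a != 0 by rewrite gt_eqF.
have b0' : b != 0 by rewrite gt_eqF.
have na0 : - a != 0 by rewrite oppr_eq0.
have Lg := strong_L2 (strong_Bop b0') Lf; set g := Bop b f in Lg *.
apply: (Bop_diff_norm a0 b0 Lf); first exact/L2_cmeas/(strong_L2 (strong_Xop a0')).
move=> x; have -> : Xop a g x = avg (fun t => g (x - a * t) - g (x - - a * t)).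
  by rewrite avgB //; apply: cinteg_box; exact: L2_affine.
apply: avg_le; first by apply: cmeasB; apply: cmeas_affine; exact: L2_cmeas.
move=> t /andP[t0 t1].
have t2 : 0 <= a * t by rewrite mulr_ge0 // ltW.
have t3 : a * t <= a by rewrite ler_piMr // ltW.
by apply: (@Bop_diff x a b _ _ f a0 b0 Lf); apply/andP; split; lra.
Qed.

Lemma Xop_shift (a s : R) f x : Xop a (fun y => f (y + s)) x = Xop a f (x + s).
Proof.
by rewrite /Xop /Bop; congr (_ - _); apply: cint_ext => t; congr (_ * f _); ring.
Qed.

(** A fine skew part nearly annihilates a coarse one. The term with [Bop (- b)] is a shift of the
    one with [Bop b], so both cost 4a/b. *)
Lemma Xop_Xop (a b : R) f : 0 < a -> 0 < b -> L2 f ->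
  l2norm (Xop a (Xop b f)) <= 8 * a / b * l2norm f.
Proof.
move=> a0 b0 Lf; have a0' : a != 0 by rewrite gt_eqF.
have b0' : b != 0 by rewrite gt_eqF.
have nb0 : - b != 0 by rewrite oppr_eq0.
have L1 := strong_L2 (strong_Bop b0') Lf; have L2' := strong_L2 (strong_Bop nb0) Lf.
have sX := strong_Xop a0'.
rewrite {2}/Xop (strongB sX L1 L2').
have -> : 8 * a / b * l2norm f = 4 * a / b * l2norm f + 4 * a / b * l2norm f by ring.
apply: le_trans (l2normB (strong_L2 sX L1) (strong_L2 sX L2')) _.
rewrite lerD ?Xop_Bop //.
have -> : Xop a (Bop (- b) f) = fun x => Xop a (Bop b f) (x - (- b)).
  apply/funext => x; rewrite opprK -Xop_shift; congr (Xop a _ x); apply/funext => y.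
  exact: Bop_opp.
rewrite (l2norm_shift (- b)) ?Xop_Bop //.
exact/L2_cmeas/(strong_L2 sX L1).
Qed.

Lemma ip_Xop (a : R) f g : a != 0 -> L2 f -> L2 g -> ip (Xop a f) g = - ip f (Xop a g).
Proof.
move=> a0 Lf Lg; have na0 : - a != 0 by rewrite oppr_eq0.
have sB := strong_Bop a0; have sN := strong_Bop na0.
rewrite /Xop ipBl //; [|exact: (strong_L2 sB)|exact: (strong_L2 sN)].
rewrite ipBr //; [|exact: (strong_L2 sB)|exact: (strong_L2 sN)].
by rewrite !ip_Bop // opprK opprB.
Qed.

Definition scale (j : nat) : R := 2 ^+ j.

Lemma scale_gt0 j : 0 < scale j.
Proof. by rewrite exprn_gt0. Qed.

Lemma scale_neq0 j : scale j != 0.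
Proof. by rewrite gt_eqF ?scale_gt0. Qed.

Lemma scale_ge1 j : 1 <= scale j.
Proof. by rewrite exprn_ege1 // ler1n. Qed.

Lemma sum_scale_ratio N : \sum_(j < N) scale j / scale N <= 1 :> R.
Proof.
rewrite -mulr_suml ler_pdivrMr ?scale_gt0 // mul1r.
suff : \sum_(j < N) scale j <= scale N - 1 by lra.
elim: N => [|N ih]; first by rewrite big_ord0 /scale expr0 subrr.
by rewrite big_ord_recr /=; move: ih; rewrite /scale exprS; lra.
Qed.

Definition Xsum N : op R := fun f x => \sum_(j < N) Xop (scale j) f x.

(* Almost orthogonality of the scales: each new term adds at most a constant to the square. *)
Lemma Xsum_norm N f : L2 f -> l2norm (Xsum N f) ^+ 2 <= 20 * N%:R * l2norm f ^+ 2.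
Proof.
move=> Lf; have LX j := strong_L2 (strong_Xop (scale_neq0 j)) Lf.
have LS k : L2 (Xsum k f) by exact: (L2_sum _ (fun j : 'I_k => LX j)).
elim: N => [|N ih].
  rewrite mulr0 mul0r /Xsum; under eq_fun do rewrite big_ord0.
  by rewrite l2norm0 expr0n.
have -> : Xsum N.+1 f = fun x => Xsum N f x + Xop (scale N) f x.
  by apply/funext => x; rewrite /Xsum big_ord_recr.
rewrite l2normD_sq //.
(* By skew-adjointness the finer scale moves to the other side, where it meets the coarsest one with
   norm at most 8 times the ratio of scales; the ratios sum to at most 1. With the diagonal bound 4,
   the increment is 2 * 8 + 4 = 20. *)
have cross : complex.Re (ip (Xsum N f) (Xop (scale N) f)) <= 8 * l2norm f ^+ 2.
  apply: le_trans (ler_norm _) _; apply: le_trans (Re_le_cabs _) _.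
  rewrite /Xsum ip_suml //; apply: le_trans (cabs_sum _ _ _) _.
  apply: (@le_trans _ _ (\sum_(j < N) 8 * l2norm f ^+ 2 * (scale j / scale N))).
    apply: ler_sum => j _; rewrite ip_Xop ?scale_neq0 // cabsN.
    apply: le_trans (cauchy_schwarz Lf (strong_L2 (strong_Xop (scale_neq0 j)) (LX N))) _.
    have := Xop_Xop (scale_gt0 j) (scale_gt0 N) Lf.
    move=> /(ler_wpM2l (l2norm_ge0 f)) /le_trans; apply.
    by rewrite le_eqVlt; apply/orP; left; apply/eqP; ring.
  by rewrite -mulr_sumr ler_piMr ?sum_scale_ratio // mulr_ge0 // sqr_ge0.
have diag : l2norm (Xop (scale N) f) ^+ 2 <= 4 * l2norm f ^+ 2.
  have -> : 4 * l2norm f ^+ 2 = (2 * l2norm f) ^+ 2 by ring.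
  rewrite ler_pXn2r ?nnegrE ?mulr_ge0 ?l2norm_ge0 //.
  exact: (strong_norm (strong_Xop (scale_neq0 N)) Lf).
have -> : N.+1%:R = N%:R + 1 :> R by rewrite natr1.
move: ih cross diag.
have := sqr_ge0 (l2norm f); set F := l2norm f ^+ 2 => F0 ih cr di.
have -> : 20 * (N%:R + 1) * F = 20 * N%:R * F + 2 * (8 * F) + 4 * F by ring.
by rewrite lerD // lerD // ler_wpM2l.
Qed.

End NearSelfAdjoint.

(** * The multiplier of a block *)

Section ComplexExponential.
Variable R : realType.
Implicit Types x y : R.

Definition cexp (x : R) : R[i] := Complex (cos x) (sin x).

Lemma cexpD x y : cexp (x + y) = cexp x * cexp y.
Proof. by apply: complex_eq; rewrite cE /= ?cosD ?sinD //; ring. Qed.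

Lemma cexp0 : cexp 0 = 1.
Proof. by rewrite /cexp cos0 sin0. Qed.

Lemma cabs_cexp x : cabs (cexp x) = 1.
Proof. by rewrite /cabs /csq /= cos2Dsin2 sqrtr1. Qed.

Lemma cexp_conj x : (cexp x)^* = cexp (- x).
Proof. by apply: complex_eq; rewrite cE /= ?cosN ?sinN. Qed.

Lemma measurable_cos : measurable_fun setT (@cos R).
Proof. by apply: continuous_measurable_fun => x; exact: continuous_cos. Qed.

Lemma measurable_sin : measurable_fun setT (@sin R).
Proof. by apply: continuous_measurable_fun => x; exact: continuous_sin. Qed.

Lemma cmeas_cexp d (T : measurableType d) (h : T -> R) :
  measurable_fun setT h -> cmeas (fun p => cexp (h p)).
Proof.
by move=> mh; split; [exact: (measurableT_comp measurable_cos)|exact: (measurableT_comp measurable_sin)].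
Qed.

Lemma sin_le x : 0 <= x -> exists2 c, 0 <= c <= x & sin x = cos c * x.
Proof.
move=> x0; have [c cx] := MVT_segment x0 (fun y _ => is_derive_sin y)
  (continuous_subspaceT (@continuous_sin R)).
by rewrite sin0 !subr0 => ->; exists c => //; move: cx; rewrite in_itv.
Qed.

Lemma norm_sin_le x : `|sin x| <= `|x|.
Proof.
wlog x0 : x / 0 <= x => [h|].
  have [/h//|/ltW x0] := leP 0 x.
  by rewrite -normrN -sinN -[leRHS]normrN; apply: h; rewrite oppr_ge0.
have [c _ ->] := sin_le x0; rewrite normrM ler_piMl //; exact: cos_max.
Qed.

Lemma cos_ge x : 1 - cos x <= x ^+ 2 / 2.
Proof.
have -> : cos x = 1 - 2 * sin (x / 2) ^+ 2.
  have -> : cos x = cos ((x / 2) *+ 2) by congr cos; field.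
  by rewrite cos_mulr2n cos2sin2; ring.
have : sin (x / 2) ^+ 2 <= (x / 2) ^+ 2.
  by rewrite -(real_normK (num_real (sin _))) -(real_normK (num_real (x / 2)))
    ler_pXn2r ?nnegrE // norm_sin_le.
rewrite expr_div_n; lra.
Qed.

Lemma cexp_sub1 x : cabs (cexp x - 1) <= `|x|.
Proof.
apply: cabs_le_csq => //; rewrite real_normK ?num_real //.
rewrite /csq /= subr0; have := cos2Dsin2 x; have := cos_ge x; rewrite !expr2; nra.
Qed.

Lemma cexp_lip x y : cabs (cexp x - cexp y) <= `|x - y|.
Proof.
have -> : cexp x - cexp y = cexp y * (cexp (x - y) - 1).
  by rewrite mulrBr mulr1 -cexpD [y + _]addrC subrK.
by rewrite cabsM cabs_cexp mul1r cexp_sub1.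
Qed.

Lemma cexp_taylor x : `|x| <= 1 -> cabs (cexp x - 1 - Complex 0 x) <= x ^+ 2.
Proof.
move=> x1; apply: le_trans (cabs_le_ReIm _) _; rewrite /= subr0 oppr0 addr0.
have h1 : `|cos x - 1| <= x ^+ 2 / 2.
  by rewrite ler0_norm ?opprB ?cos_ge // subr_le0 cos_le1.
have h2 : `|sin x - x| <= x ^+ 2 / 2.
  wlog x0 : x x1 h1 / 0 <= x => [h|].
    have [/h h2|/ltW x0] := leP 0 x; first exact: h2.
    have := h (- x); rewrite normrN cosN sinN sqrrN oppr_ge0 -opprD normrN; exact.
  have [c /andP[c0 cx] ->] := sin_le x0; rewrite -[X in _ - X]mul1r -mulrBl normrM.
  rewrite ler0_norm ?subr_le0 ?cos_le1 // opprB (ger0_norm x0).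
  rewrite (ger0_norm x0) in x1.
  have := cos_ge c; have : c ^+ 2 <= x ^+ 2 by rewrite ler_pXn2r // nnegrE.
  have := sqr_ge0 x; have : x ^+ 2 * x <= x ^+ 2 by rewrite ler_piMr // sqr_ge0.
  move=> a1 a2 a3 a4.
  have : (1 - cos c) * x <= x ^+ 2 / 2 * x by rewrite ler_wpM2r //; lra.
  by rewrite mulrAC; lra.
by lra.
Qed.

End ComplexExponential.

Section Multiplier.
Variable R : realType.
Implicit Types x y : R.

(** Kept as a mean of characters instead of the closed form (e^(iy) - 1)/(iy): for [0 <= a] the
    multiplier [bfun (a * (x - c))] is then visibly a mean of scalar multiples of operators
    [mult_op] with nonnegative frequency. *)
Definition bfun (y : R) : R[i] := avg (fun t => cexp (y * t)).

Lemma cmeas_cexp_lin (y : R) : cmeas (fun t : R => cexp (y * t)).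
Proof. by apply: cmeas_cexp; apply: measurable_funM => //; exact: measurable_id. Qed.

Lemma cinteg_box_cexp (y : R) : cinteg (fun t => box t * cexp (y * t)).
Proof.
by apply: (cinteg_box_bounded (C := 1)) => [|t _]; [exact: cmeas_cexp_lin|rewrite cabs_cexp].
Qed.

Lemma cmeas_bfun : cmeas bfun.
Proof.
apply: (cmeas_avg (Phi := fun p => cexp (p.1 * p.2))).
by apply: cmeas_cexp; apply: measurable_funM; [exact: measurable_fst|exact: measurable_snd].
Qed.

Lemma bfun_le1 y : cabs (bfun y) <= 1.
Proof. by apply: avg_le => [|t _]; [exact: cmeas_cexp_lin|rewrite cabs_cexp]. Qed.

Lemma bfun_conj y : (bfun y)^* = bfun (- y).
Proof.
rewrite avg_conj; last exact: cinteg_box_cexp.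
by apply: cint_ext => t; rewrite cexp_conj mulNr.
Qed.

Lemma bfun_lip x y : cabs (bfun x - bfun y) <= `|x - y|.
Proof.
rewrite -avgB; [|exact: cinteg_box_cexp..].
apply: avg_le => [|t /andP[t0 t1]]; first by apply: cmeasB; exact: cmeas_cexp_lin.
apply: le_trans (cexp_lip _ _) _.
by rewrite -mulrBl normrM (ger0_norm t0) ler_piMr.
Qed.

Lemma bfun0 : bfun 0 = 1.
Proof. by rewrite -[RHS](avg_cst 1); apply: avg_eq => t _; rewrite mul0r cexp0. Qed.

Lemma cint_wbox (z c : R) : 0 < c -> cinteg (wbox z c) /\ cint (wbox z c) = Complex c 0.
Proof.
move=> c0; have c0' : c != 0 by rewrite gt_eqF.
have iw : cinteg (wbox z c).
  have := cinteg_ip (L2_wbox z c0') (L2_wbox z c0'); congr cinteg; apply/funext => u.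
  by rewrite /wbox conj_box; apply: complex_eq;
    rewrite /box !cE /= ?mulr0 ?mul0r ?addr0 // subr0 -expr2 ibox_sq.
split=> //; rewrite (cint_affine z c0 iw) -[RHS]mulr1; congr (_ * _).
rewrite -[RHS](avg_cst 1); apply: cint_ext => s; rewrite mulr1; congr box.
by field; exact: c0'.
Qed.

(** Translation by the half period p = pi / y flips the sign of the exponential, so twice the
    integral sees only the difference of the box and its translate, which lives on total length
    4|p|. Hence the bound 2 pi / |y|, and pi < 4 gives the constant 8. *)
Lemma bfun_decay y : y != 0 -> cabs (bfun y) <= 8 / `|y|.
Proof.
move=> y0; have y0' : 0 < `|y| by rewrite normr_gt0.
pose p := pi / y; pose a := `|p|.
have a0 : 0 < a by rewrite normr_gt0 mulf_neq0 ?invr_eq0 // gt_eqF ?pi_gt0.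
have a20 : 0 < 2 * a by lra.
pose h t : R[i] := box t * cexp (y * t).
have ih : cinteg h := cinteg_box_cexp y.
pose G u : R := ibox ((1 + a - u) / (2 * a)) + ibox ((1 - 1 + a - u) / (2 * a)).
have [i1 e1] := cint_wbox (1 + a) a20; have [i2 e2] := cint_wbox (1 - 1 + a) a20.
have iG : rinteg G by apply: rintegD; [exact: i1.1|exact: i2.1].
have IG : \int[lebesgue_measure]_u G u = 4 * a.
  rewrite RintegralD //; [|exact: i1.1|exact: i2.1].
  have : complex.Re (cint (wbox (1 + a) (2 * a))) + complex.Re (cint (wbox (1 - 1 + a) (2 * a)))
     = 4 * a by rewrite e1 e2 /=; ring.
  by [].
have two : cabs (bfun y + bfun y) <= 4 * a.
  have -> : bfun y + bfun y = cint (fun t => h t + h (t - p)).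
    rewrite cintD //; last exact: cinteg_shift.
    by rewrite (cint_shift p (cinteg_meas ih)).
  rewrite -IG; apply: cabs_cint_le iG _.
    by apply: cmeasD; [|apply: cmeas_shift]; exact: cinteg_meas.
  move=> t; have -> : h t + h (t - p) = (box t - box (t - p)) * cexp (y * t).
    rewrite /h mulrBl; congr (_ + _).
    have -> : y * t = y * (t - p) + pi by rewrite mulrBr /p mulrCA divff // mulr1 subrK.
    by rewrite cexpD [cexp pi]/cexp cospi sinpi; apply: complex_eq; rewrite !cE /=; ring.
  rewrite cabsM cabs_cexp mulr1.
  have -> : box t - box (t - p) = Complex (ibox t - ibox (t - p)) 0 :> R[i].
    by apply: complex_eq; rewrite cE //= subr0.
  rewrite cabs_real -(ibox_sym t) -(ibox_sym (t - p)).
  have -> : 1 - t = (1 - t) / 1 by rewrite divr1.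
  have -> : 1 - (t - p) = (1 + p - t) / 1 by rewrite divr1; ring.
  apply: ibox_diff => //; first by apply/andP; split; lra.
  have := ler_norm (- p); have := ler_norm p; rewrite normrN -/a => h1 h2.
  by apply/andP; split; lra.
have -> : cabs (bfun y) = cabs (bfun y + bfun y) / 2.
  have -> : bfun y + bfun y = Complex 2 0 * bfun y.
    by apply: complex_eq; rewrite !cE /=; ring.
  by rewrite cabsM cabs_real ger0_norm // mulrC mulKf.
have -> : 8 / `|y| = 2 * (4 / `|y|) by ring.
have : a <= 4 / `|y|.
  rewrite /a /p normrM normfV ler_pM2r ?invr_gt0 // ger0_norm ?pi_ge0 //.
  by have := @pihalf_lt2 R; lra.
by lra.
Qed.

End Multiplier.

(** * Series of operators *)

Section WeakLimit.
Variable R : realType.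
Local Notation mu := (@lebesgue_measure R).
Implicit Types (f g : cfun R).

Lemma cabs_lim_unique (z : nat -> R[i]) (v w : R[i]) :
  (fun n => cabs (z n - v)) @ \oo --> 0 -> (fun n => cabs (z n - w)) @ \oo --> 0 -> v = w.
Proof.
move=> /cvg0P hv /cvg0P hw; apply/eqP; rewrite -subr_eq0; apply/eqP/cabs0_eq0/eqP.
rewrite eq_le cabs_ge0 andbT; apply/ler_addgt0Pr => e e0; rewrite add0r.
have e2 : 0 < e / 2 by lra.
have [N hN] := hv _ e2; have [M hM] := hw _ e2.
have := hN (maxn N M) (leq_maxl _ _); have := hM (maxn N M) (leq_maxr _ _).
rewrite !ger0_norm ?cabs_ge0 // => h1 h2.
have -> : v - w = (z (maxn N M) - w) - (z (maxn N M) - v) by ring.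
by apply: le_trans (cabsD _ _) _; rewrite cabsN; lra.
Qed.

(* Pointwise convergence with bounded norms gives weak convergence: split [u g] according to
   whether [u <= K g], so that it is at most [min u (K g) * g + u^2 / K]. *)
Lemma weak_limit (F : nat -> cfun R) f g (C : R) : (forall n, L2 (F n)) -> cmeas f ->
  (forall n, l2norm (F n) <= C) ->
  (forall x, (fun n => cabs (F n x - f x)) @ \oo --> 0) -> L2 g ->
  (fun n => cabs (ip (F n) g - ip f g)) @ \oo --> 0.
Proof.
move=> LF mf FC Ff Lg; have [Lf fC] := fatou_l2 LF mf FC Ff.
have C0 : 0 <= C := le_trans (l2norm_ge0 _) fC.
pose u n x := cabs (F n x - f x).
have Lu n : L2 (fun x => F n x - f x) by exact: L2B.
have uC n : l2norm (fun x => F n x - f x) <= 2 * C.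
  by apply: le_trans (l2normB (LF n) Lf) _; have := FC n; lra.
have main n : cabs (ip (F n) g - ip f g) <= \int[mu]_x (u n x * cabs (g x)).
  rewrite -ipBl //; apply: cabs_cint_le (L2_mul (Lu n) Lg) _.
    exact/cinteg_meas/cinteg_ip.
  by move=> x; rewrite cabsM cabs_conj.
apply/cvg0P => e e0.
(* Makes the remainder (2C)^2 / K at most e / 2; the added 1 keeps [K] positive when [C] is 0. *)
pose K := 8 * C ^+ 2 / e + 1.
have K0 : 0 < K by rewrite ltr_wpDl // divr_ge0 ?(ltW e0) // mulr_ge0 // sqr_ge0.
have mg : measurable_fun setT (fun x => cabs (g x)) by exact/measurable_cabs/L2_cmeas.
have mu_ n : measurable_fun setT (u n) by exact/measurable_cabs/L2_cmeas.
pose H n x : R[i] := Complex (Num.min (u n x) (K * cabs (g x)) * cabs (g x)) 0.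
have Hge n x : 0 <= Num.min (u n x) (K * cabs (g x)) * cabs (g x).
  by rewrite mulr_ge0 ?cabs_ge0 // le_min cabs_ge0 mulr_ge0 ?cabs_ge0 // ltW.
have mH n : cmeas (H n).
  apply: cmeas_real; apply: measurable_funM => //.
  by apply: measurable_minr => //; exact: measurable_funM.
have Hdom n x : cabs (H n x) <= K * csq (g x).
  rewrite cabs_real ger0_norm // -cabs_sq expr2 mulrA ler_wpM2r ?cabs_ge0 //.
  by rewrite ge_min lexx orbT.
have H0 x : (fun n => cabs (H n x - 0)) @ \oo --> 0.
  apply/cvg0P => e' e'0; have gp : 0 < cabs (g x) + 1 by rewrite ltr_wpDl ?cabs_ge0.
  have [N hN] := (cvg0P _).1 (Ff x) _ (divr_gt0 e'0 gp); exists N => n /hN.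
  rewrite !ger0_norm ?cabs_ge0 // subr0 cabs_real ger0_norm // => h.
  apply: (@le_lt_trans _ _ (u n x * (cabs (g x) + 1))); last by rewrite -ltr_pdivlMr.
  have u0 : 0 <= u n x by exact: cabs_ge0.
  apply: (@le_trans _ _ (u n x * cabs (g x))).
    by rewrite ler_wpM2r ?cabs_ge0 // ge_min lexx.
  by rewrite ler_wpM2l // lerDl.
have iG := rintegZ K (L2_csq Lg).
have e2 : 0 < e / 2 by lra.
have := dominated_cint mH (cmeas_cst 0) iG Hdom H0.
move=> /cvg0P /(_ _ e2) [N hN]; exists N => n /hN.
rewrite cint0 subr0 !ger0_norm ?cabs_ge0 // => hn.
apply: le_lt_trans (main n) _.
have iH : rinteg (fun x => Num.min (u n x) (K * cabs (g x)) * cabs (g x)).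
  exact: (cinteg_le (mH n) iG (Hdom n)).1.
have iu : rinteg (fun x => K^-1 * csq (F n x - f x)) := rintegZ K^-1 (L2_csq (Lu n)).
apply: (@le_lt_trans _ _ (\int[mu]_x (Num.min (u n x) (K * cabs (g x)) * cabs (g x) +
    K^-1 * csq (F n x - f x)))).
  apply: Rint_le; [exact: (L2_mul (Lu n) Lg)|exact: rintegD|] => x.
  have u0 : 0 <= u n x by exact: cabs_ge0.
  have [h|h] := leP (u n x) (K * cabs (g x)).
    by rewrite lerDl mulr_ge0 ?csq_ge0 // invr_ge0 ltW.
  have h' : cabs (g x) <= K^-1 * u n x by rewrite ler_pdivlMl // ltW.
  apply: (@le_trans _ _ (K^-1 * csq (F n x - f x))); last first.
    by rewrite lerDr !mulr_ge0 ?cabs_ge0 // ltW.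
  by rewrite -cabs_sq expr2 mulrCA ler_wpM2l.
rewrite RintegralD // RintegralZl //; last exact: L2_csq.
rewrite -l2norm_sq.
have h1 : \int[mu]_x (Num.min (u n x) (K * cabs (g x)) * cabs (g x)) <= cabs (cint (H n)).
  by apply: le_trans (Re_le_cabs _); exact: ler_norm.
have h2 : K^-1 * l2norm (fun x => F n x - f x) ^+ 2 <= K^-1 * (2 * C) ^+ 2.
  rewrite ler_pM2l ?invr_gt0 // ler_pXn2r ?nnegrE ?l2norm_ge0 //.
  by rewrite mulr_ge0.
have h3 : K^-1 * (2 * C) ^+ 2 <= e / 2.
  have E : K * (e / 2) = (2 * C) ^+ 2 + e / 2 by rewrite /K; field; rewrite gt_eqF.
  by rewrite ler_pdivrMl // E lerDl ltW.
lra.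
Qed.

End WeakLimit.

Section OperatorSeries.
Variable R : realType.
Local Notation mu := (@lebesgue_measure R).
Implicit Types (f g : cfun R).
Variables (A : nat -> op R) (D : nat -> R) (m : nat -> R -> R) (C M : R).
Hypothesis sA : forall n, strong_op (A n) (D n).
Hypothesis Am : forall n f x, L2 f -> cabs (A n f x) <= m n x * l2norm f.
Hypothesis m0 : forall n x, 0 <= m n x.
Hypothesis mM : forall k x, \sum_(n < k) m n x <= M.
Hypothesis AC : forall k f, L2 f -> l2norm (fun x => \sum_(n < k) A n f x) <= C * l2norm f.

(** Summed value by value instead of as a limit of operators: [Am] and [mM] give absolute
    convergence at every point, so linearity is exact, while the norm bound [AC] on partial sums
    passes to the limit by Fatou. *)
Definition opser : op R := fun f x =>
  Complex (limn (fun k => complex.Re (\sum_(n < k) A n f x)))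
          (limn (fun k => complex.Im (\sum_(n < k) A n f x))).

Let LS k f : L2 f -> L2 (fun x => \sum_(n < k) A n f x).
Proof. by move=> Lf; exact: (L2_sum _ (fun n : 'I_k => strong_L2 (sA n) Lf)). Qed.

Let real_series (v : nat -> R) (w : nat -> R) (B : R) : (forall n, `|v n| <= w n) ->
  (forall k, \sum_(n < k) w n <= B) -> cvgn (fun k => \sum_(n < k) v n).
Proof.
move=> vw wB.
have w0 n : 0 <= w n by exact: le_trans (normr_ge0 _) (vw n).
have E (z : nat -> R) : (fun k => \sum_(n < k) z n) = series z.
  by apply/funext => k; rewrite /series /= big_mkord.
rewrite E; apply: normed_cvg; apply: (@series_le_cvg _ _ w) => //.
  by move=> n /=; exact: normr_ge0.
apply: nondecreasing_is_cvgn.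
  by apply: nondecreasing_series => n _ _; exact: w0.
by exists B => _ [k _ <-]; rewrite -E.
Qed.

Lemma opser_cvg f x : L2 f ->
  (fun k => cabs (\sum_(n < k) A n f x - opser f x)) @ \oo --> 0.
Proof.
move=> Lf.
have wB k : \sum_(n < k) m n x * l2norm f <= M * l2norm f.
  by rewrite -mulr_suml ler_wpM2r ?l2norm_ge0.
have c1 : cvgn (fun k => complex.Re (\sum_(n < k) A n f x)).
  under eq_fun do rewrite cRe_sum.
  by apply: (@real_series (fun n => complex.Re (A n f x)) (fun n => m n x * l2norm f) _ _ wB) => n;
    exact: le_trans (Re_le_cabs _) (Am _ _ Lf).
have c2 : cvgn (fun k => complex.Im (\sum_(n < k) A n f x)).
  under eq_fun do rewrite cIm_sum.
  by apply: (@real_series (fun n => complex.Im (A n f x)) (fun n => m n x * l2norm f) _ _ wB) => n;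
    exact: le_trans (Im_le_cabs _) (Am _ _ Lf).
apply/cvg0P => e e0; have e2 : 0 < e / 2 by lra.
move/cvgrPdist_lt : c1 => /(_ _ e2) [N1 _ h1].
move/cvgrPdist_lt : c2 => /(_ _ e2) [N2 _ h2].
exists (maxn N1 N2) => k; rewrite geq_max => /andP[/h1 /= k1 /h2 /= k2].
rewrite ger0_norm ?cabs_ge0 //; apply: le_lt_trans (cabs_le_ReIm _) _.
rewrite !cE /= -[X in X + _]normrN -[X in _ + X]normrN !opprB.
lra.
Qed.

Lemma opser_L2 f : L2 f -> L2 (opser f) /\ l2norm (opser f) <= C * l2norm f.
Proof.
move=> Lf; apply: (@fatou_l2 _ (fun k x => \sum_(n < k) A n f x)) => //.
- by move=> k; exact: LS.
- apply: (@cmeas_limit _ _ _ (fun k x => \sum_(n < k) A n f x)).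
  + by move=> k; exact/L2_cmeas/LS.
  + move=> x; have /cvg0P h := opser_cvg x Lf; apply/cvgrPdist_lt => e e0.
    have [N hN] := h e e0; exists N => // k /= /hN; apply: le_lt_trans.
    by rewrite (ger0_norm (cabs_ge0 _)) cabsB (le_trans _ (Re_le_cabs _)) // !cE.
  + move=> x; have /cvg0P h := opser_cvg x Lf; apply/cvgrPdist_lt => e e0.
    have [N hN] := h e e0; exists N => // k /= /hN; apply: le_lt_trans.
    by rewrite (ger0_norm (cabs_ge0 _)) cabsB (le_trans _ (Im_le_cabs _)) // !cE.
- by move=> k; exact: AC.
- by move=> x; exact: opser_cvg.
Qed.

Lemma strong_opser : 0 <= C -> strong_op opser C.
Proof.
move=> C0; split => //.
- move=> a f g Lf Lg; apply/funext => x; have Lh := L2D (L2Z a Lf) Lg.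
  apply: (cabs_lim_unique (opser_cvg x Lh)).
  have /cvg0P hf := opser_cvg x Lf; have /cvg0P hg := opser_cvg x Lg.
  have a1 : 0 < cabs a + 1 by rewrite ltr_wpDl ?cabs_ge0.
  apply/cvg0P => e e0.
  have e1 : 0 < e / (2 * (cabs a + 1)) by rewrite divr_gt0 // mulr_gt0.
  have e2 : 0 < e / 2 by lra.
  have [N hN] := hf _ e1; have [N' hN'] := hg _ e2.
  exists (maxn N N') => k; rewrite geq_max => /andP[/hN h1 /hN' h2].
  move: h1 h2; rewrite !ger0_norm ?cabs_ge0 // => h1 h2.
  have -> : \sum_(n < k) A n (fun x0 => a * f x0 + g x0) x - (a * opser f x + opser g x) =
     a * (\sum_(n < k) A n f x - opser f x) + (\sum_(n < k) A n g x - opser g x).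
    have -> : \sum_(n < k) A n (fun x0 => a * f x0 + g x0) x =
        a * (\sum_(n < k) A n f x) + \sum_(n < k) A n g x.
      rewrite mulr_sumr -big_split; apply: eq_bigr => n _.
      by have [_ -> //] := sA n.
    ring.
  apply: le_lt_trans (cabsD _ _) _; rewrite cabsM.
  have : cabs a * cabs (\sum_(n < k) A n f x - opser f x) <= e / 2.
    apply: (@le_trans _ _ ((cabs a + 1) * (e / (2 * (cabs a + 1))))).
      by rewrite ler_pM ?cabs_ge0 ?(ltW h1) // lerDl.
    by rewrite le_eqVlt; apply/orP; left; apply/eqP; field; rewrite gt_eqF.
  lra.
- by move=> f Lf; exact: (opser_L2 Lf).1.
- by move=> f Lf; exact: (opser_L2 Lf).2.
Qed.

(** Partial sums converge pointwise with bounded norms, hence weakly. Adjoint formulas and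
    membership in the weak closure are read off from the partial sums through this limit. *)
Lemma opser_weak f g : L2 f -> L2 g ->
  (fun k => cabs (\sum_(n < k) ip (A n f) g - ip (opser f) g)) @ \oo --> 0.
Proof.
move=> Lf Lg.
have E k : \sum_(n < k) ip (A n f) g = ip (fun x => \sum_(n < k) A n f x) g.
  by rewrite (ip_suml _ (fun n : 'I_k => strong_L2 (sA n) Lf)).
under eq_fun do rewrite E.
apply: (@weak_limit _ _ _ _ (C * l2norm f)) => //.
- by move=> k; exact: LS.
- exact/L2_cmeas/(opser_L2 Lf).1.
- by move=> k; exact: AC.
- by move=> x; exact: opser_cvg.
Qed.

End OperatorSeries.

(** * Blocks *)

Section Block.
Variable R : realType.
Local Notation mu := (@lebesgue_measure R).
Implicit Types (f g : cfun R).

Definition rc (a : R) : R[i] := Complex a 0.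

Lemma cabs_rc (a : R) : 0 <= a -> cabs (rc a) = a.
Proof. by move=> a0; rewrite cabs_real ger0_norm. Qed.

Lemma rc_conj (a : R) : (rc a)^* = rc a.
Proof. by apply: complex_eq; rewrite cE //= oppr0. Qed.

Section SingleBlock.
Variables (N : nat) (d c : R).
Hypotheses (N0 : (0 < N)%N) (d0 : 0 < d).

Let n0 : 0 < N%:R :> R.
Proof. by rewrite ltr0n. Qed.

Let ni0 : 0 <= N%:R^-1 :> R.
Proof. by rewrite invr_ge0 ltW. Qed.

Lemma cabs_mean (F : nat -> R[i]) (B : R) : (forall j, (j < N)%N -> cabs (F j) <= B) ->
  cabs (rc N%:R^-1 * \sum_(j < N) F j) <= B.
Proof.
move=> FB; rewrite cabsM cabs_rc // mulrC ler_pdivrMr //.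
apply: le_trans (cabs_sum _ _ _) _; apply: (@le_trans _ _ (\sum_(j < N) B)).
  by apply: ler_sum => j _; exact: FB.
by rewrite sumr_const card_ord mulr_natr.
Qed.

Definition hfun (x : R) : R[i] := rc N%:R^-1 * \sum_(j < N) bfun (scale R j * d * (x - c)).

Lemma cmeas_hfun : cmeas hfun.
Proof.
apply: cmeasM; first exact: cmeas_cst.
apply: cmeas_sum => j; apply: (cmeas_comp (cmeas_bfun R)).
apply: measurable_funM => //; exact: measurable_funB.
Qed.

Lemma hfun_le1 x : cabs (hfun x) <= 1.
Proof.
by apply: (@cabs_mean (fun j => bfun (scale R j * d * (x - c)))) => j _; exact: bfun_le1.
Qed.

Lemma scale_le j k : (j <= k)%N -> scale R j <= scale R k.
Proof. by move=> jk; rewrite ler_weXn2l // ler1n. Qed.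

Lemma hfun_lip x y : cabs (hfun x - hfun y) <= d * scale R N * `|x - y|.
Proof.
rewrite /hfun -mulrBr -sumrB; apply: (@cabs_mean (fun j => bfun (scale R j * d * (x - c)) - bfun (scale R j * d * (y - c)))) => j jN.
apply: le_trans (bfun_lip _ _) _; rewrite -mulrBr opprB addrA subrK.
rewrite !normrM (gtr0_norm d0) (gtr0_norm (scale_gt0 _ _)) ler_wpM2r //.
by rewrite mulrC ler_pM2l // scale_le // ltnW.
Qed.

Lemma hfun_center : hfun c = 1.
Proof.
rewrite /hfun subrr; under eq_bigr do rewrite mulr0 bfun0.
rewrite sumr_const card_ord (_ : rc _ = real_complex R N%:R^-1) //.
by rewrite -(rmorph_nat (real_complex R) N) -rmorphM mulVf ?rmorph1 // gt_eqF.
Qed.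

Lemma hfun_decay x : x != c -> cabs (hfun x) <= 8 / (d * `|x - c|).
Proof.
move=> xc; have xc0 : 0 < `|x - c| by rewrite normr_gt0 subr_eq0.
apply: (@cabs_mean (fun j => bfun (scale R j * d * (x - c)))) => j _; have s1 := scale_ge1 R j; have s0 := scale_gt0 R j.
apply: le_trans (bfun_decay _) _.
  by rewrite !mulf_neq0 ?scale_neq0 ?subr_eq0 // gt_eqF.
rewrite ler_pM2l // !normrM (gtr0_norm d0) (gtr0_norm s0).
by rewrite lef_pV2 ?posrE ?mulr_gt0 // ler_wpM2r ?(ltW xc0) // ler_peMl ?(ltW d0).
Qed.

(** The terms grow geometrically up to 1 and decay after it. The potential [phi] stays below 4 and
    rises by at least [Num.min v v^-1] whenever its argument doubles, which lets the induction
    close. *)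
Lemma dyadic_sum (u : R) M : 0 < u ->
  \sum_(j < M) Num.min (scale R j * u) (scale R j * u)^-1 <= 4.
Proof.
move=> u0; pose phi (v : R) := if v <= 2 then v else 4 - 4 / v.
suff h : \sum_(j < M) Num.min (scale R j * u) (scale R j * u)^-1 <= phi (scale R M * u).
  apply: le_trans h _; rewrite /phi; case: ifPn => [h|]; first by lra.
  rewrite -ltNge => h; have : 0 <= 4 / (scale R M * u).
    by rewrite divr_ge0 // mulr_ge0 ?(ltW u0) // ltW // scale_gt0.
  by lra.
elim: M => [|M ih].
  by rewrite big_ord0 /phi; case: ifPn; rewrite /scale expr0 mul1r => h; [lra|];
    rewrite subr_ge0 ler_pdivrMr //; move: h; rewrite -ltNge => h; lra.
rewrite big_ord_recr /=; apply: le_trans (lerD ih (lexx _)) _.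
have -> : scale R M.+1 * u = 2 * (scale R M * u) by rewrite /scale exprS mulrA.
have : 0 < scale R M * u by rewrite mulr_gt0 // scale_gt0.
set v := scale R M * u => v0; rewrite /phi.
have iv : v * v^-1 = 1 by rewrite mulfV // gt_eqF.
have iv0 : 0 < v^-1 by rewrite invr_gt0.
have i2 : 4 / (2 * v) = 2 * v^-1 by field; rewrite gt_eqF.
rewrite i2; have m1 : Num.min v v^-1 <= v by rewrite ge_min lexx.
have m2 : Num.min v v^-1 <= v^-1 by rewrite ge_min lexx orbT.
by case: ifPn => h1; case: ifPn => h2; rewrite -?ltNge in h1 h2; nra.
Qed.

(** Each term is b(v) - b(-v): the Lipschitz bound gives 2|v|, the decay gives 16/|v|, so 16 times
    the smaller of |v| and 1/|v| covers both. The dyadic sum contributes 4, and 16 * 4 = 64. *)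
Lemma hfun_im x : cabs (hfun x - (hfun x)^*) <= 64 / N%:R.
Proof.
have [->|xc] := eqVneq x c.
  by rewrite hfun_center rmorph1 subrr cabs0 divr_ge0 // ltW.
pose u := d * `|x - c|; have u0 : 0 < u by rewrite mulr_gt0 // normr_gt0 subr_eq0.
rewrite /hfun rmorphM /= rc_conj rmorph_sum -mulrBr -sumrB cabsM cabs_rc //.
rewrite mulrC ler_wpM2r //; apply: le_trans (cabs_sum _ _ _) _.
apply: (@le_trans _ _ (\sum_(j < N) 16 * Num.min (scale R j * u) (scale R j * u)^-1)).
  apply: ler_sum => j _ /=; rewrite bfun_conj; set v := scale R j * d * (x - c).
  have v0 : v != 0 by rewrite !mulf_neq0 ?scale_neq0 ?subr_eq0 // gt_eqF.
  have -> : scale R j * u = `|v|.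
    by rewrite /v /u !normrM (gtr0_norm d0) (gtr0_norm (scale_gt0 _ _)) mulrA.
  have vp : 0 < `|v| by rewrite normr_gt0.
  have vi : 0 < `|v|^-1 by rewrite invr_gt0.
  have h1 := bfun_lip v (- v); have h2 := cabsD (bfun v) (- bfun (- v)).
  have h3 := bfun_decay v0; have v0' : - v != 0 by rewrite oppr_eq0.
  have h4 := bfun_decay v0'; rewrite normrN in h4; rewrite cabsN in h2.
  rewrite opprK -mulr2n normrMn in h1.
  have [h|h] := leP `|v| `|v|^-1; last by lra.
  by rewrite -mulr_natl in h1; lra.
by rewrite -mulr_sumr; have := dyadic_sum N u0; lra.
Qed.

(** The sign [s] selects the mean of averages, [s = 1], or its adjoint, [s = -1]. *)
Definition Qop (s : R) : op R := fun f x => rc N%:R^-1 * \sum_(j < N) Bop (s * scale R j) f x.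

Lemma strong_Qop (s : R) : s != 0 -> strong_op (Qop s) 1.
Proof.
move=> s0; have sB j : strong_op (Bop (s * scale R j)) 1.
  by apply: strong_Bop; rewrite mulf_neq0 ?scale_neq0.
have := strong_scale (rc N%:R^-1) (strong_sum N sB).
by rewrite sumr_const card_ord cabs_rc // mulVf // gt_eqF.
Qed.

Lemma Qop_pointwise (s : R) f x : `|s| = 1 -> L2 f -> cabs (Qop s f x) <= l2norm f.
Proof.
move=> s1 Lf; apply: (@cabs_mean (fun j => Bop (s * scale R j) f x)) => j _.
by apply: Bop_pointwise => //; rewrite normrM s1 mul1r ger0_norm ?scale_ge1 // ltW ?scale_gt0.
Qed.

Lemma ip_Qop (s : R) f g : s != 0 -> L2 f -> L2 g -> ip (Qop s f) g = ip f (Qop (- s) g).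
Proof.
move=> s0 Lf Lg; have ss j : s * scale R j != 0 by rewrite mulf_neq0 ?scale_neq0.
have ss' j : - s * scale R j != 0 by rewrite mulNr oppr_eq0.
have L1 j := strong_L2 (strong_Bop (ss j)) Lf.
have L2' j := strong_L2 (strong_Bop (ss' j)) Lg.
rewrite /Qop ipZl ?ipZr //; [|exact: L2_sum..].
rewrite rc_conj ip_suml ?ip_sumr //; congr (_ * _); apply: eq_bigr => j _.
by rewrite mulNr; exact: ip_Bop.
Qed.

(** Almost orthogonality bounds the squared norm of the sum of skew parts by 20 N instead of a
    multiple of N^2; the mean divides it by N^2. *)
Lemma Qop_near f : L2 f -> l2norm (fun x => Qop 1 f x - Qop (-1) f x) <=
  Num.sqrt (20 / N%:R) * l2norm f.
Proof.
move=> Lf; have -> : (fun x => Qop 1 f x - Qop (-1) f x) = fun x => rc N%:R^-1 * Xsum N f x.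
  apply/funext => x; rewrite /Qop -mulrBr -sumrB; congr (_ * _); apply: eq_bigr => j _.
  by rewrite /Xop mul1r mulN1r.
have LX : L2 (Xsum N f).
  exact: (L2_sum _ (fun j : 'I_N => strong_L2 (strong_Xop (scale_neq0 R j)) Lf)).
rewrite l2normZ // cabs_rc //.
rewrite -(@ler_pXn2r _ 2) ?nnegrE ?mulr_ge0 ?l2norm_ge0 ?sqrtr_ge0 //.
have sq : Num.sqrt (20 / N%:R) ^+ 2 = 20 / N%:R :> R by rewrite sqr_sqrtr // divr_ge0 // ltW.
rewrite !exprMn sq.
have := Xsum_norm N Lf; move=> /(ler_wpM2l (sqr_ge0 N%:R^-1)) /le_trans; apply.
by rewrite le_eqVlt; apply/orP; left; apply/eqP; field; rewrite gt_eqF.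
Qed.

Definition Aop : op R := fun f x => hfun x * Qop 1 f x.

Definition Aadj : op R := fun f => Qop (-1) (fun x => (hfun x)^* * f x).

Lemma strong_Aop : strong_op Aop 1.
Proof.
have := strong_comp (strong_Mop cmeas_hfun hfun_le1) (strong_Qop (oner_neq0 _)).
by rewrite mulr1.
Qed.

Lemma strong_Mconj : strong_op (Mop (fun x => (hfun x)^*)) 1.
Proof.
apply: strong_Mop; first exact/cmeas_conj/cmeas_hfun.
by move=> x; rewrite cabs_conj hfun_le1.
Qed.

Lemma strong_Aadj : strong_op Aadj 1.
Proof.
have n1 : -1 != 0 :> R by rewrite oppr_eq0 oner_neq0.
by have := strong_comp (strong_Qop n1) strong_Mconj; rewrite mulr1.
Qed.

Lemma ip_Aop f g : L2 f -> L2 g -> ip (Aop f) g = ip f (Aadj g).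
Proof.
move=> Lf Lg; rewrite -(ip_Qop (oner_neq0 _)) //; last exact: (strong_L2 strong_Mconj Lg).
by apply: cint_ext => x; rewrite rmorphM /= conjCK mulrCA mulrA.
Qed.

(** The commutator is the mean of (h(x) - h(x - st)) f(x - st), and the two arguments of [h] are at
    distance at most |s|. *)
Lemma commutator_Bop (h : R -> R[i]) (K L s : R) f : cmeas h -> (forall x, cabs (h x) <= K) ->
  0 <= L -> (forall x y, cabs (h x - h y) <= L * `|x - y|) -> s != 0 -> L2 f ->
  l2norm (fun x => h x * Bop s f x - Bop s (fun y => h y * f y) x) <= L * `|s| * l2norm f.
Proof.
move=> mh hK L0 hL s0 Lf; have Lhf := (L2M mh hK Lf).1.
have sB := strong_Bop s0; have mf := L2_cmeas Lf.
pose Phi (p : R * R) := rc (L * `|s|) * f (p.1 - s * p.2).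
have mS : measurable_fun setT (fun p : R * R => p.1 - s * p.2).
  apply: measurable_funB; first exact: measurable_fst.
  by apply: measurable_funM => //; exact: measurable_snd.
have mP : cmeas Phi by apply: cmeasM; [exact: cmeas_cst|exact: (cmeas_comp mf mS)].
apply: (avg_dom _ mP _ _ _).2.
- apply: L2_cmeas; apply: L2B; last exact: (strong_L2 sB Lhf).
  exact: (L2M mh hK (strong_L2 sB Lf)).1.
- by rewrite mulr_ge0 ?l2norm_ge0 // mulr_ge0.
- move=> t _; have Lt := L2_shift (s * t) Lf.
  rewrite nsqE; last exact: (L2Z _ Lt).
  rewrite /Phi /= l2normZ // cabs_rc; last exact: mulr_ge0.
  by rewrite l2norm_shift.
move=> x; have iB : cinteg (fun t => box t * (h x * f (x - s * t))).
  exact/cinteg_box/L2Z/L2_affine.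
have -> : h x * Bop s f x - Bop s (fun y => h y * f y) x =
    avg (fun t => (h x - h (x - s * t)) * f (x - s * t)).
  rewrite /Bop -avgZ; last exact/cinteg_box/L2_affine.
  rewrite -avgB //; last exact/cinteg_box/(L2_affine x s0 Lhf).
  by apply: cint_ext => t; rewrite mulrBl.
apply: le_trans (avg_le_e _) _.
  apply: cmeasM; last exact: cmeas_affine.
  by apply: cmeasB; [exact: cmeas_cst|exact: cmeas_affine].
have mabs (F : R -> R[i]) : cmeas F -> measurable_fun setT (fun t => (ibox t * cabs (F t))%:E).
  by move=> mF; apply/measurable_EFinP; exact: (measurable_boxM (measurable_cabs mF)).
apply: ge0_le_integral => //.
- by move=> t _; rewrite lee_fin mulr_ge0 ?ibox_ge0 ?cabs_ge0.
- apply: mabs; apply: cmeasM; last exact: cmeas_affine.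
  by apply: cmeasB; [exact: cmeas_cst|exact: cmeas_affine].
- by apply: mabs; exact: cmeas_pair1.
move=> t _; rewrite lee_fin.
have [/[dup] ht /andP[t0 t1]|ht] := boolP (0 <= t <= 1); last by rewrite ibox_out // !mul0r.
rewrite ibox_in // !mul1r /Phi /= !cabsM cabs_rc; last exact: mulr_ge0.
rewrite ler_wpM2r ?cabs_ge0 //; apply: le_trans (hL _ _) _.
rewrite opprB addrCA subrr addr0 normrM ler_wpM2l // ler_piMr // ger0_norm //.
Qed.

Lemma Qop_commutator f : L2 f ->
  l2norm (fun x => hfun x * Qop (-1) f x - Qop (-1) (fun y => hfun y * f y) x) <=
  d * scale R N * scale R N * l2norm f.
Proof.
move=> Lf; have Lhf := (L2M cmeas_hfun hfun_le1 Lf).1.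
pose F j x := hfun x * Bop (- scale R j) f x - Bop (- scale R j) (fun y => hfun y * f y) x.
have s0 j : - scale R j != 0 by rewrite oppr_eq0 scale_neq0.
have LF j : L2 (F j).
  apply: L2B; last exact: (strong_L2 (strong_Bop (s0 j))).
  exact: (L2M cmeas_hfun hfun_le1 (strong_L2 (strong_Bop (s0 j)) Lf)).1.
have dl : 0 <= d * scale R N by rewrite mulr_ge0 // ltW // scale_gt0.
have -> : (fun x => hfun x * Qop (-1) f x - Qop (-1) (fun y => hfun y * f y) x) =
    fun x => rc N%:R^-1 * \sum_(j < N) F j x.
  apply/funext => x; rewrite /Qop mulrCA -mulrBr mulr_sumr -sumrB; congr (_ * _).
  by apply: eq_bigr => j _; rewrite mulN1r.
rewrite l2normZ; last exact: (L2_sum _ (fun j : 'I_N => LF j)).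
rewrite cabs_rc // mulrC ler_pdivrMr //.
apply: le_trans (l2norm_sum _ (fun j : 'I_N => LF j)) _.
apply: (@le_trans _ _ (\sum_(j < N) d * scale R N * scale R N * l2norm f)); last first.
  by rewrite sumr_const card_ord mulr_natr.
apply: ler_sum => j _; apply: le_trans (commutator_Bop cmeas_hfun hfun_le1 dl hfun_lip (s0 j) Lf) _.
rewrite normrN gtr0_norm ?scale_gt0 // ler_wpM2r ?l2norm_ge0 // ler_wpM2l //.
by rewrite scale_le // ltnW.
Qed.

(** With Q' the adjoint of Q and h' the conjugate of h, hQ - Q'h' = h(Q - Q') + (hQ' - Q'h) + Q'(h -
    h'): near self-adjointness of Q, slow variation of h, near reality of h, one error each. *)
Lemma Aop_near f : L2 f -> l2norm (fun x => Aop f x - Aadj f x) <=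
  (Num.sqrt (20 / N%:R) + d * scale R N * scale R N + 64 / N%:R) * l2norm f.
Proof.
move=> Lf; have n1 : -1 != 0 :> R by rewrite oppr_eq0 oner_neq0.
have sQ := strong_Qop (oner_neq0 R); have sQ' := strong_Qop n1.
have LQ := strong_L2 sQ Lf; have LQ' := strong_L2 sQ' Lf.
have Lhf := (L2M cmeas_hfun hfun_le1 Lf).1; have Lcf := strong_L2 strong_Mconj Lf.
have LM g : L2 g -> L2 (fun x => hfun x * g x) by move=> Lg; exact: (L2M cmeas_hfun hfun_le1 Lg).1.
pose d1 x := hfun x * (Qop 1 f x - Qop (-1) f x).
pose d2 x := hfun x * Qop (-1) f x - Qop (-1) (fun y => hfun y * f y) x.
pose d3 := Qop (-1) (fun y => hfun y * f y - (hfun y)^* * f y).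
have Ld1 : L2 d1 := LM _ (L2B LQ LQ').
have Ld2 : L2 d2 := L2B (LM _ LQ') (strong_L2 sQ' Lhf).
have Ld3 : L2 d3 := strong_L2 sQ' (L2B Lhf Lcf).
have -> : (fun x => Aop f x - Aadj f x) = fun x => d1 x + d2 x + d3 x.
  apply/funext => x; rewrite /d3 (strongB sQ' Lhf Lcf) /d1 /d2 /Aop /Aadj.
  move: (hfun x) (Qop 1 f x) (Qop (-1) f x) (Qop (-1) _ x) (Qop (-1) _ x) => a p q r t.
  by ring.
have h1 : l2norm d1 <= Num.sqrt (20 / N%:R) * l2norm f.
  apply: le_trans (Qop_near Lf); rewrite -[leRHS]mul1r.
  exact: (L2M cmeas_hfun hfun_le1 (L2B LQ LQ')).2.
have h2 : l2norm d2 <= d * scale R N * scale R N * l2norm f := Qop_commutator Lf.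
have h3 : l2norm d3 <= 64 / N%:R * l2norm f.
  apply: le_trans (strong_norm sQ' (L2B Lhf Lcf)) _; rewrite mul1r.
  have E : (fun x => hfun x * f x - (hfun x)^* * f x) = fun x => (hfun x - (hfun x)^*) * f x.
    by apply/funext => x; rewrite mulrBl.
  rewrite /Mop E; apply: (L2M _ hfun_im Lf).2.
  by apply: cmeasB; [|apply: cmeas_conj]; exact: cmeas_hfun.
clearbody d1 d2 d3.
have h12 := l2normD Ld1 Ld2; have h123 := l2normD (L2D Ld1 Ld2) Ld3.
have E (p q r y : R) : (p + q + r) * y = p * y + q * y + r * y by ring.
by rewrite E; exact: (le_trans h123 (lerD (le_trans h12 (lerD h1 h2)) h3)).
Qed.

End SingleBlock.

(** [N] is fixed first and settles the two errors that decay with it. The commutator error contains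
    the square of [scale R N], and [d], chosen afterwards, brings it down to e / 3. *)
Lemma block_parameters (e : R) : 0 < e -> exists N : nat, exists d : R,
  [/\ (0 < N)%N, 0 < d, d * scale R N * scale R N <= e &
      Num.sqrt (20 / N%:R) + d * scale R N * scale R N + 64 / N%:R <= e].
Proof.
move=> e0; have e3 : 0 < e / 3 by lra.
pose B := 20 / (e / 3) ^+ 2 + 64 / (e / 3) + 1.
have B0 : 0 < B by rewrite !addr_gt0 // divr_gt0 // exprn_gt0.
pose N := `|Num.ceil B|%N.+1.
have NB : B <= N%:R.
  apply: le_trans (ceil_ge B) _; rewrite /N.
  rewrite -natr1 natr_absz ger0_norm; last by rewrite ceil_ge0 // (lt_trans _ B0) // ltrN10.
  by rewrite lerDl.
have n0 : 0 < N%:R :> R by rewrite ltr0n.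
have s0 := scale_gt0 R N.
exists N, (e / 3 / (scale R N * scale R N)).
have E : e / 3 / (scale R N * scale R N) * scale R N * scale R N = e / 3.
  by field; rewrite gt_eqF.
split => //; first by rewrite divr_gt0 // mulr_gt0.
  by rewrite E; lra.
rewrite E.
have p1 : 0 <= 20 / (e / 3) ^+ 2 by rewrite divr_ge0 // sqr_ge0.
have p2 : 0 <= 64 / (e / 3) by rewrite divr_ge0 // ltW.
have h1 : Num.sqrt (20 / N%:R) <= e / 3.
  rewrite -(@ler_pXn2r _ 2) ?nnegrE ?sqrtr_ge0 ?(ltW e3) // sqr_sqrtr ?divr_ge0 ?(ltW n0) //.
  rewrite ler_pdivrMr // mulrC -ler_pdivrMr ?exprn_gt0 //.
  by apply: le_trans NB; rewrite /B; lra.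
have h2 : 64 / N%:R <= e / 3.
  rewrite ler_pdivrMr // mulrC -ler_pdivrMr //.
  by apply: le_trans NB; rewrite /B; lra.
by lra.
Qed.

End Block.

(** * Membership in the parabolic algebra *)

Section Annihilator.
Variable R : realType.
Implicit Types (f g : cfun R) (S T : op R).

Lemma gen_alg_strong S : gen_alg S -> exists C, strong_op S C.
Proof.
elim=> [l l0|m m0|S1 S2 _ [C1 s1] _ [C2 s2]|a S1 _ [C1 s1]|S1 S2 _ [C1 s1] _ [C2 s2]].
- exists 1; apply: (strong_Mop (u := fun x => cexp (l * x))).
    by apply: cmeas_cexp; apply: measurable_funM => //; exact: measurable_id.
  by move=> x; rewrite cabs_cexp.
- by exists 1; exact: strong_transl.
- by exists (C1 + C2); exact: strong_add.
- by exists (cabs a * C1); exact: strong_scale.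
- by exists (C1 * C2); exact: strong_comp.
Qed.

Lemma gen_alg_L2 S f : gen_alg S -> L2 f -> L2 (S f).
Proof. by move=> /gen_alg_strong[C sS]; exact: (strong_L2 sS). Qed.

Section FiniteDimension.
Variables (n : nat) (fs gs : nat -> cfun R).
Hypothesis Lfg : forall i, L2 (fs i) /\ L2 (gs i).

Definition pairing_row T : 'rV[R[i]]_n := \row_(i < n) ip (T (fs i)) (gs i).

Let W (v : 'rV[R[i]]_n) := exists2 S, gen_alg S & pairing_row S = v.

Let W_scale (a : R[i]) v : W v -> W (a *: v).
Proof.
move=> [S gS <-]; exists (op_scale a S); first exact: ga_scale.
apply/rowP => i; rewrite !mxE; have [Lf Lg] := Lfg i.
by apply: ipZl => //; exact: gen_alg_L2.
Qed.

Let W_add v w : W v -> W w -> W (v + w).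
Proof.
move=> [S gS <-] [T gT <-]; exists (op_add S T); first exact: ga_add.
apply/rowP => i; rewrite !mxE; have [Lf Lg] := Lfg i.
by apply: ipDl => //; exact: gen_alg_L2.
Qed.

Let W_0 : W 0.
Proof.
rewrite -(scale0r (pairing_row (transl_op 0))); apply: W_scale.
by exists (transl_op 0) => //; exact: ga_D.
Qed.

(* The values of [gen_alg] on finitely many pairs form a subspace of [C^n], so membership is
   decided by the linear functionals vanishing on it. *)
Lemma annihilator_attained T :
  (forall l : 'I_n -> R[i],
    (forall S, gen_alg S -> \sum_(i < n) l i * ip (S (fs i)) (gs i) = 0) ->
    \sum_(i < n) l i * ip (T (fs i)) (gs i) = 0) ->
  exists2 S, gen_alg S & forall i, (i < n)%N -> ip (S (fs i)) (gs i) = ip (T (fs i)) (gs i).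
Proof.
move=> hT.
(* Instead of choosing a basis of the attained subspace, take an independent family of attained
   vectors of maximal size: adding any attained vector outside its row space would enlarge it, so it
   spans. *)
pose Q r := `[< exists2 A : 'M[R[i]]_(r, n), row_free A & forall i, W (row i A) >].
have Q0 : exists r, Q r.
  exists 0%N; apply/asboolP; exists 0 => [|[]//]; by rewrite /row_free mxrank0.
have Qn r : Q r -> (r <= n)%N.
  by move=> /asboolP[A /eqP rA _]; rewrite -[X in (X <= _)%N]rA rank_leq_col.
have [r /asboolP[A fA WA] rmax] := ex_maxnP Q0 Qn.
have sub v : W v -> (v <= A)%MS.
  move=> Wv; apply: contrapT => /negP vA.
  have : Q (1 + r)%N.
    apply/asboolP; exists (col_mx v A : 'M[R[i]]_(1 + r, n)).
      have rk : \rank (col_mx v A) = \rank (v + A)%MS by rewrite addsmxE.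
      rewrite /row_free eqn_leq rank_leq_row /= rk.
      have /eqP rA := fA; rewrite -[X in (1 + X <= _)%N]rA add1n.
      by apply: rank_ltmx; rewrite /ltmx addsmxSr /= addsmx_sub submx_refl andbT.
    move=> i; have [] : (exists j, i = lshift r j) \/ (exists j, i = rshift 1 j).
    - by rewrite -(fintype.splitK i); case: (fintype.split i) => j; [left|right]; exists j.
    - by move=> [j ->]; rewrite (rowKu j v A) row_id.
    - by move=> [j ->]; rewrite (rowKd j v A).
  by move/rmax; rewrite add1n ltnn.
have : W (pairing_row T).
  have [/submxP[u ->]|vA] := boolP (pairing_row T <= A)%MS.
    rewrite mulmx_sum_row; apply: big_ind => // i _; exact: W_scale.
  (* Each column of [cokermx A] is a functional vanishing on the attained vectors, hence on the
     target by hypothesis; together these columns detect membership in the row space. *)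
  move: vA; rewrite submxE => /eqP vA; exfalso; apply: vA.
  apply/matrixP => i j; rewrite ord1 [RHS]mxE mxE.
  under eq_bigr do rewrite mxE mulrC.
  apply: (hT (fun k => cokermx A k j)) => S gS.
  have : (pairing_row S <= A)%MS by apply: sub; exists S.
  rewrite submxE => /eqP /matrixP /(_ 0 j); rewrite [RHS]mxE mxE => H.
  by rewrite -[RHS]H; apply: eq_bigr => k _; rewrite [X in _ = X * _]mxE [RHS]mulrC.
move=> [S gS /rowP E]; exists S => // i ni.
by have := E (Ordinal ni); rewrite !mxE.
Qed.

End FiniteDimension.

(** A weak neighbourhood tests finitely many pairs, and a subspace of a finite-dimensional space is
    closed: agreement within [eps] can be strengthened to exact agreement, which linear functionals
    decide. *)
Lemma Ap_annihilator T : is_bounded_op T ->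
  (forall n (fs gs : nat -> cfun R) (l : 'I_n -> R[i]), (forall i, L2 (fs i) /\ L2 (gs i)) ->
    (forall S, gen_alg S -> \sum_(i < n) l i * ip (S (fs i)) (gs i) = 0) ->
    \sum_(i < n) l i * ip (T (fs i)) (gs i) = 0) -> Ap T.
Proof.
move=> bT hT; split => // n fs gs e e0 Lfg.
have [S gS E] := annihilator_attained Lfg (fun l => hT n fs gs l Lfg).
by exists S; split => // i ni; rewrite E // subrr cabs0.
Qed.

End Annihilator.

(** * Linear relations of the generated algebra hold for blocks *)

Section BlockInAp.
Variable R : realType.
Implicit Types (f g : cfun R) (S T : op R).
Variables (n : nat) (fs gs : nat -> cfun R) (l : 'I_n -> R[i]).
Hypothesis Lfg : forall i, L2 (fs i) /\ L2 (gs i).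
Hypothesis kill : forall S, gen_alg S -> \sum_(i < n) l i * ip (S (fs i)) (gs i) = 0.

Let Lf i : L2 (fs i) := (Lfg i).1.
Let Lg i : L2 (gs i) := (Lfg i).2.

Lemma sum_avg (F : 'I_n -> R -> R[i]) : (forall i, cinteg (fun t => box t * F i t)) ->
  \sum_(i < n) l i * avg (F i) = avg (fun t => \sum_(i < n) l i * F i t).
Proof.
move=> iF; rewrite /avg.
under eq_bigr do rewrite -cintZ //.
rewrite -cint_sum; last by move=> i; exact: cintegZ.
apply: cint_ext => t; rewrite mulr_sumr; apply: eq_bigr => i _; exact: mulrCA.
Qed.

(** For each t the factor e^(iat(x - c)) is the phase e^(-iact) times a generator of frequency at >=
    0, composed here with a translation; the relation holds before averaging, and the mean over t
    keeps it. *)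
Lemma kill_bfun (a c m : R) : 0 <= a -> 0 <= m ->
  \sum_(i < n) l i * ip (fun x => bfun (a * (x - c)) * fs i (x - m)) (gs i) = 0.
Proof.
move=> a0 m0.
pose Phi i (p : R * R) := cexp (a * (p.1 - c) * p.2) * fs i (p.1 - m).
have mE : cmeas (fun p : R * R => cexp (a * (p.1 - c) * p.2)).
  apply: cmeas_cexp; apply: measurable_funM; last exact: measurable_snd.
  apply: measurable_funM => //; apply: measurable_funB => //; exact: measurable_fst.
have mP i : cmeas (Phi i).
  apply: cmeasM => //; apply: (cmeas_comp (L2_cmeas (Lf i))).
  by apply: measurable_funB => //; exact: measurable_fst.
have bP i t : 0 <= t <= 1 -> (nsq (fun x => Phi i (x, t)) <= (l2norm (fs i) ^+ 2)%:E)%E.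
  move=> _; have Ls := L2_shift m (Lf i).
  have [LP nP] : L2 (fun x => Phi i (x, t)) /\ l2norm (fun x => Phi i (x, t)) <=
      1 * l2norm (fun x => fs i (x - m)).
    by apply: L2M => // [|x]; [exact: (cmeas_pair2 t mE)|rewrite cabs_cexp].
  rewrite nsqE // lee_fin ler_pXn2r ?nnegrE ?l2norm_ge0 //.
  by rewrite mul1r l2norm_shift in nP; [exact: nP|exact: L2_cmeas].
have iP i x : cinteg (fun t => box t * Phi i (x, t)).
  apply: (cinteg_box_bounded (C := cabs (fs i (x - m)))); first exact: cmeas_pair1.
  by move=> t _; rewrite cabsM cabs_cexp mul1r.
have E i := ip_avg (mP i) (l2norm_ge0 _) (bP i) (iP i) (Lg i).
have EB i : (fun x => bfun (a * (x - c)) * fs i (x - m)) = (fun x => avg (fun t => Phi i (x, t))).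
  apply/funext => x; rewrite /bfun mulrC -avgZ; last exact: cinteg_box_cexp.
  by apply: cint_ext => t; rewrite /Phi /= [cexp _ * _]mulrC.
have EE i : ip (fun x => bfun (a * (x - c)) * fs i (x - m)) (gs i) =
    avg (fun t => ip (fun x => Phi i (x, t)) (gs i)).
  by rewrite EB; exact: (E i).2.
under eq_bigr do rewrite EE.
rewrite (sum_avg (fun i : 'I_n => (E i).1)) -[RHS](avg_cst 0); apply: avg_eq => t /andP[t0 _].
have lam0 : 0 <= a * t by exact: mulr_ge0.
have := kill (ga_comp (ga_M lam0) (ga_D m0)).
move=> /(congr1 (fun z => cexp (- (a * c * t)) * z)); rewrite mulr0 => H.
rewrite -[RHS]H mulr_sumr; apply: eq_bigr => i _; rewrite mulrCA; congr (_ * _).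
rewrite -ipZl //; last exact: (gen_alg_L2 (ga_comp (ga_M lam0) (ga_D m0))).
apply: cint_ext => x; congr (_ * _).
rewrite /Phi /op_comp /mult_op /transl_op /= mulrA; congr (_ * _).
by rewrite -[Complex _ _]/(cexp _) -cexpD; congr cexp; ring.
Qed.

Lemma kill_hfun (N : nat) (d c m : R) : 0 < d -> 0 <= m ->
  \sum_(i < n) l i * ip (fun x => hfun N d c x * fs i (x - m)) (gs i) = 0.
Proof.
move=> d0 m0; have ad j : 0 <= scale R j * d by rewrite mulr_ge0 ?ltW ?scale_gt0.
have mb (a : R) : cmeas (fun x : R => bfun (a * (x - c))).
  apply: (cmeas_comp (cmeas_bfun R)); apply: measurable_funM => //; exact: measurable_funB.
have LB i j : L2 (fun x => bfun (scale R j * d * (x - c)) * fs i (x - m)).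
  by apply: (L2M (mb _) (fun x => bfun_le1 _) (L2_shift m (Lf i))).1.
have E i : ip (fun x => hfun N d c x * fs i (x - m)) (gs i) =
    rc N%:R^-1 * \sum_(j < N) ip (fun x => bfun (scale R j * d * (x - c)) * fs i (x - m)) (gs i).
  rewrite -(ip_suml _ (fun j : 'I_N => LB i j)) // -ipZl //; last first.
    exact: (L2_sum _ (fun j : 'I_N => LB i j)).
  by congr ip; apply/funext => x; rewrite /hfun -mulrA mulr_suml.
under eq_bigr do rewrite E mulrCA mulr_sumr.
rewrite -mulr_sumr exchange_big big1 ?mulr0 // => j _; exact: kill_bfun.
Qed.

(** The multiplier is first moved onto [gs], so that the remaining average is over translations
    alone; at each fixed t, moving it back leaves a multiplier times one translation, which
    [kill_hfun] covers. *)
Lemma kill_Aop (N : nat) (d c : R) : (0 < N)%N -> 0 < d ->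
  \sum_(i < n) l i * ip (Aop N d c (fs i)) (gs i) = 0.
Proof.
move=> N0 d0; pose g' i : cfun R := fun x => (hfun N d c x)^* * gs i x.
have Lg' i : L2 (g' i) := strong_L2 (strong_Mconj d c N0) (Lg i).
have s0 j : 1 * scale R j != 0 by rewrite mul1r scale_neq0.
have LB i j := strong_L2 (strong_Bop (s0 j)) (Lf i).
have E i : ip (Aop N d c (fs i)) (gs i) =
    rc N%:R^-1 * \sum_(j < N) ip (Bop (1 * scale R j) (fs i)) (g' i).
  rewrite -(ip_suml _ (fun j : 'I_N => LB i j)) // -ipZl //; last first.
    exact: (L2_sum _ (fun j : 'I_N => LB i j)).
  apply: cint_ext => x; by rewrite /Aop /g' rmorphM /= conjCK [RHS]mulrCA mulrA.
under eq_bigr do rewrite E mulrCA mulr_sumr.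
rewrite -mulr_sumr exchange_big big1 ?mulr0 // => j _.
have EB i := ip_Bop_avg (s0 j) (Lf i) (Lg' i).
rewrite (eq_bigr (fun i : 'I_n =>
  l i * avg (fun t => ip (transl_op (1 * scale R j * t) (fs i)) (g' i)))); last first.
  by move=> i _; rewrite (EB i).2.
rewrite (sum_avg (fun i : 'I_n => (EB i).1)) -[RHS](avg_cst 0); apply: avg_eq => t /andP[t0 _].
have m0 : 0 <= 1 * scale R j * t by rewrite mul1r mulr_ge0 // ltW // scale_gt0.
rewrite -[RHS](kill_hfun N c d0 m0); apply: eq_bigr => i _; congr (_ * _).
by apply: cint_ext => x; rewrite /g' /transl_op rmorphM /= conjCK [LHS]mulrCA mulrA.
Qed.

End BlockInAp.

(** * Compactness *)

Section TotallyBounded.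
Variable R : realType.
Implicit Types (f g u : cfun R) (S T : op R).

(** Nets are indexed by any finite type, so that a sum of operators can use pairs of indices;
    [cpt_compact] converts them to the numbered nets of [compact_op]. *)
Definition ctb (A : cfun R -> Prop) := forall e : R, 0 < e ->
  exists (I : finType) (u : I -> cfun R), (forall i, L2 (u i)) /\
    forall f, A f -> exists i, l2norm (fun x => f x - u i x) < e.

Definition cpt T := ctb (fun g => exists f, [/\ L2 f, l2norm f <= 1 & g = T f]).

Lemma cpt_approx T : (forall f, L2 f -> L2 (T f)) ->
  (forall e, 0 < e -> exists T', [/\ forall f, L2 f -> L2 (T' f), cpt T' &
    forall f, L2 f -> l2norm f <= 1 -> l2norm (fun x => T f x - T' f x) < e]) -> cpt T.
Proof.
move=> LT h e e0; have e2 : 0 < e / 2 by lra.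
have [T' [LT' cT' TT']] := h _ e2; have [I [u [Lu net]]] := cT' _ e2.
exists I, u; split => // _ [f [Lf f1 ->]].
have [i hi] := net (T' f) (ex_intro _ f (And3 Lf f1 erefl)); exists i.
have -> : (fun x => T f x - u i x) = fun x => (T f x - T' f x) + (T' f x - u i x).
  by apply/funext => x; rewrite addrA subrK.
apply: le_lt_trans (l2normD (L2B (LT _ Lf) (LT' _ Lf)) (L2B (LT' _ Lf) (Lu i))) _.
by have := TT' f Lf f1; lra.
Qed.

Lemma cpt_add S T : (forall f, L2 f -> L2 (S f)) -> (forall f, L2 f -> L2 (T f)) ->
  cpt S -> cpt T -> cpt (fun f x => S f x + T f x).
Proof.
move=> LS LT cS cT e e0; have e2 : 0 < e / 2 by lra.
have [I [u [Lu nu]]] := cS _ e2; have [J [v [Lv nv]]] := cT _ e2.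
exists (I * J)%type, (fun p x => u p.1 x + v p.2 x); split.
  by move=> p; apply: L2D.
move=> _ [f [Lf f1 ->]].
have [i hi] := nu (S f) (ex_intro _ f (And3 Lf f1 erefl)).
have [j hj] := nv (T f) (ex_intro _ f (And3 Lf f1 erefl)).
exists (i, j) => /=.
have -> : (fun x => S f x + T f x - (u i x + v j x)) =
    fun x => (S f x - u i x) + (T f x - v j x).
  by apply/funext => x; rewrite opprD addrACA.
apply: le_lt_trans (l2normD (L2B (LS _ Lf) (Lu i)) (L2B (LT _ Lf) (Lv j))) _.
lra.
Qed.

Lemma cpt_left S C T : strong_op S C -> (forall f, L2 f -> L2 (T f)) -> cpt T ->
  cpt (fun f => S (T f)).
Proof.
move=> sS LT cT e e0; have [C0 _ _ _] := sS.
have C1 : 0 < C + 1 by rewrite ltr_wpDl.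
have [I [u [Lu nu]]] := cT _ (divr_gt0 e0 C1).
exists I, (fun i => S (u i)); split; first by move=> i; exact: (strong_L2 sS).
move=> _ [f [Lf f1 ->]].
have [i hi] := nu (T f) (ex_intro _ f (And3 Lf f1 erefl)); exists i.
have Ld := L2B (LT _ Lf) (Lu i).
rewrite -(strongB sS (LT _ Lf) (Lu i)); apply: le_lt_trans (strong_norm sS Ld) _.
move: hi; rewrite ltr_pdivlMr //; apply: le_lt_trans; rewrite mulrC.
by rewrite ler_wpM2l ?l2norm_ge0 // lerDl.
Qed.

Lemma cpt_right S C T D : strong_op S C -> strong_op T D -> cpt T ->
  cpt (fun f => T (S f)).
Proof.
move=> sS sT cT e e0; have [C0 _ _ _] := sS.
(* Dividing [S f] by C + 1 puts it in the unit ball, also when C = 0; the net for [T] is scaled back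
   by the same factor. *)
have C1 : 0 < C + 1 by rewrite ltr_wpDl.
have C1' : C + 1 != 0 by rewrite gt_eqF.
have [I [u [Lu nu]]] := cT _ (divr_gt0 e0 C1).
exists I, (fun i x => rc (C + 1) * u i x); split; first by move=> i; exact: L2Z.
move=> _ [f [Lf f1 ->]].
have LSf := strong_L2 sS Lf; have Lg := L2Z (rc (C + 1)^-1) LSf.
have g1 : l2norm (fun x => rc (C + 1)^-1 * S f x) <= 1.
  rewrite l2normZ // cabs_rc ?invr_ge0 ?(ltW C1) // ler_pdivrMl // mulr1.
  apply: le_trans (strong_norm sS Lf) _.
  by apply: le_trans (ler_wpM2l C0 f1) _; rewrite mulr1 lerDl.
have [i hi] := nu _ (ex_intro _ _ (And3 Lg g1 erefl)); exists i.
move: hi; rewrite (strongZ _ sT LSf); set w := T (S f).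
have -> : (fun x => w x - rc (C + 1) * u i x) =
    fun x => rc (C + 1) * (rc (C + 1)^-1 * w x - u i x).
  apply/funext => x; rewrite mulrBr mulrA; congr (_ - _).
  have -> : rc (C + 1) * rc (C + 1)^-1 = 1.
    by apply: complex_eq; rewrite !cE /= ?mulr0 ?mul0r ?subr0 ?addr0 // divff.
  by rewrite mul1r.
rewrite (l2normZ (rc (C + 1)) (L2B (L2Z _ (strong_L2 sT LSf)) (Lu i))).
by rewrite cabs_rc ?(ltW C1) // ltr_pdivlMr // mulrC.
Qed.

Lemma cpt_compact T C : strong_op T C -> cpt T -> compact_op T.
Proof.
move=> sT cT; split; first exact: strong_bounded sT.
move=> e e0; have [I [u [Lu nu]]] := cT e e0.
exists #|I|, (fun k => if insub k is Some o then u (enum_val (o : 'I_#|I|)) else fun=> 0).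
split; first by move=> k; case: insubP => [i0 _ _ | _]; [exact: Lu|exact: L2_0].
move=> f Lf f1; have [i hi] := nu (T f) (ex_intro _ f (And3 Lf f1 erefl)).
exists (enum_rank i); split; first exact: ltn_ord.
by rewrite valK enum_rankK.
Qed.

Lemma real_net (K e : R) : 0 < e -> exists (m : nat) (v : 'I_m -> R),
  forall t, `|t| <= K -> exists i, `|t - v i| < e.
Proof.
move=> e0; pose m := (Num.truncn (2 * K / e)).+1.
exists m, (fun i : 'I_m => - K + (i : nat)%:R * e).
move=> t; rewrite ler_norml => /andP[t1 t2].
have p0 : 0 <= (t + K) / e by rewrite divr_ge0 ?(ltW e0) //; lra.
have /andP[l1 l2] := truncn_itv p0.
have im : (Num.truncn ((t + K) / e) < m)%N.
  by rewrite ltnS; apply: le_truncn; rewrite ler_pM2r ?invr_gt0 //; lra.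
exists (Ordinal im) => /=.
move: l1 l2; set k := Num.truncn _; rewrite ler_pdivlMr // ltr_pdivrMr // -natr1 [(_ + 1) * e]mulrDl mul1r => l1 l2.
by rewrite ltr_norml; apply/andP; split; lra.
Qed.

Lemma ctb_line u (K : R) : L2 u ->
  ctb (fun g => exists2 z : R[i], cabs z <= K & g = fun x => z * u x).
Proof.
move=> Lu e e0; have u1 : 0 < l2norm u + 1 by rewrite ltr_wpDl ?l2norm_ge0.
have e1 : 0 < e / (l2norm u + 1) / 2 by rewrite !divr_gt0.
have [m [v nv]] := real_net K e1.
exists ('I_m * 'I_m)%type, (fun p x => Complex (v p.1) (v p.2) * u x); split.
  by move=> p; exact: L2Z.
move=> _ [z zK ->].
have [i hi] := nv _ (le_trans (Re_le_cabs z) zK).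
have [j hj] := nv _ (le_trans (Im_le_cabs z) zK).
exists (i, j) => /=.
have -> : (fun x => z * u x - Complex (v i) (v j) * u x) =
    fun x => (z - Complex (v i) (v j)) * u x by apply/funext => x; rewrite mulrBl.
rewrite l2normZ //.
have zv : cabs (z - Complex (v i) (v j)) <= e / (l2norm u + 1).
  apply: le_trans (cabs_le_ReIm _) _; rewrite !cE /=; lra.
apply: (@le_lt_trans _ _ (e / (l2norm u + 1) * l2norm u)).
  by rewrite ler_wpM2r ?l2norm_ge0.
rewrite -[ltRHS]mulr1 -mulrA ltr_pM2l // ltr_pdivrMl // mulr1.
by rewrite ltrDl.
Qed.

Lemma cpt_rank_one u (phi : cfun R -> R[i]) (K : R) : L2 u ->
  (forall f, L2 f -> l2norm f <= 1 -> cabs (phi f) <= K) -> cpt (fun f x => phi f * u x).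
Proof.
move=> Lu pK e e0; have [I [v [Lv nv]]] := ctb_line K Lu e0.
exists I, v; split => // _ [f [Lf f1 ->]]; apply: nv.
by exists (phi f) => //; exact: pK.
Qed.

Lemma cpt_zero : cpt (fun _ _ => 0).
Proof.
move=> e e0; exists unit, (fun _ _ => 0); split; first by move=> _; exact: L2_0.
move=> _ [f [_ _ ->]]; exists tt; under eq_fun do rewrite subrr.
by rewrite l2norm0.
Qed.

Lemma cpt_sum (N : nat) (F : nat -> op R) : (forall j f, L2 f -> L2 (F j f)) ->
  (forall j, (j < N)%N -> cpt (F j)) -> cpt (fun f x => \sum_(j < N) F j f x).
Proof.
move=> LF; elim: N => [|N ih] cF.
  by rewrite (_ : (fun f x => _) = fun _ _ => 0); [exact: cpt_zero|];
    apply/funext => f; apply/funext => x; rewrite big_ord0.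
rewrite (_ : (fun f x => _) = fun f x => (\sum_(j < N) F j f x) + F N f x); last first.
  by apply/funext => f; apply/funext => x; rewrite big_ord_recr.
apply: cpt_add.
- by move=> f Lf; apply: (L2_sum _ (fun j : 'I_N => LF j f Lf)).
- exact: LF.
- have cF' j : (j < N)%N -> cpt (F j) by move=> jN; apply: cF; exact: ltnW.
  exact: (ih cF').
- exact: cF.
Qed.

End TotallyBounded.

(** * Compactness of averages damped at infinity *)

Section CompactBox.
Variable R : realType.
Implicit Types (f g : cfun R).

(** Half-open, so that consecutive intervals of a grid tile and a point lies in exactly one of
    them. *)
Definition icc (a b x : R) : R[i] := if a <= x < b then 1 else 0.

Lemma cabs_icc a b x : cabs (icc a b x) <= 1.
Proof. by rewrite /icc; case: ifP => _; rewrite ?cabs1 ?cabs0. Qed.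

Lemma cmeas_icc a b : cmeas (icc a b).
Proof.
rewrite (_ : icc a b = fun x => rc (\1_(`[a, b[%classic) x)).
  by apply: cmeas_real; exact: measurable_indic.
apply/funext => x; rewrite /icc indicE; case: ifP => h.
  by rewrite mem_set //= in_itv.
by rewrite memNset //= in_itv /= h.
Qed.

Lemma L2_icc a b : L2 (icc a b).
Proof.
have [ab|ba] := ltP a b; last first.
  rewrite (_ : icc a b = fun=> 0); first exact: L2_0.
  apply/funext => x; rewrite /icc; case: ifP => // /andP[h1 h2].
  by have := le_lt_trans h1 h2; rewrite ltNge ba.
have ab0 : b - a != 0 by rewrite subr_eq0 gt_eqF.
have abp : 0 < b - a by rewrite subr_gt0.
apply: (L2_dom (cmeas_icc a b) (L2_wbox b ab0) ler01 _).1 => x.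
rewrite mul1r cabs_box /icc; case: ifP => [/andP[h1 h2]|_]; last first.
  by rewrite cabs0 ibox_ge0.
rewrite cabs1 ibox_in //; apply/andP; split; first by rewrite divr_ge0 ?(ltW abp) //; lra.
by rewrite ler_pdivrMr // mul1r; lra.
Qed.

(** Averages vary slowly, so sampling [Bop s f] on a grid of mesh [a] costs at most 4a/s in norm.
    The sampled function is of finite rank, its coefficients being the point values, bounded on the
    unit ball. *)
Lemma cpt_icc_Bop (M s : R) : 1 <= s -> cpt (fun f x => icc (- M) M x * Bop s f x).
Proof.
move=> s1; have s0 : 0 < s by rewrite (lt_le_trans ltr01).
have s0' : s != 0 by rewrite gt_eqF.
have sB := strong_Bop s0'.
apply: cpt_approx.
  move=> f Lf; apply: (L2M (cmeas_icc _ _) (cabs_icc _ _) (strong_L2 sB Lf)).1.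
move=> e e0.
pose k := (Num.truncn (4 / s / e)).+1; have k0 : 0 < k%:R :> R by rewrite ltr0n.
pose a : R := k%:R^-1; have a0 : 0 < a by rewrite invr_gt0.
have ke : 4 * a / s < e.
  rewrite /a; have := truncnS_gt (4 / s / e); rewrite -/k.
  rewrite ltr_pdivrMr // => h.
  have -> : 4 / k%:R / s = 4 / s / k%:R by ring.
  by rewrite ltr_pdivrMr // [ltRHS]mulrC.
pose m := (Num.truncn (2 * M / a)).+1.
pose xj (j : nat) : R := - M + j%:R * a.
pose F (j : nat) : op R := fun f x => Bop s f (xj j) * icc (xj j) (xj j.+1) x.
pose T' : op R := fun f x => icc (- M) M x * \sum_(j < m) F j f x.
have LF j f : L2 f -> L2 (F j f) by move=> _; apply: L2Z; exact: L2_icc.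
have LS f : L2 f -> L2 (fun x => \sum_(j < m) F j f x).
  by move=> Lf; exact: (L2_sum _ (fun j : 'I_m => LF j f Lf)).
have LT' f : L2 f -> L2 (T' f).
  by move=> Lf; exact: (L2M (cmeas_icc _ _) (cabs_icc _ _) (LS f Lf)).1.
exists T'; split => //.
  apply: (cpt_left (strong_Mop (cmeas_icc (- M) M) (cabs_icc (- M) M)) LS).
  apply: cpt_sum => // j jm.
  apply: (@cpt_rank_one _ (icc (xj j) (xj j.+1)) (fun f => Bop s f (xj j)) 1).
    exact: L2_icc.
  move=> f Lf f1; apply: le_trans f1; apply: Bop_pointwise => //.
  by rewrite ger0_norm // ltW.
move=> f Lf f1; apply: (@le_lt_trans _ _ (4 * a / s * l2norm f)); last first.
  apply: le_lt_trans ke; rewrite ler_piMr //.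
  by apply: divr_ge0 (ltW s0); apply: mulr_ge0 (ltW a0); rewrite ler0n.
apply: (Bop_diff_norm a0 s0 Lf).
  apply: L2_cmeas; apply: (L2B _ (LT' f Lf)).
  exact: (L2M (cmeas_icc _ _) (cabs_icc _ _) (strong_L2 sB Lf)).1.
move=> x; rewrite /T' -mulrBr cabsM.
have rhs : 0 <= 2 * a / s * (cabs (Bop (2 * a) (absf f) (x + a)) +
    cabs (Bop (2 * a) (absf f) (x - s + a))).
  by rewrite mulr_ge0 ?addr_ge0 ?cabs_ge0 // divr_ge0 ?(ltW s0) // mulr_ge0 // ltW.
rewrite {1}/icc; case: ifP => [/andP[x1 x2]|_]; last by rewrite cabs0 mul0r.
rewrite cabs1 mul1r.
have p0 : 0 <= (x + M) / a by rewrite divr_ge0 ?(ltW a0) //; lra.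
have /andP[l1 l2] := truncn_itv p0; set j0 := Num.truncn ((x + M) / a) in l1 l2.
have jm : (j0 < m)%N.
  by rewrite ltnS; apply: le_truncn; rewrite ler_pM2r ?invr_gt0 //; lra.
have h1 : xj j0 <= x by rewrite /xj addrC lerBlDr -ler_pdivlMr.
have h2 : x < xj j0.+1 by rewrite /xj addrC ltrBrDr -ltr_pdivrMr.
have -> : \sum_(j < m) F j f x = Bop s f (xj j0).
  rewrite (bigD1 (Ordinal jm)) //= [X in _ + X]big1 ?addr0; last first.
    move=> j jj; rewrite /F /icc; case: ifP => [/andP[u1 u2]|]; last by rewrite mulr0.
    have mono p q : xj p <= x -> x < xj q.+1 -> (p <= q)%N.
      move=> v1 v2; have : xj p < xj q.+1 by exact: le_lt_trans v1 v2.
      by rewrite /xj ltrD2l ltr_pM2r // ltr_nat ltnS.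
    have E : (j : nat) = j0 by apply/eqP; rewrite eqn_leq !mono.
    by case/negP: jj; apply/eqP/val_inj.
  by rewrite /F /icc h1 h2 mulr1.
have xj1 : xj j0.+1 = xj j0 + a by rewrite /xj -natr1; ring.
rewrite xj1 in h2.
apply: Bop_diff => //; first by rewrite gerBl lerDl ltW.
by rewrite lerBlDr (ltW h2) (le_trans h1) // lerDl ltW.
Qed.

Section Multipliers.
Variables (h : R -> R[i]) (K s : R).
Hypotheses (mh : cmeas h) (hK : forall x, cabs (h x) <= K) (s1 : 1 <= s).
Hypothesis hdec : forall e, 0 < e -> exists M, forall x, M <= `|x| -> cabs (h x) <= e.

Let s0 : s != 0.
Proof. by rewrite gt_eqF // (lt_le_trans ltr01). Qed.

Let sB : strong_op (Bop s) 1 := strong_Bop s0.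

Let LM f : L2 f -> L2 (fun x => h x * f x).
Proof. by move=> Lf; exact: (L2M mh hK Lf).1. Qed.

Let Li (M : R) f : L2 f -> L2 (fun x => icc (- M) M x * f x).
Proof. by move=> Lf; exact: (L2M (cmeas_icc _ _) (cabs_icc _ _) Lf).1. Qed.

Let cut e : 0 < e -> exists M, forall x, cabs (h x * (1 - icc (- M) M x)) <= e.
Proof.
move=> e0; have [M hM] := hdec e0; exists (M + 1) => x; rewrite cabsM /icc.
case: ifPn => hx; first by rewrite subrr cabs0 mulr0 ltW.
rewrite subr0 cabs1 mulr1; apply: hM.
move: hx; rewrite negb_and -ltNge -leNgt => /orP[hx|hx].
  by have := ler_norm (- x); rewrite normrN; lra.
by have := ler_norm x; lra.
Qed.

Let cmeas_cut M : cmeas (fun x => h x * (1 - icc (- M) M x)).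
Proof. by apply: cmeasM => //; apply: cmeasB; [exact: cmeas_cst|exact: cmeas_icc]. Qed.

Lemma cpt_Mop_Bop : cpt (fun f x => h x * Bop s f x).
Proof.
apply: cpt_approx => [f Lf|e e0]; first exact/LM/(strong_L2 sB).
have e2 : 0 < e / 2 by lra.
have [M hM] := cut e2.
have LB f : L2 f -> L2 (fun x => icc (- M) M x * Bop s f x).
  by move=> Lf; apply: Li; exact: (strong_L2 sB).
exists (fun f => Mop h (fun x => icc (- M) M x * Bop s f x)); split.
- by move=> f Lf; exact/LM/LB.
- by apply: (cpt_left (strong_Mop mh hK) LB); exact: cpt_icc_Bop.
move=> f Lf f1; have LBf := strong_L2 sB Lf.
have -> : (fun x => h x * Bop s f x - Mop h (fun y => icc (- M) M y * Bop s f y) x) =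
    fun x => (h x * (1 - icc (- M) M x)) * Bop s f x.
  by apply/funext => x; rewrite /Mop; ring.
apply: le_lt_trans (L2M (cmeas_cut M) hM LBf).2 _.
have := strong_norm sB Lf; rewrite mul1r => h1.
apply: (@le_lt_trans _ _ (e / 2)); last by lra.
by rewrite ler_piMr ?(ltW e2) // (le_trans h1).
Qed.

(** Here the multiplier acts before the average, while sampling wants a cut-off after it. Once the
    multiplier is cut to [-M0, M0), the average [Bop s] spreads the support by at most [s], so a
    cut-off at [M] can be inserted at no cost; [Bop (- s)] is a shift of [Bop s]. *)
Lemma cpt_Bop_Mop : cpt (fun f => Bop (- s) (fun x => h x * f x)).
Proof.
have ns0 : - s != 0 by rewrite oppr_eq0.
have sN := strong_Bop ns0.
apply: cpt_approx => [f Lf|e e0]; first exact/(strong_L2 sN)/LM.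
have e2 : 0 < e / 2 by lra.
have [M0 hM0] := cut e2.
pose M := Num.max M0 0 + s.
have sp : 0 < s by rewrite (lt_le_trans ltr01).
have MM0 : M0 + s <= M by rewrite lerD2r le_max lexx.
pose V : op R := fun f => Bop s (fun x => icc (- M0) M0 x * (h x * f x)).
have sV : strong_op V (1 * (1 * K)).
  apply: (strong_comp sB).
  exact: (strong_comp (strong_Mop (cmeas_icc _ _) (cabs_icc (- M0) M0)) (strong_Mop mh hK)).
have VE : V = fun f x => icc (- M) M x * Bop s (fun y => icc (- M0) M0 y * (h y * f y)) x.
  apply/funext => f; apply/funext => x; rewrite {1}/icc; case: ifPn => hx; first by rewrite mul1r.
  rewrite mul0r /V /Bop; transitivity (avg (fun _ : R => 0 : R[i])); last exact: avg_cst.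
  apply: avg_eq => t /andP[t0 t1].
  rewrite /icc; case: ifP => [/andP[y1 y2]|_]; last by rewrite mul0r.
  case/negP: hx; have st0 : 0 <= s * t by rewrite mulr_ge0 // ltW.
  have st1 : s * t <= s by rewrite ler_piMr // ltW.
  by apply/andP; split; lra.
have cV : cpt V.
  rewrite VE.
  have := cpt_right (strong_comp (strong_Mop (cmeas_icc _ _) (cabs_icc (- M0) M0)) (strong_Mop mh hK))
    (strong_comp (strong_Mop (cmeas_icc _ _) (cabs_icc (- M) M)) sB) (cpt_icc_Bop M s1).
  by [].
exists (fun f => transl_op (- s) (V f)); split.
- by move=> f Lf; apply: (strong_L2 (strong_transl _)); exact: (strong_L2 sV).
- by apply: (cpt_left (strong_transl _)) cV => f Lf; exact: (strong_L2 sV).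
move=> f Lf f1.
have Lc : L2 (fun x => (h x * (1 - icc (- M0) M0 x)) * f x) := (L2M (cmeas_cut M0) hM0 Lf).1.
have Lihf := Li M0 (LM Lf).
have -> : (fun x => Bop (- s) (fun y => h y * f y) x - transl_op (- s) (V f) x) =
    Bop (- s) (fun x => (h x * (1 - icc (- M0) M0 x)) * f x).
  rewrite (_ : (fun x => h x * (1 - icc (- M0) M0 x) * f x) =
      fun x => h x * f x - icc (- M0) M0 x * (h x * f x)); last first.
    by apply/funext => x; ring.
  rewrite (strongB sN (LM Lf) Lihf); apply/funext => x; congr (_ - _).
  by rewrite (Bop_opp x s0 Lihf) /transl_op opprK.
apply: le_lt_trans (strong_norm sN Lc) _; rewrite mul1r.
apply: le_lt_trans (L2M (cmeas_cut M0) hM0 Lf).2 _.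
apply: (@le_lt_trans _ _ (e / 2)); last by lra.
by rewrite ler_piMr ?(ltW e2).
Qed.

End Multipliers.

End CompactBox.

(** * Compactness and pointwise bounds of a single block *)

Section BlockProperties.
Variable R : realType.
Implicit Types (f g : cfun R).

Lemma ip_Mop (u : R -> R[i]) f g : ip (fun x => u x * f x) g = ip f (fun x => (u x)^* * g x).
Proof. by apply: cint_ext => x; rewrite rmorphM /= conjCK [u x * _]mulrC mulrA. Qed.

Variables (N : nat) (d c : R).
Hypotheses (N0 : (0 < N)%N) (d0 : 0 < d).

Let h := hfun N d c.

Lemma hfun_vanish e : 0 < e -> exists M, forall x, M <= `|x| -> cabs (h x) <= e.
Proof.
move=> e0; exists (`|c| + 8 / (d * e)) => x hx.
have p0 : 0 < 8 / (d * e) by rewrite divr_gt0 // mulr_gt0.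
have xc : 8 / (d * e) <= `|x - c| by have := lerB_dist x c; lra.
have xc0 : 0 < `|x - c| by exact: lt_le_trans p0 xc.
apply: le_trans (hfun_decay N0 d0 _) _; first by rewrite -subr_eq0 -normr_gt0.
rewrite ler_pdivrMr ?mulr_gt0 //; move: xc; rewrite ler_pdivrMr ?mulr_gt0 //.
by have -> : `|x - c| * (d * e) = e * (d * `|x - c|) by ring.
Qed.

Lemma cpt_Aop : cpt (Aop N d c).
Proof.
pose F j : op R := fun f x => h x * Bop (scale R j) f x.
have LF j f : L2 f -> L2 (F j f).
  move=> Lf; apply: (L2M (cmeas_hfun N d c) (hfun_le1 d c N0) _).1.
  exact: (strong_L2 (strong_Bop (scale_neq0 R j))).
have -> : Aop N d c = fun f => Mop (fun=> rc N%:R^-1) (fun x => \sum_(j < N) F j f x).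
  apply/funext => f; apply/funext => x; rewrite /Aop /Qop /Mop mulrCA mulr_sumr.
  by congr (_ * _); apply: eq_bigr => j _; rewrite mul1r.
apply: cpt_left.
- exact: (strong_Mop (cmeas_cst _) (fun=> lexx _)).
- by move=> f Lf; exact: (L2_sum _ (fun j : 'I_N => LF j f Lf)).
apply: cpt_sum => // j _.
exact: (cpt_Mop_Bop (cmeas_hfun N d c) (hfun_le1 d c N0) (scale_ge1 R j) hfun_vanish).
Qed.

Lemma cpt_Aadj : cpt (Aadj N d c).
Proof.
pose F j : op R := fun f => Bop (- scale R j) (fun x => (h x)^* * f x).
have LF j f : L2 f -> L2 (F j f).
  move=> Lf; have s0 : - scale R j != 0 by rewrite oppr_eq0 scale_neq0.
  exact: (strong_L2 (strong_Bop s0) (strong_L2 (strong_Mconj d c N0) Lf)).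
have -> : Aadj N d c = fun f => Mop (fun=> rc N%:R^-1) (fun x => \sum_(j < N) F j f x).
  apply/funext => f; apply/funext => x; rewrite /Aadj /Qop /Mop.
  by congr (_ * _); apply: eq_bigr => j _; rewrite mulN1r.
apply: cpt_left.
- exact: (strong_Mop (cmeas_cst _) (fun=> lexx _)).
- by move=> f Lf; exact: (L2_sum _ (fun j : 'I_N => LF j f Lf)).
apply: cpt_sum => // j _.
have hc e : 0 < e -> exists M, forall x, M <= `|x| -> cabs (h x)^* <= e.
  by move=> /hfun_vanish[M hM]; exists M => x /hM; rewrite cabs_conj.
apply: (cpt_Bop_Mop (cmeas_conj (cmeas_hfun N d c)) _ (scale_ge1 R j) hc) => x.
by rewrite cabs_conj; exact: hfun_le1.
Qed.

Lemma Aop_pointwise f x : L2 f -> cabs (Aop N d c f x) <= cabs (h x) * l2norm f.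
Proof.
by move=> Lf; rewrite /Aop cabsM ler_wpM2l ?cabs_ge0 // Qop_pointwise // normr1.
Qed.

(** The average at [x] sees the multiplier at distance up to |s|, where it exceeds its value at [x]
    by at most [L * |s|] in modulus. This gives adjoint blocks the pointwise control that
    [Aop_pointwise] gives directly for blocks. *)
Lemma Bop_Mop_pointwise (u : R -> R[i]) (K L s : R) f x : cmeas u ->
  (forall y, cabs (u y) <= K) -> 0 <= L -> (forall y z, cabs (u y - u z) <= L * `|y - z|) ->
  1 <= `|s| -> L2 f ->
  cabs (Bop s (fun y => u y * f y) x) <= (cabs (u x) + L * `|s|) * l2norm f.
Proof.
move=> mu_ uK L0 uL s1 Lf; have s0 : s != 0 by rewrite -normr_gt0 (lt_le_trans ltr01).
have Lg := (L2M mu_ uK Lf).1; have B0 : 0 <= cabs (u x) + L * `|s|.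
  by rewrite addr_ge0 ?cabs_ge0 // mulr_ge0.
apply: le_trans (ler_wpM2l B0 (_ : cabs (Bop s (absf f) x) <= _)); last first.
  by rewrite -l2norm_absf; apply: Bop_pointwise => //; exact: L2_absf.
pose G t := box t * absf f (x - s * t).
have iG : cinteg G by apply: cinteg_box; exact: (L2_affine x s0 (L2_absf Lf)).
have iB : rinteg (fun t => (cabs (u x) + L * `|s|) * complex.Re (G t)) := rintegZ _ iG.1.
apply: le_trans (_ : _ <= (cabs (u x) + L * `|s|) * complex.Re (cint G)) _; last first.
  by rewrite ler_wpM2l // (le_trans (ler_norm _)) // Re_le_cabs.
rewrite /= -RintegralZl //; last exact: iG.1.
apply: cabs_cint_le iB _.
  by apply: cmeasM; [exact: cmeas_box|exact: (cmeas_affine x s (L2_cmeas Lg))].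
move=> t; rewrite /G !cE /= mul0r subr0 !cabsM cabs_box.
have [/[dup] ht /andP[t0 t1]|ht] := boolP (0 <= t <= 1); last by rewrite ibox_out // !mul0r mulr0.
rewrite ibox_in // !mul1r ler_wpM2r ?cabs_ge0 //.
have -> : u (x - s * t) = u x + (u (x - s * t) - u x) by rewrite [RHS]addrC subrK.
apply: le_trans (cabsD _ _) _; rewrite lerD2l; apply: le_trans (uL _ _) _.
by rewrite addrAC subrr add0r normrN normrM ler_wpM2l // (ger0_norm t0) ler_piMr.
Qed.

Lemma Aadj_pointwise f x : L2 f ->
  cabs (Aadj N d c f x) <= (cabs (h x) + d * scale R N * scale R N) * l2norm f.
Proof.
move=> Lf; apply: (@cabs_mean _ N N0 (fun j => Bop (-1 * scale R j) _ x)) => j jN.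
have L0 : 0 <= d * scale R N by rewrite mulr_ge0 // ltW // scale_gt0.
have s1 : `|-1 * scale R j| = scale R j by rewrite normrM normrN1 mul1r gtr0_norm ?scale_gt0.
apply: le_trans (Bop_Mop_pointwise (u := fun x => (h x)^*) (K := 1) (L := d * scale R N) _ _ _ _ _ _ _) _ => //.
- exact/cmeas_conj/cmeas_hfun.
- by move=> y; rewrite cabs_conj hfun_le1.
- by move=> y z; rewrite -rmorphB /= cabs_conj; exact: hfun_lip.
- by rewrite s1 scale_ge1.
by rewrite s1 cabs_conj ler_wpM2r ?l2norm_ge0 // lerD2l ler_wpM2l // scale_le // ltnW.
Qed.

(** A block is close to its adjoint, in which the multiplier acts first, so its size on [f] is
    governed by the part of [f] near the centre. This is what allows the norms of many blocks on one
    [f] to be summed in squares. *)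
Lemma Aop_norm_Mop f : L2 f -> l2norm (Aop N d c f) <= l2norm (fun x => h x * f x) +
  (Num.sqrt (20 / N%:R) + d * scale R N * scale R N + 64 / N%:R) * l2norm f.
Proof.
move=> Lf; have LA := strong_L2 (strong_Aop d c N0) Lf.
have LA' := strong_L2 (strong_Aadj d c N0) Lf.
have -> : Aop N d c f = fun x => Aadj N d c f x + (Aop N d c f x - Aadj N d c f x).
  by apply/funext => x; rewrite [RHS]addrC subrK.
apply: le_trans (l2normD LA' (L2B LA LA')) _; apply: lerD; last exact: Aop_near.
have n1 : -1 != 0 :> R by rewrite oppr_eq0 oner_neq0.
have := strong_norm (strong_Qop N0 n1) (strong_L2 (strong_Mconj d c N0) Lf).
rewrite mul1r => /le_trans; apply; rewrite /Mop.
have mh := cmeas_hfun N d c; have Lh := (L2M mh (hfun_le1 d c N0) Lf).1.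
apply: l2norm_le => //; first by apply: cmeasM; [exact: cmeas_conj|exact: L2_cmeas].
by move=> x; rewrite [leLHS]cabsM [leRHS]cabsM cabs_conj.
Qed.

End BlockProperties.

(** * The almost self-adjoint operator *)

Section Placement.
Variable R : realType.
Local Notation mu := (@lebesgue_measure R).
Implicit Types (f g : cfun R).

(** The error budget of block [n]. The offset 4 makes every term at most 1/16 and the total at most
    1/8, as the numerical estimates below require. *)
Definition qq (n : nat) : R := 2^-1 ^+ (n + 4).

Lemma qq_gt0 n : 0 < qq n.
Proof. by rewrite exprn_gt0 // invr_gt0. Qed.

Lemma qqS n : qq n = 2 * qq n.+1.
Proof. by rewrite /qq addSn exprS mulrA divff ?mul1r // pnatr_eq0. Qed.

Lemma qq_anti m n : (m <= n)%N -> qq n <= qq m.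
Proof.
move=> mn; apply: ler_wiXn2l; rewrite ?leq_add2r ?invr_ge0 //.
by rewrite invf_le1 // ler1n.
Qed.

Lemma qq_le n : qq n <= 1 / 16.
Proof.
apply: le_trans (qq_anti (leq0n n)) _; rewrite /qq add0n exprVn.
by rewrite div1r lef_pV2 ?posrE ?exprn_gt0 //; rewrite -natrX ler_nat.
Qed.

Lemma sum_qq k : \sum_(n < k) qq n = 1 / 8 - 2 * qq k.
Proof.
elim: k => [|k ih]; last by rewrite big_ord_recr /= ih (qqS k); ring.
by rewrite big_ord0 /qq add0n; field.
Qed.

Lemma sum_qq_le k : \sum_(n < k) qq n <= 1 / 8.
Proof. by rewrite sum_qq; have := qq_gt0 k; lra. Qed.

Lemma qq_small e : 0 < e -> exists n, forall k, (n <= k)%N -> qq k < e.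
Proof.
move=> e0; pose n := (Num.truncn e^-1).+1; exists n => k nk.
apply: le_lt_trans (qq_anti nk) _; rewrite /qq exprVn -[ltRHS]invrK ltf_pV2 ?posrE ?invr_gt0 ?exprn_gt0 //.
apply: lt_le_trans (truncnS_gt _) _; rewrite -natrX ler_nat.
apply: leq_trans (ltn_expl (n + 4) (ltnSn 1)); rewrite ltnS /n.
by rewrite (leq_trans _ (leq_addr _ _)).
Qed.

Lemma block_sequence : exists (N : nat -> nat) (d : nat -> R), forall n,
  [/\ (0 < N n)%N, 0 < d n, d n * scale R (N n) * scale R (N n) <= qq n &
  Num.sqrt (20 / (N n)%:R) + d n * scale R (N n) * scale R (N n) + 64 / (N n)%:R <= qq n].
Proof.
have [N hN] := choice (fun n => block_parameters (qq_gt0 n)).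
have [d hd] := choice hN.
by exists N, d.
Qed.

Variables (N : nat -> nat) (d : nat -> R).
Hypotheses (N0 : forall n, (0 < N n)%N) (d0 : forall n, 0 < d n).
Hypothesis ds : forall n, d n * scale R (N n) * scale R (N n) <= qq n.
Hypothesis err : forall n,
  Num.sqrt (20 / (N n)%:R) + d n * scale R (N n) * scale R (N n) + 64 / (N n)%:R <= qq n.

(** The two lengths attached to block [j]: [8 / d j] is the decay constant of its multiplier,
    [scale R (N j)] bounds the length of its translations. *)
Let w j : R := 8 / d j + scale R (N j).

Let w1 j : 1 <= w j.
Proof. by have := scale_ge1 R (N j); have : 0 < 8 / d j by [exact: divr_gt0]; rewrite /w; lra. Qed.

(* At distance at least [reach n] from its site every block [l <= n] is at most [qq n ^+ 2]. *)
Definition reach (n : nat) : R := (\sum_(j < n.+1) w j) / qq n ^+ 2.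

(** The factor 3 separates site [n] from earlier ones by three times [reach n]: a point within two
    reaches of a site keeps one reach of distance from each earlier one, and a full reach of the
    later block from each later one. *)
Definition site (n : nat) : R := 3 * \sum_(j < n.+1) reach j.

Definition blk (n : nat) : R -> R[i] := hfun (N n) (d n) (site n).

Let sumw m n : (m <= n)%N -> \sum_(j < m.+1) w j <= \sum_(j < n.+1) w j.
Proof.
elim: n => [|n ih]; first by rewrite leqn0 => /eqP ->.
rewrite leq_eqVlt => /predU1P[->//|/ih h]; rewrite [leRHS]big_ord_recr /=.
by have := w1 n.+1; lra.
Qed.

Let w_sum l n : (l <= n)%N -> w l <= \sum_(j < n.+1) w j.
Proof.
move=> ln; apply: le_trans (sumw ln); rewrite big_ord_recr /= lerDr sumr_ge0 // => j _.
by have := w1 j; lra.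
Qed.

Lemma reach_gt l n : (l <= n)%N -> w l / qq n ^+ 2 <= reach n.
Proof. by move=> ln; rewrite ler_pM2r ?w_sum // invr_gt0 exprn_gt0 ?qq_gt0. Qed.

Let qq2 n : 0 < qq n ^+ 2.
Proof. by rewrite exprn_gt0 ?qq_gt0. Qed.

Lemma reach_gt0 n : 0 < reach n.
Proof.
by apply: lt_le_trans (reach_gt (leqnn n)); rewrite divr_gt0 // (lt_le_trans ltr01).
Qed.

Let le_div_qq (x : R) n : 0 <= x -> x <= x / qq n ^+ 2.
Proof.
move=> x0; rewrite ler_pdivlMr // ler_piMr // exprn_ile1 ?(ltW (qq_gt0 _)) //.
by have := qq_le n; lra.
Qed.

Lemma reach_scale n : scale R (N n) <= reach n.
Proof.
apply: le_trans (reach_gt (leqnn n)); apply: le_trans (le_div_qq n _); rewrite /w.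
  by rewrite lerDr divr_ge0 // ltW.
by have := w1 n; rewrite /w; lra.
Qed.

Lemma reach_mono l n : (l <= n)%N -> reach l <= reach n.
Proof.
move=> ln; apply: ler_pM; rewrite ?sumw //.
- by apply: le_trans (w_sum (leqnn l)); have := w1 l; lra.
- by rewrite invr_ge0 ltW.
by rewrite lef_pV2 ?posrE // ler_pXn2r ?nnegrE ?qq_anti // ltW ?qq_gt0.
Qed.

(** Each width is at least 1. This pushes the sites, and with them the test vectors, off to
    infinity. *)
Lemma reach_ge n : n%:R <= reach n.
Proof.
apply: le_trans (le_div_qq n (_ : 0 <= \sum_(j < n.+1) w j)); last first.
  by apply: le_trans (w_sum (leqnn n)); have := w1 n; lra.
apply: (@le_trans _ _ (\sum_(j < n.+1) 1)); last by apply: ler_sum => j _.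
by rewrite sumr_const card_ord ler_nat.
Qed.

Lemma site_gap l n : (l < n)%N -> site l + 3 * reach n <= site n.
Proof.
elim: n => // n ih; rewrite ltnS leq_eqVlt => /predU1P[->|/ih h].
  by rewrite /site [\sum_(j < n.+2) _]big_ord_recr /= mulrDr.
have r0 := reach_gt0 n; rewrite [leRHS]/site big_ord_recr /= mulrDr -/(site n); lra.
Qed.

Lemma site_ge n : 3 * reach n <= site n.
Proof.
rewrite /site ler_pM2l // big_ord_recr /= lerDr sumr_ge0 // => j _; exact/ltW/reach_gt0.
Qed.

Lemma blk_far l n x : (l <= n)%N -> reach n <= `|x - site l| -> cabs (blk l x) <= qq n ^+ 2.
Proof.
move=> ln hx; have x0 : 0 < `|x - site l| by exact: lt_le_trans (reach_gt0 n) hx.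
apply: le_trans (hfun_decay (N0 l) (d0 l) _) _; first by rewrite -subr_eq0 -normr_gt0.
rewrite ler_pdivrMr ?mulr_gt0 // mulrA mulrAC -ler_pdivrMr // [leRHS]mulrC.
apply: le_trans (_ : w l / qq n ^+ 2 * qq n ^+ 2 <= _); last first.
  by rewrite ler_pM2r // (le_trans (reach_gt ln)).
by rewrite divfK ?gt_eqF // /w lerDl ltW // scale_gt0.
Qed.

(** Three reaches separate the sites and at most two are given up. The decay is measured with the
    larger of the two indices, and its squared budget is at most the product of both budgets. *)
Lemma blk_cross l n x : l != n -> `|x - site n| <= 2 * reach n ->
  cabs (blk l x) <= qq l * qq n.
Proof.
move=> ln hx; have q0 m := qq_gt0 m.
have tri m : `|site m - site n| <= `|x - site m| + `|x - site n|.
  by rewrite (distrC x (site m)) -(subrKA x) ler_normD.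
have [lt_ln|nl] := ltnP l n.
  apply: (@le_trans _ _ (qq n ^+ 2)); last by rewrite expr2 ler_pM2r // qq_anti // ltnW.
  apply: blk_far; first exact: ltnW.
  have := site_gap lt_ln; have := tri l; have r0 := reach_gt0 n.
  by have := ler_norm (site n - site l); rewrite distrC; lra.
have lt_nl : (n < l)%N by rewrite ltn_neqAle eq_sym ln.
apply: (@le_trans _ _ (qq l ^+ 2)); last by rewrite expr2 ler_pM2l // qq_anti // ltnW.
apply: blk_far => //; have := site_gap lt_nl; have := tri l; have := reach_mono nl.
by have := ler_norm (site l - site n); lra.
Qed.

(** At every point one factor is small: block [n] away from its own site, block [l] near that
    site. *)
Lemma blk_prod l n x : (l < n)%N -> cabs (blk l x) * cabs (blk n x) <= qq l * qq n.
Proof.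
move=> ln; have b1 m : cabs (blk m x) <= 1 by exact: hfun_le1.
have b0 m : 0 <= cabs (blk m x) by exact: cabs_ge0.
have [h|h] := leP (reach n) `|x - site n|.
  apply: (@le_trans _ _ (1 * qq n ^+ 2)); first by apply: ler_pM => //; exact: blk_far.
  by rewrite mul1r expr2 ler_pM2r ?qq_gt0 // qq_anti // ltnW.
rewrite -[leRHS]mulr1; apply: ler_pM => //; apply: blk_cross; first by rewrite ltn_eqF.
by have := reach_gt0 n; lra.
Qed.

Lemma sum_blk k x : \sum_(n < k) cabs (blk n x) <= 2.
Proof.
(* Far from site [k] the new term fits in its budget and the induction hypothesis is kept. Near it
   the new term may be 1, but then all earlier ones are small and together cost at most [qq k]. *)
suff : \sum_(n < k) cabs (blk n x) <= 1 + \sum_(n < k) qq n.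
  by have := sum_qq_le k; lra.
elim: k => [|k ih]; first by rewrite !big_ord0 addr0.
rewrite !big_ord_recr /=; have q0 := qq_gt0 k; have q1 := qq_le k.
have [h|h] := leP (reach k) `|x - site k|.
  have := blk_far (leqnn k) h; have : qq k ^+ 2 <= qq k.
    by rewrite expr2 ler_piMr ?(ltW q0) //; lra.
  lra.
have h1 : cabs (blk k x) <= 1 by exact: hfun_le1.
have h2 : \sum_(n < k) cabs (blk n x) <= \sum_(n < k) qq n * qq k.
  apply: ler_sum => l _; apply: blk_cross; first by rewrite ltn_eqF.
  by have := reach_gt0 k; lra.
move: h2; rewrite -mulr_suml => h2; have := sum_qq_le k; have : 0 <= \sum_(n < k) qq n.
  by apply: sumr_ge0 => n _; exact/ltW/qq_gt0.
move: h2; set s := \sum_(n < k) qq n => h2 s0 s1.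
have : s * qq k <= qq k by rewrite ler_piMl ?(ltW q0) //; lra.
lra.
Qed.

End Placement.

Section ComplexLimits.
Variable R : realType.
Implicit Types (z s : nat -> R[i]) (w t a : R[i]).

Definition clim z w := (fun n => cabs (z n - w)) @ \oo --> (0 : R).

Lemma climP z w : clim z w <->
  forall e, 0 < e -> exists N, forall n, (N <= n)%N -> cabs (z n - w) < e.
Proof.
split => [/cvg0P h e /h[N hN]|h]; first by exists N => n /hN; rewrite ger0_norm ?cabs_ge0.
by apply/cvg0P => e /h[N hN]; exists N => n /hN; rewrite ger0_norm ?cabs_ge0.
Qed.

Lemma clim_axpy a z w s t : clim z w -> clim s t ->
  clim (fun n => a * z n + s n) (a * w + t).
Proof.
move=> /climP hz /climP hs; apply/climP => e e0.
have a1 : 0 < cabs a + 1 by rewrite ltr_wpDl ?cabs_ge0.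
have e2 : 0 < e / 2 by lra.
have [N hN] := hz _ (divr_gt0 e2 a1); have [M hM] := hs _ e2.
exists (maxn N M) => n; rewrite geq_max => /andP[/hN h1 /hM h2].
have -> : a * z n + s n - (a * w + t) = a * (z n - w) + (s n - t) by ring.
apply: le_lt_trans (cabsD _ _) _; rewrite cabsM.
have := cabs_ge0 (z n - w); have := cabs_ge0 a.
move: h1; rewrite ltr_pdivlMr //; move: (cabs a) (cabs (z n - w)) h2 => p q h2 h1 p0 q0.
have : p * q <= q * (p + 1) by rewrite mulrDr mulr1 mulrC lerDl.
lra.
Qed.

Lemma clim_cst w : clim (fun=> w) w.
Proof. by apply/climP => e e0; exists 0%N => n _; rewrite subrr cabs0. Qed.

Lemma clim_lin (I : Type) (r : seq I) (l : I -> R[i]) (z : I -> nat -> R[i]) (w : I -> R[i]) :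
  (forall i, clim (z i) (w i)) ->
  clim (fun n => \sum_(i <- r) l i * z i n) (\sum_(i <- r) l i * w i).
Proof.
move=> h; elim: r => [|i r ih].
  by rewrite big_nil; under eq_fun do rewrite big_nil; exact: clim_cst.
by rewrite big_cons; under eq_fun do rewrite big_cons; exact: clim_axpy.
Qed.

Lemma clim_conj z w : clim z w -> clim (fun n => (z n)^*) w^*.
Proof.
by move=> /climP h; apply/climP => e /h[N hN]; exists N => n /hN;
  rewrite -rmorphB /= cabs_conj.
Qed.

Lemma clim_le z w (v : R[i]) (e : R) : clim z w -> (forall n, cabs (z n - v) <= e) ->
  cabs (w - v) <= e.
Proof.
move=> /climP h zv; apply/ler_addgt0Pr => d d0; have [N hN] := h _ d0.
have := hN N (leqnn N); rewrite cabsB => h1; have := zv N => h2.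
have -> : w - v = (w - z N) + (z N - v) by ring.
by apply: le_trans (cabsD _ _) _; lra.
Qed.

End ComplexLimits.

(** * The sum of the blocks, its adjoint and their compact difference *)

Section Witness.
Variable R : realType.
Local Notation mu := (@lebesgue_measure R).
Implicit Types (f g : cfun R).
Variables (N : nat -> nat) (d : nat -> R).
Hypotheses (N0 : forall n, (0 < N n)%N) (d0 : forall n, 0 < d n).
Hypothesis ds : forall n, d n * scale R (N n) * scale R (N n) <= qq R n.
Hypothesis err : forall n,
  Num.sqrt (20 / (N n)%:R) + d n * scale R (N n) * scale R (N n) + 64 / (N n)%:R <= qq R n.

Definition partA n : op R := Aop (N n) (d n) (site N d n).
Definition partY n : op R := fun f x => partA n f x - Aadj (N n) (d n) (site N d n) f x.

Let h := blk N d.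

Let q0 n : 0 <= qq R n := ltW (qq_gt0 R n).

Lemma strong_partA n : strong_op (partA n) 1.
Proof. exact: strong_Aop. Qed.

Lemma strong_partY n : strong_op (partY n) (1 + 1).
Proof. by apply: strong_sub; [exact: strong_partA|exact: strong_Aadj]. Qed.

Let LA n f (Lf : L2 f) : L2 (partA n f) := strong_L2 (strong_partA n) Lf.
Let LY n f (Lf : L2 f) : L2 (partY n f) := strong_L2 (strong_partY n) Lf.

Let A_pt n f x : L2 f -> cabs (partA n f x) <= cabs (h n x) * l2norm f.
Proof. exact: Aop_pointwise. Qed.

Let Y_pt n f x : L2 f -> cabs (partY n f x) <= (2 * cabs (h n x) + qq R n) * l2norm f.
Proof.
move=> Lf; apply: le_trans (cabsD _ _) _; rewrite cabsN.
have h1 := A_pt n x Lf; have h2 := Aadj_pointwise (site N d n) (N0 n) (d0 n) x Lf.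
have h3 := ler_wpM2r (l2norm_ge0 f) (ds n).
rewrite mulrDl in h2; rewrite -/(blk N d n x) in h2; rewrite mulrDl -mulrA.
by move: h1 h2; rewrite /h; lra.
Qed.

Let Y_norm n f : L2 f -> l2norm (partY n f) <= qq R n * l2norm f.
Proof.
move=> Lf; apply: le_trans (Aop_near (site N d n) (N0 n) (d0 n) Lf) _.
by rewrite ler_wpM2r ?l2norm_ge0.
Qed.

Let sum_h k x : \sum_(n < k) cabs (h n x) <= 2.
Proof. exact: sum_blk. Qed.

Let sum_Y k x : \sum_(n < k) (2 * cabs (h n x) + qq R n) <= 5.
Proof.
by rewrite big_split /= -mulr_sumr; have := sum_h k x; have := sum_qq_le R k; lra.
Qed.

Let cross l k f : (l < k)%N -> L2 f ->
  cabs (ip (partA l f) (partA k f)) <= qq R l * qq R k * l2norm f ^+ 2.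
Proof.
move=> lk Lf; pose Q n := Qop (N n) 1 f.
have LQ n : L2 (Q n) := strong_L2 (strong_Qop (N0 n) (oner_neq0 R)) Lf.
have nQ n : l2norm (Q n) <= l2norm f.
  by have := strong_norm (strong_Qop (N0 n) (oner_neq0 R)) Lf; rewrite mul1r.
have qq0 : 0 <= qq R l * qq R k by rewrite mulr_ge0.
have iQ := L2_mul (LQ l) (LQ k).
apply: (@le_trans _ _ (\int[mu]_x (qq R l * qq R k * (cabs (Q l x) * cabs (Q k x))))).
  apply: cabs_cint_le (rintegZ _ iQ) _; first exact/cinteg_meas/(cinteg_ip (LA l Lf) (LA k Lf)).
  move=> x; rewrite cabsM cabs_conj /partA /Aop [X in X * _]cabsM [X in _ * X]cabsM mulrACA.
  apply: ler_pM => //; [by rewrite mulr_ge0 ?cabs_ge0|by rewrite mulr_ge0 ?cabs_ge0|].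
  exact: (blk_prod N0 d0).
rewrite RintegralZl // ler_wpM2l // (le_trans (cauchy_schwarz_abs _ _)) //.
by rewrite expr2 ler_pM ?l2norm_ge0.
Qed.

Let sum_Mh k f : L2 f -> \sum_(n < k) l2norm (fun x => h n x * f x) ^+ 2 <= 2 * l2norm f ^+ 2.
Proof.
move=> Lf; have mh n : cmeas (h n) by exact: cmeas_hfun.
have h1 n x : cabs (h n x) <= 1 by exact: hfun_le1.
have Lh n : L2 (fun x => h n x * f x) := (L2M (mh n) (h1 n) Lf).1.
pose S m x := \sum_(n < m) csq (h n x * f x).
have S_0 : S 0%N = fun=> 0 by apply/funext => x; rewrite /S big_ord0.
have S_S m : S m.+1 = fun x => S m x + csq (h m x * f x).
  by apply/funext => x; rewrite /S big_ord_recr.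
have iS m : rinteg (S m).
  elim: m => [|m ih]; first by rewrite S_0; exact: integrable0.
  by rewrite S_S; exact: rintegD ih (L2_csq (Lh m)).
have E m : \sum_(n < m) l2norm (fun x => h n x * f x) ^+ 2 = \int[mu]_x S m x.
  elim: m => [|m ih]; first by rewrite S_0 big_ord0 Rintegral_cst // mul0r.
  rewrite big_ord_recr S_S /= ih l2norm_sq.
  by rewrite (RintegralD measurableT (iS m) (L2_csq (Lh m))).
rewrite E l2norm_sq -RintegralZl //; last exact: L2_csq.
apply: Rint_le (iS k) (rintegZ _ (L2_csq Lf)) _ => x; rewrite /S.
under eq_bigr do rewrite csqM; rewrite -mulr_suml ler_wpM2r ?csq_ge0 //.
apply: le_trans (sum_h k x); apply: ler_sum => n _.
by rewrite -cabs_sq expr2 ler_piMr ?cabs_ge0.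
Qed.

(** Expanding the square, cross terms are paid by the budgets and a diagonal term is at most twice
    the squared norm of [h n * f] plus a small error. As the moduli of the multipliers sum to at
    most 2 at each point, the total is at most 4 + 1/8, below 9. *)
Let sumA_norm k f : L2 f -> l2norm (fun x => \sum_(n < k) partA n f x) <= 3 * l2norm f.
Proof.
move=> Lf; have n0 := l2norm_ge0 f; have n2 := sqr_ge0 (l2norm f).
have LS m : L2 (fun x => \sum_(n < m) partA n f x).
  exact: (L2_sum _ (fun n : 'I_m => LA n Lf)).
have main : l2norm (fun x => \sum_(n < k) partA n f x) ^+ 2 <=
    2 * \sum_(n < k) l2norm (fun x => h n x * f x) ^+ 2 + (\sum_(n < k) qq R n) * l2norm f ^+ 2.
  elim: k => [|k ih].
    rewrite !big_ord0 mul0r mulr0 addr0; under eq_fun do rewrite big_ord0.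
    by rewrite l2norm0 expr0n.
  under eq_fun do rewrite big_ord_recr /=; rewrite !big_ord_recr /=.
  rewrite (l2normD_sq (LS k) (LA k Lf)).
  have hA : l2norm (partA k f) ^+ 2 <=
      2 * l2norm (fun x => h k x * f x) ^+ 2 + 2 * (qq R k * l2norm f) ^+ 2.
    have hk := Aop_norm_Mop (site N d k) (N0 k) (d0 k) Lf.
    have := le_trans hk (lerD (lexx _) (ler_wpM2r n0 (err k))).
    rewrite -/(partA k f) -/(blk N d k) -/h.
    have := l2norm_ge0 (partA k f).
    move: (l2norm (partA k f)) (l2norm (fun x => h k x * f x)) (qq R k * l2norm f) => a b e' a0 ab.
    have : a ^+ 2 <= (b + e') ^+ 2 by rewrite ler_pXn2r ?nnegrE ?(le_trans a0 ab).
    by have := sqr_ge0 (b - e'); nra.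
  have hc : complex.Re (ip (fun x => \sum_(n < k) partA n f x) (partA k f)) <=
      1 / 8 * qq R k * l2norm f ^+ 2.
    apply: le_trans (ler_norm _) (le_trans (Re_le_cabs _) _).
    rewrite (ip_suml _ (fun n : 'I_k => LA n Lf) (LA k Lf)).
    apply: le_trans (cabs_sum _ _ _) _.
    apply: (@le_trans _ _ (\sum_(n < k) qq R n * (qq R k * l2norm f ^+ 2))).
      by apply: ler_sum => n _; rewrite mulrA; exact: cross.
    by rewrite -mulr_suml -mulrA ler_wpM2r ?sum_qq_le // mulr_ge0.
  have hq : 2 * (qq R k * l2norm f) ^+ 2 <= 1 / 8 * qq R k * l2norm f ^+ 2.
    rewrite exprMn mulrA ler_wpM2r // expr2 mulrA ler_wpM2r //.
    by have := qq_le R k; lra.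
  have hq' : 0 <= qq R k * l2norm f ^+ 2 by rewrite mulr_ge0.
  set X := qq R k * l2norm f ^+ 2 in hq'.
  have eX : 1 / 8 * qq R k * l2norm f ^+ 2 = 1 / 8 * X by rewrite -mulrA.
  rewrite eX in hc hq; rewrite mulrDr [(_ + qq R k) * _]mulrDl -/X.
  have E (s r y p b z S' V' : R) : s <= S' + V' -> r <= 1 / 8 * X -> y <= p + 2 * z ->
      2 * z <= 1 / 8 * X -> s + 2 * r + y <= S' + p + (V' + X) by move=> *; lra.
  exact: E ih hc hA hq.
rewrite -(@ler_pXn2r _ 2) ?nnegrE ?l2norm_ge0 ?mulr_ge0 //; apply: le_trans main _.
have h1 := sum_Mh k Lf; have h2 := ler_wpM2r n2 (sum_qq_le R k).
by rewrite exprMn; lra.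
Qed.

Let sumY_norm k f : L2 f -> l2norm (fun x => \sum_(n < k) partY n f x) <= 1 * l2norm f.
Proof.
move=> Lf; apply: le_trans (l2norm_sum _ (fun n : 'I_k => LY n Lf)) _.
apply: (@le_trans _ _ (\sum_(n < k) qq R n * l2norm f)).
  by apply: ler_sum => n _; exact: Y_norm.
by rewrite -mulr_suml ler_wpM2r ?l2norm_ge0 //; have := sum_qq_le R k; lra.
Qed.

Definition opT : op R := opser partA.
Definition opK : op R := opser partY.
(** The adjoint of [opT], formed as a difference instead of a series of adjoints, so that T = S + K,
    which exhibits T in the adjoint algebra modulo compacts, holds by construction. *)
Definition opS : op R := fun f x => opT f x - opK f x.

Lemma strong_opT : strong_op opT 3.
Proof. exact: (strong_opser strong_partA A_pt sum_h sumA_norm). Qed.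

Lemma strong_opK : strong_op opK 1.
Proof. exact: (strong_opser strong_partY Y_pt sum_Y sumY_norm). Qed.

Lemma strong_opS : strong_op opS (3 + 1).
Proof. exact: (strong_sub strong_opT strong_opK). Qed.

Lemma opT_weak f g : L2 f -> L2 g ->
  clim (fun k => \sum_(n < k) ip (partA n f) g) (ip (opT f) g).
Proof. by move=> Lf Lg; exact: (opser_weak strong_partA A_pt sum_h sumA_norm). Qed.

Lemma opK_weak f g : L2 f -> L2 g ->
  clim (fun k => \sum_(n < k) ip (partY n f) g) (ip (opK f) g).
Proof. by move=> Lf Lg; exact: (opser_weak strong_partY Y_pt sum_Y sumY_norm). Qed.

(** Block by block, subtracting [partY] from [partA] leaves the adjoint block; both sides are then
    limits of the same pairings of finite sums. *)
Lemma opT_adjoint f g : L2 f -> L2 g -> ip (opT f) g = ip f (opS g).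
Proof.
move=> Lf Lg; have LT := strong_L2 strong_opT Lg; have LK := strong_L2 strong_opK Lg.
have hT := opT_weak Lg Lf; have hK := opK_weak Lg Lf.
apply: (cabs_lim_unique (opT_weak Lf Lg)).
rewrite (ipC (strong_L2 strong_opS Lg) Lf) /opS ipBl //.
have E k : \sum_(n < k) ip (partA n f) g =
    (-1 * \sum_(n < k) ip (partY n g) f + \sum_(n < k) ip (partA n g) f)^*.
  rewrite mulN1r [- _ + _]addrC -sumrB rmorph_sum /=; apply: eq_bigr => n _.
  have LB : L2 (Aadj (N n) (d n) (site N d n) g) := strong_L2 (strong_Aadj _ _ (N0 n)) Lg.
  rewrite /partY (ipBl (LA n Lg) LB Lf) opprB [_ + (_ - _)]addrC subrK -(ipC LB Lf).
  exact: (ip_Aop _ _ (N0 n)).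
under eq_fun do rewrite E.
have := clim_conj (clim_axpy (-1) hK hT).
by rewrite mulN1r [- ip _ _ + _]addrC.
Qed.

Lemma Ap_opT : Ap opT.
Proof.
apply: Ap_annihilator; first exact: strong_bounded strong_opT.
move=> n fs gs l Lfg kill.
have hT (i : 'I_n) := opT_weak (Lfg i).1 (Lfg i).2.
apply: (cabs_lim_unique (clim_lin (index_enum 'I_n) l hT)).
suff E k : \sum_(i < n) l i * (\sum_(m < k) ip (partA m (fs i)) (gs i)) = 0.
  by under eq_fun do rewrite E; exact: clim_cst.
under eq_bigr do rewrite mulr_sumr; rewrite exchange_big big1 // => m _.
exact: (kill_Aop Lfg kill (site N d m) (N0 m) (d0 m)).
Qed.

Let cpt_partY n : cpt (partY n).
Proof.
have E : partY n = fun f x => partA n f x +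
    Mop (fun=> -1) (Aadj (N n) (d n) (site N d n) f) x.
  by apply/funext => f; apply/funext => x; rewrite /Mop mulN1r.
have LB f : L2 f -> L2 (Aadj (N n) (d n) (site N d n) f).
  by move=> Lf; exact: (strong_L2 (strong_Aadj _ _ (N0 n))).
have sM : strong_op (Mop (fun=> -1 : R[i])) 1.
  by apply: strong_Mop => [|x]; [exact: cmeas_cst|rewrite cabsN cabs1].
rewrite E; apply: cpt_add; first exact: LA.
- by move=> f Lf; exact: (strong_L2 sM (LB f Lf)).
- exact: cpt_Aop.
- by apply: cpt_left sM LB _; exact: cpt_Aadj.
Qed.

(** Finite sums are compact and the tail from [k] on has norm at most [2 * qq R k], the sum of the
    remaining budgets. As the series converges only pointwise, the tail bound is obtained from its
    finite pieces by Fatou. *)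
Lemma cpt_opK : cpt opK.
Proof.
apply: cpt_approx; first by move=> f Lf; exact: (strong_L2 strong_opK Lf).
move=> e e0; have e2 : 0 < e / 2 by lra.
have [k hk] := qq_small e2; have qk := hk k (leqnn k).
have LS m f : L2 f -> L2 (fun x => \sum_(n < m) partY n f x).
  by move=> Lf; exact: (L2_sum _ (fun n : 'I_m => LY n Lf)).
exists (fun f x => \sum_(n < k) partY n f x); split; [exact: LS| |].
  by apply: cpt_sum => // n f Lf; exact: LY.
move=> f Lf f1; apply: (@le_lt_trans _ _ (2 * qq R k)); last by lra.
pose F m x := \sum_(n < m) partY (k + n) f x.
have FE m x : F m x = \sum_(n < k + m) partY n f x - \sum_(n < k) partY n f x.
  by rewrite big_split_ord /= addrAC subrr add0r.
have LF m : L2 (F m) by exact: (L2_sum _ (fun n : 'I_m => LY (k + n) Lf)).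
have LKS := L2B (strong_L2 strong_opK Lf) (LS k f Lf).
apply: (fatou_l2 LF (L2_cmeas LKS) _ _).2.
  move=> m; apply: le_trans (l2norm_sum _ (fun n : 'I_m => LY (k + n) Lf)) _.
  apply: (@le_trans _ _ (\sum_(n < m) qq R (k + n))).
    apply: ler_sum => n _; apply: le_trans (Y_norm _ Lf) _.
    by rewrite ler_piMr.
  have := sum_qq R (k + m); rewrite big_split_ord /= sum_qq.
  by have := q0 (k + m); lra.
move=> x; apply/climP => e' e'0.
have /climP /(_ _ e'0)[M hM] := opser_cvg Y_pt sum_Y x Lf.
exists M => m Mm; have := hM (k + m)%N (leq_trans Mm (leq_addl _ _)).
by rewrite FE opprB addrA subrK.
Qed.

End Witness.

(** * Test vectors escaping to infinity *)

Section TestVectors.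
Variable R : realType.
Local Notation mu := (@lebesgue_measure R).
Implicit Types (f g : cfun R).

Lemma clim_le_near (z : nat -> R[i]) w (v : R[i]) (e : R) M : clim z w ->
  (forall n, (M <= n)%N -> cabs (z n - v) <= e) -> cabs (w - v) <= e.
Proof.
move=> zw zv; apply: (@clim_le _ (fun n => z (n + M)%N)); last by move=> n; apply/zv/leq_addl.
move/climP: zw => h; apply/climP => d /h[K hK]; exists K => n Kn.
by apply: hK; rewrite (leq_trans Kn) ?leq_addr.
Qed.

Lemma box_mul_conj (t : R) : box t * (box t)^* = box t.
Proof.
by rewrite conj_box; apply: complex_eq; rewrite /box !cE /= ?mulr0 ?mul0r ?addr0 // subr0 -expr2
  ibox_sq.
Qed.

Lemma ip_wbox (z c : R) : 0 < c -> ip (wbox z c) (wbox z c) = Complex c 0.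
Proof. by move=> /(cint_wbox z)[_ <-]; apply: cint_ext => x; rewrite box_mul_conj. Qed.

Lemma l2norm_wbox_sq (z c : R) : 0 < c -> l2norm (wbox z c) ^+ 2 = c.
Proof. by move=> c0; have := ip_wbox z c0; rewrite ipff => -[]. Qed.

Lemma wbox_in (z c x : R) : 0 < c -> z - c <= x <= z -> wbox z c x = 1.
Proof.
move=> c0 /andP[h1 h2]; rewrite /wbox /box ibox_in //; apply/andP; split.
  by rewrite divr_ge0 ?(ltW c0) // subr_ge0.
by rewrite ler_pdivrMr // mul1r; lra.
Qed.

Lemma wbox_out (z c x : R) : 0 < c -> ~~ (z - c <= x <= z) -> wbox z c x = 0.
Proof.
move=> c0 h; rewrite /wbox /box ibox_out //; apply: contra h => /andP[h1 h2].
move: h2; rewrite ler_pdivrMr // mul1r => h2.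
have : 0 <= (z - x) / c * c by rewrite mulr_ge0 // ltW.
by rewrite divfK ?gt_eqF // => h3; apply/andP; split; lra.
Qed.

Lemma escape_weak (v : nat -> cfun R) g : (forall n, L2 (v n)) ->
  (forall n, l2norm (v n) <= 1) -> (forall n x, x < n%:R -> v n x = 0) -> L2 g ->
  clim (fun n => ip g (v n)) 0.
Proof.
move=> Lv v1 v0 Lg; have mz : cmeas (fun _ : R => 0 : R[i]) by exact: cmeas_cst.
have pt x : (fun n => cabs (v n x - 0)) @ \oo --> 0.
  apply/cvg0P => e e0; exists (Num.truncn x).+1 => n hn; rewrite v0 ?subr0 ?cabs0 ?normr0 //.
  by apply: lt_le_trans (truncnS_gt x) _; rewrite ler_nat.
have := weak_limit Lv mz v1 pt Lg; have -> : ip (fun=> 0) g = 0.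
  by rewrite -[RHS]cint0; apply: cint_ext => x; rewrite mul0r.
move/clim_conj; rewrite rmorph0; congr clim; apply/funext => n.
by rewrite -ipC.
Qed.

(** Every [K (u n)] is close to one of finitely many vectors, and each of these has pairings tending
    to 0 with [v n], which is weakly null because its support escapes. *)
Lemma compact_escape (K : op R) (u v : nat -> cfun R) : compact_op K ->
  (forall n, L2 (u n) /\ l2norm (u n) <= 1) -> (forall n, L2 (v n) /\ l2norm (v n) <= 1) ->
  (forall n x, x < n%:R -> v n x = 0) ->
  forall e, 0 < e -> exists M, forall n, (M <= n)%N -> cabs (ip (K (u n)) (v n)) < e.
Proof.
move=> [[LK _] cK] hu hv v0 e e0; have e2 : 0 < e / 2 by lra.
have [m [hs [Lh net]]] := cK _ e2.
have hM i : exists M, forall n, (M <= n)%N -> cabs (ip (hs i) (v n) - 0) < e / 2.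
  by have /climP := escape_weak (fun n => (hv n).1) (fun n => (hv n).2) v0 (Lh i); apply.
have [M hM'] := choice hM.
exists (\max_(i < m) M i) => n nM; have [i [im hi]] := net _ (hu n).1 (hu n).2.
have LKu := LK _ (hu n).1; have [Lv v1] := hv n.
have -> : ip (K (u n)) (v n) = ip (fun x => K (u n) x - hs i x) (v n) + ip (hs i) (v n).
  by rewrite ipBl // subrK.
have h1 : cabs (ip (hs i) (v n)) < e / 2.
  rewrite -[ip _ _]subr0; apply: hM'; apply: leq_trans nM.
  exact: (@leq_bigmax _ (fun j : 'I_m => M j) (Ordinal im)).
have h2 := cauchy_schwarz (L2B LKu (Lh i)) Lv.
have h3 : l2norm (fun x => K (u n) x - hs i x) * l2norm (v n) <= l2norm (fun x => K (u n) x - hs i x).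
  by rewrite ler_piMr ?l2norm_ge0.
apply: le_lt_trans (cabsD _ _) _.
move: (cabs _) (cabs _) (l2norm (fun x => K (u n) x - _)) (_ * l2norm (v n)) h1 h2 h3 hi.
by move=> *; lra.
Qed.

End TestVectors.

(** * The sum of the blocks is not scalar modulo compact operators *)

Section NotScalar.
Variable R : realType.
Local Notation mu := (@lebesgue_measure R).
Implicit Types (f g : cfun R).
Variables (N : nat -> nat) (d : nat -> R).
Hypotheses (N0 : forall n, (0 < N n)%N) (d0 : forall n, 0 < d n).
Hypothesis ds : forall n, d n * scale R (N n) * scale R (N n) <= qq R n.
Hypothesis err : forall n,
  Num.sqrt (20 / (N n)%:R) + d n * scale R (N n) * scale R (N n) + 64 / (N n)%:R <= qq R n.

Let A := partA N d.
Let T := opT N d.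
Let x_ := site N d.
Let D := reach N d.
Let sT : strong_op T 3 := strong_opT N0 d0 err.
Let q0 n : 0 <= qq R n := ltW (qq_gt0 R n).

Lemma QAp_opT : QAp T.
Proof.
have sK := strong_opK N0 d0 ds err; have bT := strong_bounded sT.
split; split => //.
  exists T, (fun _ _ => 0); split; first exact: Ap_opT.
  split; first by apply: (cpt_compact (strong_zero R)); exact: cpt_zero.
  by move=> f _; apply: aeW => x; rewrite /op_add addr0.
exists (opS N d), (opK N d); split.
  exists T; split; first exact: Ap_opT.
  split; first exact: strong_bounded (strong_opS N0 d0 ds err).
  by move=> f g Lf Lg; exact: opT_adjoint.
split; first exact: cpt_compact sK (cpt_opK N0 d0 ds err).
by move=> f _; apply: aeW => x; rewrite /op_add /opS subrK.
Qed.

Let A_test l (B : R) u v : 0 <= B -> L2 u -> l2norm u <= 1 -> L2 v -> l2norm v <= 1 ->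
  (forall x, v x != 0 -> cabs (blk N d l x) <= B) -> cabs (ip (A l u) v) <= B.
Proof.
move=> B0 Lu u1 Lv v1 hB.
rewrite /A /partA /Aop ip_Mop; set w := fun x => _.
have LQ := strong_L2 (strong_Qop (N0 l) (oner_neq0 R)) Lu.
have nQ := strong_norm (strong_Qop (N0 l) (oner_neq0 R)) Lu.
have [Lw nw] : L2 w /\ l2norm w <= B * l2norm v.
  apply: (L2_dom _ Lv B0).
    by apply: cmeasM; [exact/cmeas_conj/cmeas_hfun|exact: L2_cmeas].
  move=> x; rewrite /w [leLHS]cabsM cabs_conj; have [->|v0] := eqVneq (v x) 0.
    by rewrite cabs0 !mulr0.
  by rewrite ler_wpM2r ?cabs_ge0 //; exact: hB.
apply: le_trans (cauchy_schwarz LQ Lw) _.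
rewrite -[leRHS]mul1r; apply: ler_pM; rewrite ?l2norm_ge0 //.
  by rewrite mul1r in nQ; exact: le_trans nQ u1.
by apply: le_trans nw _; rewrite ler_piMr.
Qed.

(** Within two reaches of site [n] every other block [l] is at most [qq R l * qq R n], and these sum
    to at most [qq R n]: there the operator acts as its block [n] alone. *)
Let T_test n u v : L2 u -> l2norm u <= 1 -> L2 v -> l2norm v <= 1 ->
  (forall x, v x != 0 -> `|x - x_ n| <= 2 * D n) ->
  cabs (ip (T u) v - ip (A n u) v) <= qq R n.
Proof.
move=> Lu u1 Lv v1 hv.
apply: (clim_le_near (M := n.+1) (opT_weak N0 d0 err Lu Lv)) => k nk.
rewrite (bigD1 (Ordinal nk)) //= addrAC subrr add0r.
apply: le_trans (cabs_sum _ _ _) _.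
apply: (@le_trans _ _ (\sum_(l < k) qq R l * qq R n)).
  rewrite [leRHS](bigD1 (Ordinal nk)) //= ler_wpDl ?mulr_ge0 //; apply: ler_sum => l ln.
  apply: A_test => //; first by rewrite mulr_ge0.
  by move=> x /hv; apply: blk_cross.
rewrite -mulr_suml ler_piMl //; have := sum_qq_le R k; lra.
Qed.

Let D_ge1 n : 1 <= D n.
Proof. exact: le_trans (scale_ge1 R (N n)) (reach_scale N d0 n). Qed.

(** A unit interval one reach to the left of site [n]: close enough for the other blocks to be
    negligible, far enough for block [n] to be negligible too. There the operator looks like 0,
    which forces the scalar to be 0. *)
Let left_box n : cfun R := wbox (x_ n - D n) 1.

Let L_left n : L2 (left_box n) /\ l2norm (left_box n) <= 1.
Proof.
split; first exact: (L2_wbox _ (oner_neq0 R)).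
by rewrite -(@ler_pXn2r _ 2) ?nnegrE ?l2norm_ge0 // l2norm_wbox_sq // expr1n.
Qed.

Let left_supp n x : left_box n x != 0 -> x_ n - D n - 1 <= x <= x_ n - D n.
Proof. by apply: contraR => h; rewrite /left_box wbox_out. Qed.

Let left_escape n x : x < n%:R -> left_box n x = 0.
Proof.
move=> xn; apply/eqP; apply/negPn/negP => /left_supp /andP[h _].
have := site_ge N d0 n; have := reach_ge N d0 n; have := D_ge1 n; rewrite -/(D n) -/(x_ n).
lra.
Qed.

Let c_zero (c : R[i]) K : compact_op K -> opeq T (op_add (op_scale c (@op_id R)) K) -> c = 0.
Proof.
move=> cK TK; apply: cabs0_eq0; apply/eqP; rewrite eq_le cabs_ge0 andbT.
apply/ler_addgt0Pr => e e0; rewrite add0r; have e3 : 0 < e / 3 by lra.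
have [M hM] := compact_escape cK L_left L_left left_escape e3.
have [M' hM'] := qq_small e3.
set n := maxn M M'; have qn := hM' n (leq_maxr _ _); have Kn := hM n (leq_maxl _ _).
have [Lu u1] := L_left n; have [[LK _] _] := cK; have LKu := LK _ Lu.
have E : ip (T (left_box n)) (left_box n) = c * 1 + ip (K (left_box n)) (left_box n).
  rewrite (@ip_ae _ _ _ (fun x => c * left_box n x + K (left_box n) x) (left_box n)
    (strong_L2 sT Lu) Lu _ (L2_cmeas Lu) (TK _ Lu) (aeeq_refl _)); last first.
    exact/L2_cmeas/(L2D (L2Z c Lu) LKu).
  by rewrite (ipDl (L2Z c Lu) LKu Lu) (ipZl c Lu Lu) ip_wbox.
have t1 : cabs (ip (T (left_box n)) (left_box n) - ip (A n (left_box n)) (left_box n)) <= qq R n.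
  apply: T_test => // x /left_supp /andP[h1 h2]; have := D_ge1 n.
  by rewrite ler_norml => h; apply/andP; split; lra.
have t2 : cabs (ip (A n (left_box n)) (left_box n)) <= qq R n ^+ 2.
  apply: A_test => //; first exact: sqr_ge0.
  move=> x /left_supp /andP[h1 h2]; apply: (blk_far N0 d0 (leqnn n)).
  by rewrite distrC -/(x_ n) -/(D n) ger0_norm; have := D_ge1 n; lra.
have q2 : qq R n ^+ 2 <= qq R n by rewrite expr2 ler_piMl //; have := qq_le R n; lra.
have -> : c = (ip (T (left_box n)) (left_box n) - ip (A n (left_box n)) (left_box n))
    + (ip (A n (left_box n)) (left_box n) - ip (K (left_box n)) (left_box n)).
  by rewrite E; ring.
apply: le_trans (cabsD _ _) _; have := cabsD (ip (A n (left_box n)) (left_box n))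
  (- ip (K (left_box n)) (left_box n)); rewrite cabsN.
lra.
Qed.

Let s n : R := scale R (N n).
Let s_gt0 n : 0 < s n := scale_gt0 R (N n).
Let amp n : R := Num.sqrt (2 * s n)^-1.
(** The normalized indicator of radius [s n] about the site. All translations in Q go to the right
    by at most [s n], so Q leaves this function unchanged on the right half of the interval, where
    [half] lives. *)
Let wide n : cfun R := fun x => rc (amp n) * wbox (x_ n + s n) (2 * s n) x.
Let half n : cfun R := fun x => rc (amp n) * wbox (x_ n + s n) (s n) x.

Let ss0 n : 0 < 2 * s n.
Proof. by rewrite mulr_gt0. Qed.

Let amp_ge0 n : 0 <= amp n := sqrtr_ge0 _.

Let amp_sq n : amp n ^+ 2 = (2 * s n)^-1.
Proof. by rewrite sqr_sqrtr // invr_ge0 ltW. Qed.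

Let L_box n (t : R) : 0 < t -> t <= 2 * s n ->
  L2 (fun x => rc (amp n) * wbox (x_ n + s n) t x) /\
  l2norm (fun x => rc (amp n) * wbox (x_ n + s n) t x) <= 1.
Proof.
move=> t0 t2; have Lw : L2 (wbox (x_ n + s n) t) by apply: L2_wbox; rewrite gt_eqF.
split; first exact: L2Z.
rewrite l2normZ // cabs_rc // -(@ler_pXn2r _ 2) ?nnegrE ?mulr_ge0 ?l2norm_ge0 //.
by rewrite exprMn amp_sq l2norm_wbox_sq // expr1n mulrC ler_pdivrMr // mul1r.
Qed.

Let L_wide n : L2 (wide n) /\ l2norm (wide n) <= 1.
Proof. exact: L_box. Qed.

Let L_half n : L2 (half n) /\ l2norm (half n) <= 1.
Proof. by apply: L_box => //; have := s_gt0 n; lra. Qed.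

Let half_supp n x : half n x != 0 -> x_ n <= x <= x_ n + s n.
Proof.
apply: contraR => h; rewrite /half wbox_out ?mulr0 //.
by have -> : x_ n + s n - s n = x_ n by ring.
Qed.

Let half_escape n x : x < n%:R -> half n x = 0.
Proof.
move=> xn; apply/eqP; apply/negPn/negP => /half_supp /andP[h _].
have := site_ge N d0 n; have := reach_ge N d0 n; have := D_ge1 n; rewrite -/(D n) -/(x_ n).
lra.
Qed.

Let Q_wide n x : x_ n <= x <= x_ n + s n -> Qop (N n) 1 (wide n) x = rc (amp n).
Proof.
move=> /andP[h1 h2]; rewrite /Qop; under eq_bigr => j _.
  have -> : Bop (1 * scale R j) (wide n) x = rc (amp n).
    rewrite /Bop -[RHS](@avg_cst R); apply: avg_eq => t /andP[t0 t1].
    have sj : scale R j * t <= s n.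
      apply: (@le_trans _ _ (scale R j * 1)).
        by rewrite ler_wpM2l // ltW // scale_gt0.
      by rewrite mulr1; apply: scale_le; exact: ltnW.
    have sj0 : 0 <= scale R j * t by rewrite mulr_ge0 // ltW // scale_gt0.
    by rewrite /wide mul1r wbox_in ?mulr1 //; apply/andP; split; lra.
  over.
have n0 : (N n)%:R != 0 :> R by rewrite pnatr_eq0 -lt0n.
have -> : \sum_(j < N n) rc (amp n) = rc ((N n)%:R * amp n).
  apply: complex_eq; rewrite ?cRe_sum ?cIm_sum /= sumr_const card_ord ?mul0rn //.
  by rewrite mulr_natl.
by apply: complex_eq; rewrite !cE /= ?mulr0 ?mul0r ?subr0 ?addr0 // mulKf.
Qed.

Let blk_near n x : x_ n <= x <= x_ n + s n -> 1 / 2 <= complex.Re (blk N d n x).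
Proof.
move=> /andP[h1 h2].
have hl := hfun_lip (x_ n) (N0 n) (d0 n) (x_ n) x; rewrite hfun_center // -/(blk N d n x) in hl.
have h3 : cabs (1 - blk N d n x) <= 1 / 16.
  apply: le_trans hl (le_trans _ (qq_le R n)); apply: le_trans (ds n).
  rewrite ler_wpM2l // ?mulr_ge0 ?(ltW (d0 n)) ?(ltW (scale_gt0 _ _)) //.
  by rewrite distrC ger0_norm; rewrite /s in h2; lra.
have := le_trans (ler_norm _) (le_trans (Re_le_cabs (1 - blk N d n x)) h3).
by rewrite !cE /=; lra.
Qed.

(** On the support of [half] the factor Q returns the constant [amp n] and the multiplier has real
    part at least 1/2, so the pairing is at least amp^2 s / 2 with amp^2 = 1 / (2s). *)
Let A_big n : 1 / 4 <= complex.Re (ip (A n (wide n)) (half n)).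
Proof.
have [Lw _] := L_wide n; have [Lh _] := L_half n.
have LA := strong_L2 (strong_partA d N0 n) Lw.
pose G x := amp n ^+ 2 / 2 * complex.Re (wbox (x_ n + s n) (s n) x).
have [iw cw] := cint_wbox (x_ n + s n) (s_gt0 n).
have -> : 1 / 4 = \int[mu]_x G x.
  rewrite RintegralZl //; last exact: iw.1.
  have -> : \int[mu]_x complex.Re (wbox (x_ n + s n) (s n) x) = s n by case: cw.
  by rewrite amp_sq; field; rewrite gt_eqF.
apply: Rint_le (rintegZ _ iw.1) (cinteg_ip LA Lh).1 _ => x.
have xs : x_ n + s n - s n = x_ n by rewrite addrK.
rewrite /G; have [hx|hx] := boolP (x_ n <= x <= x_ n + s n); last first.
  have w0 : wbox (x_ n + s n) (s n) x = 0 by apply: wbox_out => //; rewrite xs.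
  have h0 : half n x = 0 by rewrite /half w0 mulr0.
  by rewrite h0 conjC0 mulr0 w0 /= mulr0.
have w1 : wbox (x_ n + s n) (s n) x = 1 by apply: wbox_in => //; rewrite xs.
rewrite /half w1 mulr1 rc_conj /A /partA /Aop Q_wide // -/(blk N d n x).
have -> : complex.Re (blk N d n x * rc (amp n) * rc (amp n)) = amp n ^+ 2 * complex.Re (blk N d n x).
  by rewrite !cE /=; ring.
by rewrite /= mulr1 ler_wpM2l ?sqr_ge0 // -[_^-1]mul1r blk_near.
Qed.

(** Once the scalar is 0, the compact operator alone would have to produce the pairings on the wide
    bumps, which are at least 1/4 - 1/16; but its pairings eventually fall below 1/16. *)
Lemma not_scalar_opT : ~ scalar_plusK T.
Proof.
move=> [_ [c [K [cK TK]]]]; have c0 := c_zero cK TK.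
have e0 : 0 < 1 / 16 :> R by lra.
have [M hM] := compact_escape cK L_wide L_half half_escape e0.
have [Lw w1] := L_wide M; have [Lh h1] := L_half M.
have E : ip (T (wide M)) (half M) = ip (K (wide M)) (half M).
  have [[LK _] _] := cK; apply: (ip_ae (strong_L2 sT Lw) Lh _ (L2_cmeas Lh) _ (aeeq_refl _)).
    exact/L2_cmeas/LK.
  by apply: ae_mono (TK _ Lw) => x ->; rewrite /op_add /op_scale c0 mul0r add0r.
have t1 : cabs (ip (T (wide M)) (half M) - ip (A M (wide M)) (half M)) <= qq R M.
  apply: T_test => // x /half_supp /andP[p1 p2].
  have := reach_scale N d0 M; rewrite -/(s M) -/(D M) => sD; have := s_gt0 M.
  by rewrite ler_norml => sM; apply/andP; split; lra.
have t2 := hM M (leqnn M); rewrite -E in t2.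
have t3 := Re_le_cabs (ip (A M (wide M)) (half M)).
have t4 := cabsD (ip (T (wide M)) (half M)) (- (ip (T (wide M)) (half M) - ip (A M (wide M)) (half M))).
rewrite cabsN opprB addrCA subrr addr0 in t4.
move: (A_big M); have := ler_norm (complex.Re (ip (A M (wide M)) (half M))).
have E4 (a b r r' p q : R) : p <= q -> q <= 1 / 16 -> a < 1 / 16 -> r <= r' -> r' <= b ->
    b <= a + p -> 1 / 4 <= r -> False by clear E c0; move=> *; lra.
move=> rr Ar; exact: (E4 _ _ _ _ _ _ t1 (qq_le R M) t2 rr t3 t4 Ar).
Qed.

End NotScalar.

(** * Resolvents determine a function *)

Section Resolvents.
Variable R : realType.
Local Notation mu := (@lebesgue_measure R).
Implicit Types (f g : cfun R) (a z : R[i]).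

Lemma rinteg_oneDsqr : rinteg (fun x : R => (1 + x ^+ 2)^-1).
Proof.
have p0 (x : R) : 0 <= (1 + x ^+ 2)^-1 by rewrite invr_ge0 addr_ge0 // sqr_ge0.
have mf : measurable_fun setT (fun x : R => (1 + x ^+ 2)^-1).
  by apply: continuous_measurable_fun; exact: (@continuous_oneDsqrV R).
pose g (x : R) := if 0 <= x then (1 + x ^+ 2)^-1 else 0.
have g0 x : 0 <= g x by rewrite /g; case: ifP.
have gE x : g x = (fun x : R => (1 + x ^+ 2)^-1) x * \1_(`[0, +oo[%classic) x.
  rewrite /g indicE; case: ifP => h; first by rewrite mem_set ?mulr1 //= in_itv /= h.
  by rewrite memNset ?mulr0 //= in_itv /= h.
have mg : measurable_fun setT g.
  rewrite (funext gE); apply: measurable_funM => //; exact: measurable_indic.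
have ig : rinteg g.
  apply: rinteg_lty => //; rewrite (_ : (\int[mu]_x (g x)%:E)%E =
      (\int[mu]_(x in `[0%R, +oo[) (oneDsqr x)^-1%:E)%E); last first.
    rewrite [RHS]integral_mkcond; apply: eq_integral => x _; rewrite patchE gE indicE.
    by case: ifP => h; rewrite ?h ?mulr1 ?mulr0.
  by rewrite integral0y_oneDsqr ltry.
have ign : rinteg (fun x => g (- x)).
  apply: rinteg_lty => //; first exact: (measurableT_comp mg (@measurable_funN _ _ R setT id (@measurable_id _ _ _))).
  rewrite -(@ge0_integral_oppr R (fun x => (g x)%:E)) ?rinteg_fin ?ltry //.
  exact/measurable_EFinP.
apply: (rinteg_le mf (rintegD ig ign)) => x; rewrite ger0_norm // /g sqrrN.
by case: (leP 0 x) => h; [rewrite lerDl; case: ifP|rewrite oppr_ge0 (ltW h) add0r].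
Qed.

(** The value is pi, but a positive lower bound is enough, and on [0, 1] the integrand is at least
    1/2. *)
Lemma Rint_oneDsqr_ge : 1 / 2 <= \int[mu]_t (1 + t ^+ 2)^-1 :> R.
Proof.
have -> : 1 / 2 = \int[mu]_t (1 / 2 * ibox t) :> R.
  by rewrite RintegralZl ?Rint_ibox ?mulr1 //; exact: rinteg_ibox.
apply: Rint_le (rintegZ _ (rinteg_ibox R)) rinteg_oneDsqr _ => t.
have [/andP[t0 t1]|ht] := boolP (0 <= t <= 1); last first.
  by rewrite ibox_out // mulr0 invr_ge0 addr_ge0 ?sqr_ge0.
rewrite ibox_in ?t0 // mulr1 div1r lef_pV2 ?posrE ?ltr_wpDr ?sqr_ge0 //.
by have := exprn_ile1 2 t0 t1; lra.
Qed.

(** A square integrable majorant of all resolvents up to constants and shifts; products of two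
    shifts of it are integrable. *)
Definition decay (x : R) : R := (1 + `|x|)^-1.

Lemma decay_gt0 x : 0 < decay x.
Proof. by rewrite invr_gt0 ltr_wpDr. Qed.

Lemma measurable_decay : measurable_fun setT decay.
Proof.
apply: continuous_measurable_fun => x; apply: cvgV; first by rewrite gt_eqF // ltr_wpDr.
by apply: cvgD; [exact: cvg_cst|exact: norm_continuous].
Qed.

Lemma L2_decay : L2 (fun x => rc (decay x)).
Proof.
have m := cmeas_real measurable_decay; case: (m) => m1 m2; split => //; split => //.
rewrite -ge0_fin_numE; last by apply: integral_ge0 => x _; rewrite lee_fin csq_ge0.
apply: (integrable_fin_num measurableT); apply: (rinteg_le _ rinteg_oneDsqr).
  exact: measurable_csq.
move=> x; rewrite ger0_norm ?csq_ge0 // csq_real /decay exprVn.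
rewrite lef_pV2 ?posrE ?exprn_gt0 ?ltr_wpDr ?sqr_ge0 //.
rewrite -[x ^+ 2]real_normK ?num_real //; have := normr_ge0 x; nra.
Qed.

Definition fres a : cfun R := fun x => (rc x - a)^-1.

Lemma fresE (s y x : R) : fres (Complex s y) x =
  Complex ((x - s) / ((x - s) ^+ 2 + y ^+ 2)) (y / ((x - s) ^+ 2 + y ^+ 2)).
Proof.
rewrite /fres; have -> : rc x - Complex s y = Complex (x - s) (- y).
  by apply: complex_eq; rewrite !cE /= ?sub0r.
by apply: complex_eq; rewrite /= ?sqrrN // mulNr opprK.
Qed.

Lemma cmeas_fres a : complex.Im a != 0 -> cmeas (fres a).
Proof.
case: a => s y /= y0.
have d0 (x : R) : (x - s) ^+ 2 + y ^+ 2 != 0.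
  by rewrite gt_eqF // ltr_wpDl ?sqr_ge0 // lt0r sqr_ge0 sqrf_eq0 y0.
have cD : continuous (fun x : R => (x - s) ^+ 2 + y ^+ 2).
  move=> x; apply: cvgD; last exact: cvg_cst.
  by apply: cvgM; apply: cvgB => //; exact: cvg_cst.
have mD : measurable_fun setT (fun x : R => ((x - s) ^+ 2 + y ^+ 2)^-1).
  by apply: continuous_measurable_fun => x; apply: cvgV => //; exact: cD.
have E : fres (Complex s y) = fun x => Complex ((x - s) * ((x - s) ^+ 2 + y ^+ 2)^-1)
    (y * ((x - s) ^+ 2 + y ^+ 2)^-1).
  by apply/funext => x; exact: fresE.
rewrite E; split => /=; last exact: measurable_funM.
by apply: measurable_funM => //; exact: measurable_funB.
Qed.

Lemma cabs_fres a x : complex.Im a != 0 ->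
  cabs (fres a x) <= (1 + `|complex.Im a|^-1) * decay (x - complex.Re a).
Proof.
move=> a0; have i0 : 0 < `|complex.Im a| by rewrite normr_gt0.
have h1 := Re_le_cabs (rc x - a); have h2 := Im_le_cabs (rc x - a).
rewrite !cE /= sub0r normrN in h1 h2.
have c0 : 0 < cabs (rc x - a) by exact: lt_le_trans h2.
rewrite /fres cabsV -[leLHS]div1r /decay ler_pdivrMr // mulrAC ler_pdivlMr ?ltr_wpDr // mul1r.
rewrite mulrDl mul1r addrC lerD //.
by rewrite ler_pdivlMl // mulr1.
Qed.

Lemma L2_fres a : complex.Im a != 0 -> L2 (fres a).
Proof.
move=> a0; have C0 : 0 <= 1 + `|complex.Im a|^-1 by rewrite addr_ge0 // invr_ge0.
apply: (L2_dom (cmeas_fres a0) (L2_shift (complex.Re a) L2_decay) C0 _).1.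
by move=> x; rewrite cabs_rc ?cabs_fres // ltW // decay_gt0.
Qed.

Lemma cinteg_mul f g : L2 f -> L2 g -> cinteg (fun x => f x * g x).
Proof. by move=> Lf /L2_conj Lg; have := cinteg_ip Lf Lg; under eq_fun do rewrite conjCK. Qed.

(** The Poisson kernel of the upper half-plane without the factor 1/pi; it arises as the difference
    of resolvents at conjugate points. *)
Definition poisson (y u : R) : R := y / (u ^+ 2 + y ^+ 2).

Lemma fres_poisson (s y x : R) :
  fres (Complex s y) x - fres (Complex s (- y)) x = Complex 0 2 * rc (poisson y (x - s)).
Proof.
rewrite !fresE /poisson; apply: complex_eq; rewrite !cE /= sqrrN.
  by rewrite mul0r mulr0 subr0 subrr.
by rewrite mul0r add0r mulNr opprK mulr2n mulrDl !mul1r.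
Qed.

End Resolvents.

(** * Functions whose integral over every interval vanishes *)

Section NullOnIntervals.
Variable R : realType.
Local Notation mu := (@lebesgue_measure R).
Variable f : R -> R.
Hypothesis mf : measurable_fun setT f.
Hypothesis f0 : forall z c : R, 0 < c -> rinteg (fun x => ibox ((z - x) / c) * f x) /\
  \int[mu]_x (ibox ((z - x) / c) * f x) = 0.

Let wibox (z c x : R) : 0 < c -> ibox ((z - x) / c) = \1_(`[z - c, z]%classic) x.
Proof.
move=> c0; rewrite indicE; have [h|h] := boolP (z - c <= x <= z).
  have := wbox_in c0 h; rewrite /wbox /box => -[->].
  by rewrite mem_set //= in_itv.
have := wbox_out c0 h; rewrite /wbox /box => -[->].
by rewrite memNset //= in_itv /=; exact/negP.
Qed.

Let itv_ibox (g : R -> \bar R) (z c : R) : 0 < c ->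
  (\int[mu]_(x in `[(z - c)%R, z]) g x = \int[mu]_x ((ibox ((z - x) / c)%R)%:E * g x))%E.
Proof.
move=> c0; rewrite [LHS]integral_mkcond; apply: eq_integral => x _.
by rewrite patchE wibox // indicE; case: ifP => _; rewrite ?mul1e ?mul0e.
Qed.

Let ball_box (g : R -> \bar R) (x e : R) : 0 < e -> measurable_fun setT g ->
  (\int[mu]_(y in ball x e) g y = \int[mu]_y ((ibox ((x + e - y) / (2 * e))%R)%:E * g y))%E.
Proof.
move=> e0 mg; have e2 : 0 < 2 * e by rewrite mulr_gt0.
have mS (D : set R) : measurable_fun D g by apply: measurable_funS mg.
rewrite ball_itv integral_itv_bndo_bndc // integral_itv_obnd_cbnd // -itv_ibox //.
by have -> : x + e - 2 * e = x - e by ring.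
Qed.

Let locally : locally_integrable setT f.
Proof.
split => //; first exact: openT.
move=> K _ cK; have [M [_ hM]] := compact_bounded cK.
pose b : R := `|M| + 1; have b0 : 0 < b by rewrite ltr_wpDl.
have Kb x : K x -> `|x| <= b by apply: hM; rewrite /b (le_lt_trans (ler_norm M)) // ltrDl.
have b2 : 0 < 2 * b by rewrite mulr_gt0.
have mK := compact_measurable cK.
have mn : measurable_fun setT (fun x : R => `|f x|%R%:E).
  by apply/measurable_EFinP; exact: measurableT_comp.
apply: (@le_lt_trans _ _ (\int[mu]_(x in `[(b - 2 * b)%R, b]) `|f x|%:E)%E).
  apply: ge0_subset_integral => //; first by apply: measurable_funS mn.
  by move=> x /Kb; rewrite /= in_itv /= ler_norml => /andP[h1 h2]; apply/andP; split; lra.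
rewrite itv_ibox // [ltLHS](_ : _ = \int[mu]_x `|ibox ((b - x) / (2 * b)) * f x|%R%:E)%E.
  by rewrite (rinteg_fin (integrable_norm (f0 b b2).1)) ltry.
by apply: eq_integral => x _; rewrite normrM (ger0_norm (ibox_ge0 _)) EFinM.
Qed.

(** At a Lebesgue point the mean of |f - f(x)| over small balls tends to 0; it dominates the modulus
    of the mean of f - f(x), which is |f(x)| because [f] has mean 0 on every ball. *)
Lemma null_on_intervals : {ae mu, forall x, f x = 0}.
Proof.
have := lebesgue_differentiation locally; apply: ae_mono => x; rewrite /lebesgue_pt.
move=> /fine_cvgP[hf /cvgrPdist_lt hl]; apply/eqP; rewrite -normr_eq0 eq_le normr_ge0 andbT.
apply/ler_addgt0Pr => e e0; rewrite add0r.
have [d /= d0 hd] := filterI hf (hl e e0).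
have d2 : 0 < d / 2 by rewrite divr_gt0.
have [fin] : (davg f x (d / 2) \is a fin_num)%E /\ `|0 - fine (davg f x (d / 2))| < e.
  by apply: hd => //=; rewrite sub0r normrN ger0_norm ?(ltW d2) // ltr_pdivrMr // ltr_pMr // ltr1n.
set r := d / 2 in d2 fin *; have r2 : 0 < 2 * r by rewrite mulr_gt0.
have mg : measurable_fun setT (fun y : R => (f y - f x)%R%:E).
  by apply/measurable_EFinP; exact: measurable_funB.
have I1 : (\int[mu]_(y in ball x r) (f y - f x)%R%:E = (- (2 * r * f x))%R%:E)%E.
  rewrite ball_box // [LHS](_ : _ = \int[mu]_y (ibox ((x + r - y) / (2 * r)) * f y -
     f x * ibox ((x + r - y) / (2 * r)))%R%:E)%E; last first.
    by apply: eq_integral => y _; rewrite -EFinM mulrBr [_ * f x]mulrC.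
  have [iw cw] := cint_wbox (x + r) r2.
  have iw' : rinteg (fun y : R => f x * ibox ((x + r - y) / (2 * r))) := rintegZ _ iw.1.
  have [i1 e1] := f0 (x + r) r2.
  rewrite (rinteg_fin (rintegB i1 iw')); congr EFin.
  rewrite RintegralB // e1 RintegralZl //; last exact: iw.1.
  by have [-> _] := cw; rewrite sub0r mulrC.
have mur : (mu (ball x r) = (2 * r)%R%:E)%E by rewrite lebesgue_measure_ball ?(ltW d2) // mulr_natl.
have mb : measurable (ball x r) by exact: measurable_ball.
have dle : (`|f x|%:E <= davg f x r)%E.
  rewrite /davg /iavg -[X in (_ * X)%E]/(\int[mu]_(y in ball x r) `|(f y - f x)%R%:E|)%E.
  have h := le_abse_integral mu mb (measurable_funS measurableT (@subsetT _ _) mg).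
  rewrite I1 in h; rewrite mur.
  apply: le_trans (lee_wpmul2l _ h); last by rewrite inve_ge0 lee_fin ltW.
  rewrite /= normrN normrM (gtr0_norm r2) inver gt_eqF // -EFinM mulKf ?gt_eqF //.
rewrite sub0r normrN => h.
rewrite -lee_fin; apply: le_trans dle _.
by rewrite -(fineK fin) lee_fin ltW // (le_lt_trans (ler_norm _) h).
Qed.

End NullOnIntervals.

(** * Poisson integrals of the indicator of an interval *)

Section Uniqueness.
Variable R : realType.
Local Notation mu := (@lebesgue_measure R).
Variable r : cfun R.
Hypothesis Lr : L2 r.
Hypothesis Hr : forall z : R[i], complex.Im z != 0 -> cint (fun x => r x * fres z x) = 0.

Let pk (y s : R) : cfun R := fun x => rc (poisson y (x - s)).

Let pkE y s : pk y s = fun x => (Complex 0 2)^-1 * (fres (Complex s y) x - fres (Complex s (- y)) x).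
Proof.
apply/funext => x; rewrite fres_poisson mulrA mulVf ?mul1r //.
by apply/eqP => -[] /eqP; rewrite pnatr_eq0.
Qed.

Let L2_pk y s : 0 < y -> L2 (pk y s).
Proof.
move=> y0; rewrite pkE; apply: L2Z.
by apply: L2B; apply: L2_fres; rewrite /= ?oppr_eq0 gt_eqF.
Qed.

Let l2norm_pk y s : 0 < y -> l2norm (pk y s) = l2norm (pk y 0).
Proof.
move=> y0; rewrite -(l2norm_shift s (L2_cmeas (L2_pk 0 y0))); congr l2norm.
by apply/funext => x; rewrite /pk subr0.
Qed.

Let vanish y s : 0 < y -> cint (fun x => r x * pk y s x) = 0.
Proof.
move=> y0; have y0' : y != 0 by rewrite gt_eqF.
have i1 : cinteg (fun x => r x * fres (Complex s y) x) by apply: cinteg_mul => //; exact: L2_fres.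
have i2 : cinteg (fun x => r x * fres (Complex s (- y)) x).
  by apply: cinteg_mul => //; apply: L2_fres; rewrite /= oppr_eq0.
rewrite pkE (_ : (fun x => _) = fun x => (Complex 0 2)^-1 *
    (r x * fres (Complex s y) x - r x * fres (Complex s (- y)) x)); last first.
  by apply/funext => x; ring.
rewrite cintZ; last exact: cintegB.
by rewrite cintB // !Hr ?subrr ?mulr0 //= oppr_eq0.
Qed.

Variables (z c : R).
Hypothesis c0 : 0 < c.

Let kk (t : R) : R := (1 + t ^+ 2)^-1.

Let kk_ge0 t : 0 <= kk t.
Proof. by rewrite invr_ge0 addr_ge0 ?sqr_ge0. Qed.

Let kk_le1 t : kk t <= 1.
Proof. by rewrite invf_le1 ?lerDl ?sqr_ge0 // ltr_wpDr ?sqr_ge0. Qed.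

Let mkk : measurable_fun setT kk := rinteg_measurable (rinteg_oneDsqr R).

(** Up to the factor pi, the Poisson extension of the indicator at height [y]. In this scaled form
    the kernel is fixed and only the argument x - yt moves, so the limit y -> 0 follows from
    dominated convergence. *)
Let W (y x : R) : R[i] := cint (fun t => wbox z c (x - y * t) * rc (kk t)).

Let cmeas_wbox : cmeas (wbox z c).
Proof. by apply/L2_cmeas/L2_wbox; rewrite gt_eqF. Qed.

Let W_conv y x : 0 < y -> W y x = cint (fun s => wbox z c s * pk y s x).
Proof.
move=> y0; have c0' : c != 0 by rewrite gt_eqF.
have pkC s : pk y s x = pk y x s by rewrite /pk /poisson -sqrrN opprB.
rewrite [RHS](_ : _ = cint (fun s => wbox z c s * pk y x s)); last first.
  by apply: cint_ext => s; rewrite pkC.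
have i0 : cinteg (fun s => wbox z c s * pk y x s) by apply: cinteg_wbox => //; exact: L2_pk.
rewrite (cint_affine x y0 i0) -cintZ; last first.
  apply: (cinteg_mul (f := fun t => wbox z c (x - y * t)) (g := fun t => pk y x (x - y * t))).
    by apply: L2_affine; [rewrite gt_eqF|exact: L2_wbox].
  by apply: L2_affine; [rewrite gt_eqF|exact: L2_pk].
apply: cint_ext => t; rewrite mulrCA; congr (_ * _).
rewrite /pk /rc /poisson /kk addrAC subrr add0r sqrrN exprMn.
apply: complex_eq; rewrite !cE /= ?mulr0 ?mul0r ?subr0 ?addr0 //.
have h1 : 1 + t ^+ 2 != 0 by rewrite gt_eqF // ltr_wpDr ?sqr_ge0.
have -> : y ^+ 2 * t ^+ 2 + y ^+ 2 = y * (y * (1 + t ^+ 2)) by ring.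
have y1 : y != 0 by rewrite gt_eqF.
by field; rewrite y1 h1.
Qed.

(** By Fubini this is an integral over the interval of Poisson integrals of [r], all of them 0. *)
Let W_vanish y : 0 < y -> cint (fun x => r x * W y x) = 0.
Proof.
move=> y0; pose F (p : R * R) := wbox z c p.1 * (r p.2 * pk y p.1 p.2).
have mr := L2_cmeas Lr.
have mF : cmeas F.
  apply: cmeasM; first exact: (cmeas_comp cmeas_wbox measurable_fst).
  apply: cmeasM; first exact: (cmeas_comp mr measurable_snd).
  rewrite (_ : (fun _ => _) = fun p : R * R => pk y 0 (p.2 - p.1)); last first.
    by apply/funext => p; rewrite /pk subr0.
  apply: (cmeas_comp (L2_cmeas (L2_pk 0 y0))).
  by apply: measurable_funB; [exact: measurable_snd|exact: measurable_fst].
have [iw _] := cint_wbox z c0.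
pose C := l2norm r * l2norm (pk y 0).
have inner s : (\int[mu]_x (cabs (F (s, x)))%:E <= (cabs (wbox z c s) * C)%:E)%E.
  have i1 := L2_mul Lr (L2_pk s y0).
  have -> : (\int[mu]_x (cabs (F (s, x)))%:E =
      \int[mu]_x (cabs (wbox z c s) * (cabs (r x) * cabs (pk y s x)))%R%:E)%E.
    by apply: eq_integral => x _; rewrite /F !cabsM.
  rewrite (rinteg_fin (rintegZ _ i1)) lee_fin RintegralZl // ler_wpM2l ?cabs_ge0 //.
  by rewrite /C -(l2norm_pk s y0); exact: (cauchy_schwarz_abs Lr (L2_pk s y0)).
have Foo : (\int[mu]_s \int[mu]_x (cabs (F (s, x)))%:E < +oo)%E.
  have iC : rinteg (fun s => cabs (wbox z c s) * C).
    by have := rintegZ C (cinteg_cabs iw); under eq_fun do rewrite mulrC.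
  apply: (@le_lt_trans _ _ (\int[mu]_s (cabs (wbox z c s) * C)%R%:E)%E); last first.
    by rewrite (rinteg_fin iC) ltry.
  have mabs : measurable_fun setT (fun p => (cabs (F p))%:E).
    exact/measurable_EFinP/measurable_cabs.
  apply: ge0_le_integral => //.
  - by move=> s _; apply: integral_ge0 => x _; rewrite lee_fin cabs_ge0.
  - by apply: (measurable_int_param (F := fun p => (cabs (F p))%:E)) => // p; rewrite lee_fin cabs_ge0.
  - by apply/measurable_EFinP; exact: (rinteg_measurable iC).
have := cfubini mF Foo; rewrite {1}/F /=.
have -> : cint (fun s => cint (fun x => wbox z c s * (r x * pk y s x))) = 0.
  rewrite -[RHS]cint0; apply: cint_ext => s.
  rewrite cintZ ?vanish ?mulr0 //; apply: cinteg_mul => //; exact: L2_pk.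
move=> H; rewrite [RHS]H; apply: cint_ext => x; rewrite W_conv // /F /= -cintZ; last first.
  have -> : (fun s => wbox z c s * pk y s x) = fun s => wbox z c s * pk y x s.
    by apply/funext => s; rewrite /pk /poisson -sqrrN opprB.
  by apply: cinteg_wbox; [rewrite gt_eqF|exact: L2_pk].
by apply: cint_ext => s; rewrite mulrCA.
Qed.

Let K0 := \int[mu]_t kk t.

Let ikk : rinteg kk := rinteg_oneDsqr R.

Let K0_ge : 1 / 2 <= K0 := Rint_oneDsqr_ge R.

(** From a point at distance more than [c] from [z], the interval is reached only if y|t| is at
    least |x - z| - c, and for such t the kernel is small. *)
Let gap (x y t : R) : 0 < y -> c < `|x - z| -> wbox z c (x - y * t) != 0 ->
  kk t <= (y / (`|x - z| - c)) ^+ 2.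
Proof.
move=> y0 xz w0; have m0 : 0 < `|x - z| - c by rewrite subr_gt0.
have hx : z - c <= x - y * t <= z by apply: contraR w0 => /(wbox_out c0) ->.
have yt : `|x - z| - c <= y * `|t|.
  have -> : y * `|t| = `|y * t| by rewrite normrM (gtr0_norm y0).
  move: hx => /andP[h1 h2]; have := ler_norm (y * t); have := ler_norm (- (y * t)).
  rewrite normrN; have [h|h] := leP 0 (x - z); first by rewrite (ger0_norm h); lra.
  by rewrite (ltr0_norm h); lra.
have p1 : 0 < 1 + t ^+ 2 by rewrite ltr_wpDr ?sqr_ge0.
have p2 : 0 < (y / (`|x - z| - c)) ^+ 2 by rewrite exprn_gt0 // divr_gt0.
rewrite -[_ ^+ 2]invrK lef_pV2 ?posrE ?invr_gt0 //.
rewrite -exprVn invf_div; apply: (@le_trans _ _ (`|t| ^+ 2)); last by rewrite real_normK ?num_real // lerDr.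
rewrite ler_pXn2r ?nnegrE ?divr_ge0 ?(ltW m0) ?(ltW y0) // ler_pdivrMr //.
by rewrite mulrC.
Qed.

Let cmeas_Wint (y x : R) : cmeas (fun t => wbox z c (x - y * t) * rc (kk t)).
Proof. by apply: cmeasM; [exact: cmeas_affine|exact: cmeas_real]. Qed.

Let cabs_wkk (u t : R) : cabs (wbox z c u * rc (kk t)) <= kk t.
Proof.
rewrite cabsM cabs_rc // ler_piMl // cabs_box.
by have := ibox_sq ((z - u) / c); have := ibox_ge0 ((z - u) / c); nra.
Qed.

Let W_le y x : cabs (W y x) <= K0.
Proof. by apply: cabs_cint_le ikk _ => // t; exact: cabs_wkk. Qed.

Let W_far (y x : R) : 0 < y <= 1 -> c + 1 < `|x - z| -> cabs (W y x) <= c / (`|x - z| - c).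
Proof.
move=> /andP[y0 y1] xz; have m1 : 1 <= `|x - z| - c by lra.
have m0 : 0 < `|x - z| - c by lra.
have [iw cw] := cint_wbox z c0; have c0' : c != 0 by rewrite gt_eqF.
have y0' : y != 0 by rewrite gt_eqF.
have ia : cinteg (fun t => wbox z c (x - y * t)).
  have La := L2_affine x y0' (L2_wbox z c0').
  have := cinteg_ip La La; congr cinteg; apply/funext => t; exact: box_mul_conj.
have := cint_affine x y0 iw; rewrite cw => -[]; rewrite mul0r subr0 => cy _.
set D := (y / (`|x - z| - c)) ^+ 2.
apply: (@le_trans _ _ (\int[mu]_t (D * complex.Re (wbox z c (x - y * t))))).
  apply: cabs_cint_le (rintegZ _ ia.1) _ => // t.
  have [->|w0] := eqVneq (wbox z c (x - y * t)) 0; first by rewrite mul0r cabs0 /= mulr0.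
  rewrite cabsM cabs_rc // cabs_box mulrC ler_wpM2r ?ibox_ge0 //.
  by apply: gap => //; lra.
rewrite RintegralZl //; last exact: ia.1.
have -> : \int[mu]_t complex.Re (wbox z c (x - y * t)) = c / y.
  by apply: (mulfI y0'); rewrite [RHS]mulrC divfK //; exact: esym cy.
rewrite /D; set m := `|x - z| - c in m1 m0 *.
have -> : (y / m) ^+ 2 * (c / y) = y / m * (c / m) by field; rewrite y0' gt_eqF.
rewrite ler_piMl ?divr_ge0 ?(ltW c0) ?(ltW m0) // ler_pdivrMr // mul1r.
exact: le_trans y1 m1.
Qed.

Let Cw := (K0 + c) * (c + 2).

(** One square integrable majorant for all heights up to 1, as the weak limit needs bounded norms:
    near the interval the total mass [K0] suffices, away from it [W_far] gives the decay. *)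
Let W_dom (y x : R) : 0 < y <= 1 -> cabs (W y x) <= Cw * cabs (rc (decay (x - z))).
Proof.
move=> hy; rewrite cabs_rc ?(ltW (decay_gt0 _)) // /decay ler_pdivlMr ?ltr_wpDr // /Cw.
have K := K0_ge; have a0 := normr_ge0 (x - z).
have [h|h] := leP `|x - z| (c + 1).
  have h1 : cabs (W y x) <= K0 + c by apply: le_trans (W_le y x) _; rewrite lerDl ltW.
  have h2 : 1 + `|x - z| <= c + 2 by lra.
  by apply: ler_pM h1 h2; rewrite ?cabs_ge0 ?addr_ge0.
have := W_far hy h; rewrite ler_pdivlMr; last by lra.
have := cabs_ge0 (W y x); move: (cabs (W y x)) (`|x - z|) h a0 => w u h a0 w0 hw.
apply: (@le_trans _ _ (c * (c + 2))); last first.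
  by rewrite ler_wpM2r ?addr_ge0 ?(ltW c0) // lerDr (le_trans _ K).
apply: le_trans (_ : w * ((u - c) * (c + 2)) <= _); last first.
  by rewrite mulrA ler_wpM2r // addr_ge0 // ltW.
by rewrite ler_wpM2l //; have := c0; nra.
Qed.

Let yn (n : nat) : R := n.+1%:R^-1.

Let yn_in n : 0 < yn n <= 1.
Proof. by rewrite invr_gt0 ltr0n /= invf_le1 ?ltr0n // ler1n. Qed.

(** Zero at the two ends of the interval, where the extension does not tend to [K0] times the
    indicator. Deleting them turns convergence almost everywhere into the everywhere convergence
    required by [weak_limit]. *)
Let gd (x : R) : R[i] := if (x == z) || (x == z - c) then 0 else 1.

Let gd_ae : {ae mu, forall x, gd x = 1}.
Proof.
exists [set z; z - c]; split.
- by apply: measurableU; exact: measurable_set1.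
- by apply: countable_lebesgue_measure0; apply/finite_set_countable; exact: finite_set2.
move=> x /= h; rewrite /gd in h; case: ifP h => [/orP[/eqP ->|/eqP ->]|_ []] //; by [left|right].
Qed.

Let cmeas_gd : cmeas gd.
Proof.
rewrite (_ : gd = fun x => rc (\1_(~` [set z; z - c]) x)).
  apply: cmeas_real; apply: measurable_indic; apply: measurableC.
  by apply: measurableU; exact: measurable_set1.
apply/funext => x; rewrite /gd indicE; case: ifP => h.
  by rewrite memNset //= => -[]; move: h => /orP[/eqP ->|/eqP ->]; [left|right].
by rewrite mem_set //= => -[] E; move: h; rewrite E eqxx ?orbT.
Qed.

Let cabs_gd x : cabs (gd x) <= 1.
Proof. by rewrite /gd; case: ifP; rewrite ?cabs0 ?cabs1. Qed.

Let yn_small (t e : R) : 0 < e -> exists M, forall n, (M <= n)%N -> `|yn n * t| < e.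
Proof.
move=> e0; exists (Num.truncn (`|t| / e)) => n hn.
rewrite normrM gtr0_norm; last by case/andP: (yn_in n).
rewrite /yn ltr_pdivrMl ?ltr0n // mulrC -ltr_pdivrMl // mulrC.
by apply: lt_le_trans (truncnS_gt _) _; rewrite ler_nat ltnS.
Qed.

Let W_lim x : gd x != 0 ->
  (fun n => cabs (W (yn n) x - wbox z c x * rc K0)) @ \oo --> 0.
Proof.
rewrite /gd; case: ifPn; rewrite ?eqxx // negb_or => /andP[xz xc] _.
have [e e0 he] : exists2 e, 0 < e & forall u, `|u| < e -> wbox z c (x - u) = wbox z c x.
  have [h|h] := boolP (z - c <= x <= z).
    have /andP[h1 h2] : z - c < x < z by move: h; rewrite !lt_neqAle eq_sym xc xz.
    exists (Num.min (x - (z - c)) (z - x)); first by rewrite lt_min !subr_gt0 h1.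
    move=> u; rewrite lt_min !ltr_norml => /andP[/andP[u1 u2] /andP[u3 u4]].
    by rewrite !wbox_in //; apply/andP; split; lra.
  move: (h); rewrite negb_and -!ltNge => /orP[h1|h1].
    exists (z - c - x); first by rewrite subr_gt0.
    move=> u; rewrite ltr_norml => /andP[u1 u2]; rewrite !wbox_out //.
    by rewrite negb_and -!ltNge; apply/orP; left; lra.
  exists (x - z); first by rewrite subr_gt0.
  move=> u; rewrite ltr_norml => /andP[u1 u2]; rewrite !wbox_out //.
  by rewrite negb_and -!ltNge; apply/orP; right; lra.
have ck : cinteg (fun t => rc (kk t)) by split; [exact: ikk|exact: integrable0].
have -> : wbox z c x * rc K0 = cint (fun t => wbox z c x * rc (kk t)).
  rewrite cintZ //; congr (_ * _); apply: complex_eq => //=.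
  by rewrite Rintegral_cst // mul0r.
apply: (dominated_cint (fun n => cmeas_Wint (yn n) x) (cmeasM (cmeas_cst (wbox z c x))
  (cmeas_real mkk)) ikk (fun n t => cabs_wkk _ t)).
move=> t; apply/climP => d d0; have [M hM] := yn_small t e0.
by exists M => n /hM /he ->; rewrite subrr cabs0.
Qed.

(** The extensions tend weakly to [K0] times the indicator while every pairing with [r] is 0, and
    [K0] is not 0. *)
Lemma wbox_null : cint (fun x => wbox z c x * r x) = 0.
Proof.
have c0' : c != 0 by rewrite gt_eqF.
have Lw : L2 (wbox z c) := L2_wbox z c0'.
have cK : 0 <= Cw by rewrite mulr_ge0 ?addr_ge0 //; have := K0_ge; have := c0; lra.
have Lcr := L2_conj Lr; have mr := L2_cmeas Lr.
pose F n x := gd x * W (yn n) x.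
have mW n : cmeas (W (yn n)).
  apply: (cmeas_cint_param (F := fun p : R * R => wbox z c (p.1 - yn n * p.2) * rc (kk p.2))).
  apply: cmeasM; last exact: (cmeas_comp (cmeas_real mkk) measurable_snd).
  apply: (cmeas_comp cmeas_wbox); apply: measurable_funB; first exact: measurable_fst.
  by apply: measurable_funM => //; exact: measurable_snd.
have LD := L2_shift z (L2_decay R).
have mF n : cmeas (F n) by exact: cmeasM.
have LF n : L2 (F n) /\ l2norm (F n) <= Cw * l2norm (fun x => rc (decay (x - z))).
  apply: (L2_dom (mF n) LD cK) => x; rewrite /F cabsM.
  by apply: le_trans (W_dom x (yn_in n)); rewrite ler_piMl ?cabs_ge0.
pose f x := gd x * (wbox z c x * rc K0).
have mf : cmeas f by apply: cmeasM => //; apply: cmeasM => //; exact: cmeas_cst.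
have pt x : (fun n => cabs (F n x - f x)) @ \oo --> 0.
  have [g0|g0] := eqVneq (gd x) 0.
    by apply/climP => e e0; exists 0%N => n _; rewrite /F /f g0 !mul0r subrr cabs0.
  have /climP h := W_lim g0; apply/climP => e /h[M hM]; exists M => n /hM; apply: le_lt_trans.
  by rewrite /F /f -mulrBr cabsM ler_piMl ?cabs_ge0.
have := weak_limit (fun n => (LF n).1) mf (fun n => (LF n).2) pt Lcr.
have E n : ip (F n) (fun x => (r x)^*) = 0.
  have y0 : 0 < yn n by case/andP: (yn_in n).
  rewrite -(W_vanish y0); apply: cint_ae.
  - by apply: cmeasM => //; exact/cmeas_conj/cmeas_conj.
  - exact: cmeasM.
  by apply: ae_mono gd_ae => x gx; rewrite /F gx mul1r conjCK mulrC.
under eq_fun do rewrite E.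
move=> /(cabs_lim_unique (clim_cst 0)) H.
have e1 : ip f (fun x => (r x)^*) = cint (fun x => rc K0 * (wbox z c x * r x)).
  apply: cint_ae.
  - by apply: cmeasM => //; exact/cmeas_conj/cmeas_conj.
  - by apply: cmeasM; [exact: cmeas_cst|exact: cmeasM].
  by apply: ae_mono gd_ae => x gx; rewrite /f gx mul1r conjCK mulrAC mulrC.
move: H; rewrite e1 cintZ; last exact: cinteg_wbox.
move/eqP; rewrite eq_sym mulf_eq0 => /orP[|/eqP //].
by move=> /eqP[K00]; have := K0_ge; rewrite K00 div1r invr_le0 lern0.
Qed.

End Uniqueness.

Section UniquenessConclusion.
Variable R : realType.
Local Notation mu := (@lebesgue_measure R).

(* The vanishing of all resolvent integrals makes every Poisson integral of [r] vanish, hence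
   its integral over every interval. *)
Lemma resolvent_unique (r : cfun R) : L2 r ->
  (forall z : R[i], complex.Im z != 0 -> cint (fun x => r x * fres z x) = 0) ->
  aeeq r (fun=> 0).
Proof.
move=> Lr Hr; have [m1 m2] := L2_cmeas Lr.
have iw (z c : R) (c0 : 0 < c) : cinteg (fun x => wbox z c x * r x).
  by apply: cinteg_wbox => //; rewrite gt_eqF.
have n1 := @null_on_intervals R (fun x => complex.Re (r x)) m1.
have n2 := @null_on_intervals R (fun x => complex.Im (r x)) m2.
have E (z c : R) : (fun x => ibox ((z - x) / c) * complex.Re (r x)) =
    fun x => complex.Re (wbox z c x * r x).
  by apply/funext => x; rewrite /wbox /box cE /= mul0r subr0.
have E' (z c : R) : (fun x => ibox ((z - x) / c) * complex.Im (r x)) =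
    fun x => complex.Im (wbox z c x * r x).
  by apply/funext => x; rewrite /wbox /box cE /= mul0r addr0.
apply: (ae_mono2 _ (n1 _) (n2 _)).
- by move=> x h1 h2; apply: complex_eq.
- move=> z c c0; rewrite E; split; first exact: (iw z c c0).1.
  exact: (congr1 (@complex.Re R) (wbox_null Lr Hr z c0)).
- move=> z c c0; rewrite E'; split; first exact: (iw z c c0).2.
  exact: (congr1 (@complex.Im R) (wbox_null Lr Hr z c0)).
Qed.

End UniquenessConclusion.

(** * Hardy functions *)

Section ContourShift.
Variable R : realType.
Local Notation mu := (@lebesgue_measure R).
Variables (h : R -> R -> R[i]) (G : R -> R) (k0 : R).
Hypothesis k0_gt0 : 0 < k0.
Hypothesis mh : forall y, 0 <= y -> cmeas (h y).
Hypothesis iG : rinteg G.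
Hypothesis hG : forall y x, 0 <= y -> cabs (h y x) <= G x.
Hypothesis hd : forall y k x, 0 <= y -> 0 < k -> k <= k0 ->
  cabs (h (y + k) x - h y x - Complex 0 1 * (h y (x + k) - h y x)) <= k ^+ 2 * G x.
Hypothesis hl : forall x, clim (fun n => h n%:R x) 0.

Let ih y : 0 <= y -> cinteg (h y).
Proof. by move=> y0; apply: (cinteg_le (mh y0) iG) => x; exact: hG. Qed.

Let I := \int[mu]_x G x.

Let step y k : 0 <= y -> 0 < k -> k <= k0 ->
  cabs (cint (h (y + k)) - cint (h y)) <= k ^+ 2 * I.
Proof.
move=> y0 kp kk; have yk : 0 <= y + k by rewrite addr_ge0 // ltW.
have i1 := ih yk; have i2 := ih y0.
have i3 : cinteg (fun x => h y (x + k)).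
  by have := cinteg_shift (- k) i2; under eq_fun do rewrite opprK.
have e3 : cint (fun x => h y (x + k)) = cint (h y).
  by rewrite -(cint_shift (- k) (mh y0)); apply: cint_ext => x; rewrite opprK.
have i4 := cintegZ (Complex 0 1) (cintegB i3 i2).
have -> : cint (h (y + k)) - cint (h y) = cint (fun x => h (y + k) x - h y x -
    Complex 0 1 * (h y (x + k) - h y x)).
  by rewrite cintB ?cintB ?cintZ ?cintB ?e3 ?subrr ?mulr0 ?subr0 //; exact: cintegB.
rewrite -RintegralZl //; apply: cabs_cint_le (rintegZ _ iG) _.
  exact/cinteg_meas/(cintegB (cintegB i1 i2) i4).
by move=> x; exact: hd.
Qed.

Let steps k m : 0 < k -> k <= k0 ->
  cabs (cint (h (m%:R * k)) - cint (h 0)) <= m%:R * (k ^+ 2 * I).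
Proof.
move=> kp kk; elim: m => [|m ih']; first by rewrite !mul0r subrr cabs0.
have mk : 0 <= m%:R * k by rewrite mulr_ge0 // ltW.
have -> : m.+1%:R * k = m%:R * k + k by rewrite -natr1 mulrDl mul1r.
have -> : cint (h (m%:R * k + k)) - cint (h 0) =
    (cint (h (m%:R * k + k)) - cint (h (m%:R * k))) + (cint (h (m%:R * k)) - cint (h 0)).
  by rewrite subrKA.
apply: le_trans (cabsD _ _) _; have := step mk kp kk.
by rewrite -natr1 [(m%:R + 1) * _]mulrDl mul1r; lra.
Qed.

Let const n : cint (h n%:R) = cint (h 0).
Proof.
apply/eqP; rewrite -subr_eq0; apply/eqP/cabs0_eq0/eqP; rewrite eq_le cabs_ge0 andbT.
have I0 : 0 <= I.
  apply: Rintegral_ge0 => x _; exact: le_trans (cabs_ge0 _) (hG x (lexx 0)).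
apply/ler_addgt0Pr => e e0; rewrite add0r.
pose m := (Num.truncn (n%:R * I / e + k0^-1)).+1.
have m0 : 0 < m%:R :> R by rewrite ltr0n.
have mI : n%:R * I / e + k0^-1 <= m%:R by exact/ltW/truncnS_gt.
have q0 : 0 <= n%:R * I / e by rewrite divr_ge0 ?(ltW e0) // mulr_ge0.
have k0' : 0 < k0^-1 by rewrite invr_gt0.
have km : m%:R^-1 <= k0.
  by rewrite -[k0]invrK lef_pV2 ?posrE //; lra.
have := steps (n * m) (_ : 0 < m%:R^-1) km; rewrite invr_gt0 => /(_ m0).
rewrite natrM mulfK ?gt_eqF // => /le_trans; apply.
have -> : n%:R * m%:R * (m%:R^-1 ^+ 2 * I) = n%:R * I / m%:R by field; rewrite gt_eqF.
by rewrite ler_pdivrMr // [leRHS]mulrC -ler_pdivrMr //; lra.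
Qed.

(** Cauchy's theorem in discrete form. By [hd] a vertical increment is i times a horizontal one up
    to [k ^ 2 * G], and horizontal increments integrate to 0 by translation invariance. Climbing to
    height n takes n/k steps and costs a multiple of n k, which is arbitrarily small; so the
    integral is the same at every integer height, and it tends to 0 by [hl]. *)
Lemma contour_shift : cint (h 0) = 0.
Proof.
have n0 (n : nat) : 0 <= n%:R :> R by [].
have H : clim (fun n => cint (h n%:R)) (cint (fun=> 0)).
  apply: (dominated_cint (fun n => mh (n0 n)) (cmeas_cst 0) iG (fun n x => hG x (n0 n))).
  exact: hl.
move: H; rewrite cint0; under eq_fun do rewrite const.
exact: (cabs_lim_unique (clim_cst _)).
Qed.

End ContourShift.

(** * First-order Taylor bounds for products and resolvents *)

Section Taylor.
Variable R : realType.
Implicit Types (z w a b : R[i]) (f g : R[i] -> R[i]).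

(* Only the two increments [k] and [i k] enter the Cauchy-Riemann difference. *)
Definition tay (F k : R) f f' z := forall w, w = rc k \/ w = Complex 0 k ->
  [/\ cabs (f z) <= F, cabs (f (z + w)) <= F, cabs (f' z) <= F &
      cabs (f (z + w) - f z - w * f' z) <= k ^+ 2 * F].

Let cabs_w (k : R) w : 0 < k -> w = rc k \/ w = Complex 0 k -> cabs w = k.
Proof.
move=> k0 [->|->]; first by rewrite cabs_rc // ltW.
have -> : Complex 0 k = Complex 0 1 * rc k by apply: complex_eq; rewrite !cE /=; ring.
by rewrite cabsM cabs_rc ?ltW // /cabs /csq /= expr0n expr1n add0r sqrtr1 mul1r.
Qed.

(** The remainder of a product splits into four terms, each at most k^2 F G since [k <= 1]; hence
    the factor 4. *)
Lemma tay_mul (F G k : R) f f' g g' z : 0 < k -> k <= 1 -> tay F k f f' z -> tay G k g g' z ->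
  tay (4 * F * G) k (fun z => f z * g z) (fun z => f' z * g z + f z * g' z) z.
Proof.
move=> k0 k1 tf tg w hw; have cw := cabs_w k0 hw.
have [f1 f2 f3 f4] := tf w hw; have [g1 g2 g3 g4] := tg w hw.
have F0 := le_trans (cabs_ge0 _) f1; have G0 := le_trans (cabs_ge0 _) g1.
have FG : 0 <= F * G by rewrite mulr_ge0.
have m2 (p q : R[i]) (P Q : R) : cabs p <= P -> cabs q <= Q -> cabs (p * q) <= P * Q.
  by move=> hp hq; rewrite cabsM ler_pM ?cabs_ge0.
have k2 : 0 <= k ^+ 2 by exact: sqr_ge0.
have kk1 : k ^+ 2 <= 1 by rewrite exprn_ile1 // ltW.
split.
- by apply: le_trans (m2 _ _ _ _ f1 g1) _; lra.
- by apply: le_trans (m2 _ _ _ _ f2 g2) _; lra.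
- apply: le_trans (cabsD _ _) _; have := m2 _ _ _ _ f3 g1; have := m2 _ _ _ _ f1 g3; lra.
have -> : f (z + w) * g (z + w) - f z * g z - w * (f' z * g z + f z * g' z) =
    f z * (g (z + w) - g z - w * g' z) + w * f' z * (w * g' z) +
    (w * f' z * (g (z + w) - g z - w * g' z) + (f (z + w) - f z - w * f' z) * g (z + w)).
  by ring.
have wf : cabs (w * f' z) <= k * F by apply: m2; rewrite ?cw.
have wg : cabs (w * g' z) <= k * G by apply: m2; rewrite ?cw.
have h1 := m2 _ _ _ _ f1 g4; have h2 := m2 _ _ _ _ wf wg.
have h3 := m2 _ _ _ _ wf g4; have h4 := m2 _ _ _ _ f4 g2.
have t1 := cabsD (f z * (g (z + w) - g z - w * g' z)) (w * f' z * (w * g' z)).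
have t2 := cabsD (w * f' z * (g (z + w) - g z - w * g' z))
  ((f (z + w) - f z - w * f' z) * g (z + w)).
apply: le_trans (cabsD _ _) _.
have E1 : F * (k ^+ 2 * G) = k ^+ 2 * (F * G) by ring.
have E2 : k * F * (k * G) = k ^+ 2 * (F * G) by ring.
have E3 : k * F * (k ^+ 2 * G) = k * (k ^+ 2 * (F * G)) by ring.
have E4 : k ^+ 2 * F * G = k ^+ 2 * (F * G) by ring.
have E5 : k ^+ 2 * (4 * F * G) = 4 * (k ^+ 2 * (F * G)) by ring.
have X0 : 0 <= k ^+ 2 * (F * G) by rewrite mulr_ge0.
have X1 : k * (k ^+ 2 * (F * G)) <= k ^+ 2 * (F * G) by rewrite ler_piMl.
rewrite E1 in h1; rewrite E2 in h2; rewrite E3 in h3; rewrite E4 in h4; rewrite E5.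
move: (k ^+ 2 * (F * G)) X0 X1 h1 h2 h3 h4 t1 t2 => X X0 X1.
have L (u1 u2 u3 u4 v1 v2 : R) : u1 <= X -> u2 <= X -> u3 <= k * X -> u4 <= X ->
    v1 <= u1 + u2 -> v2 <= u3 + u4 -> v1 + v2 <= 4 * X by move=> *; lra.
by move=> h1 h2 h3 h4 t1 t2; exact: L h1 h2 h3 h4 t1 t2.
Qed.

(** The derivative terms cancel, the increment ik being i times the increment k, and two remainders
    are left. *)
Lemma tay_cauchy_riemann (F k : R) f f' z : tay F k f f' z ->
  cabs (f (z + Complex 0 k) - f z - Complex 0 1 * (f (z + rc k) - f z)) <= k ^+ 2 * (2 * F).
Proof.
move=> t; have [_ _ _ h1] := t _ (or_introl erefl); have [_ _ _ h2] := t _ (or_intror erefl).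
have E : Complex 0 k = Complex 0 1 * rc k by apply: complex_eq; rewrite !cE /=; ring.
have -> : f (z + Complex 0 k) - f z - Complex 0 1 * (f (z + rc k) - f z) =
    (f (z + Complex 0 k) - f z - Complex 0 k * f' z) -
    Complex 0 1 * (f (z + rc k) - f z - rc k * f' z).
  by rewrite {3}E; ring.
apply: le_trans (cabsD _ _) _; rewrite cabsN cabsM.
have -> : cabs (Complex 0 1 : R[i]) = 1.
  by rewrite /cabs /csq /= expr0n expr1n add0r sqrtr1.
by rewrite mul1r; lra.
Qed.

Definition majorant a (x : R) : R := decay (x - complex.Re a).

(** For a pole at distance [t] below the axis. The first factor compares 1/|z - a| with [majorant];
    in the second, the terms 1, 1/t and 1/t^2 serve the value, the derivative and the remainder. *)
Definition res_const (t : R) : R := (1 + 2 / t) * (1 + t^-1 + t^-1 ^+ 2).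

Lemma tay_resolvent a (k x y : R) : complex.Im a < 0 -> 0 <= y -> 0 < k -> k <= 1 ->
  tay (res_const (- complex.Im a) * majorant a x) k
    (fun z => (z - a)^-1) (fun z => - ((z - a)^-1 * (z - a)^-1)) (Complex x y).
Proof.
move=> a0 y0 k0 k1; set t := - complex.Im a; have t0 : 0 < t by rewrite oppr_gt0.
have ti : 0 < t^-1 by rewrite invr_gt0.
set B := (1 + 2 / t) * majorant a x.
have B0 : 0 <= B by rewrite mulr_ge0 ?ltW ?decay_gt0 // addr_gt0 // divr_gt0.
(* The room |u - x| <= 1 admits the real increment [k]. Together with the 1 inside [decay] it costs
   2, which is at most 2/t times the distance to the pole. *)
have low u v : `|u - x| <= 1 -> 0 <= v -> t <= cabs (Complex u v - a) /\
    cabs (Complex u v - a)^-1 <= B.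
  move=> ux v0; have h1 := Re_le_cabs (Complex u v - a); have h2 := Im_le_cabs (Complex u v - a).
  rewrite !cE /= in h1 h2.
  have h3 : t <= cabs (Complex u v - a).
    by apply: le_trans h2; apply: le_trans (ler_norm _); rewrite /t; lra.
  have c0 : 0 < cabs (Complex u v - a) by exact: lt_le_trans h3.
  split => //; rewrite cabsV -[leLHS]div1r /B /majorant /decay ler_pdivrMr // mulrAC.
  rewrite ler_pdivlMr ?ltr_wpDr // mul1r.
  have h4 : `|x - complex.Re a| <= cabs (Complex u v - a) + 1.
    have := ler_normD (u - complex.Re a) (x - u); rewrite [`|x - u|]distrC.
    have -> : u - complex.Re a + (x - u) = x - complex.Re a by ring.
    lra.
  have h5 : 1 <= cabs (Complex u v - a) / t by rewrite ler_pdivlMr // mul1r.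
  have -> : (1 + 2 / t) * cabs (Complex u v - a) =
      cabs (Complex u v - a) + 2 * (cabs (Complex u v - a) / t) by ring.
  lra.
have [z1 z2] : t <= cabs (Complex x y - a) /\ cabs (Complex x y - a)^-1 <= B.
  by apply: low => //; rewrite subrr normr0.
have zt : cabs (Complex x y - a)^-1 <= t^-1.
  by rewrite cabsV lef_pV2 ?posrE // (lt_le_trans t0).
have FE : res_const t * majorant a x = B * (1 + t^-1 + t^-1 ^+ 2) by rewrite /B /res_const; ring.
have B1 : 0 <= B * t^-1 by rewrite mulr_ge0 // ltW.
have B2 : 0 <= B * t^-1 ^+ 2 by rewrite mulr_ge0 // sqr_ge0.
rewrite FE !mulrDr mulr1 => w hw.
have cw := cabs_w k0 hw.
have [w1 w2] : t <= cabs (Complex x y + w - a) /\ cabs (Complex x y + w - a)^-1 <= B.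
  case: hw => ->.
    have -> : Complex x y + rc k = Complex (x + k) y by apply: complex_eq; rewrite /= ?addr0.
    by apply: low => //; rewrite addrAC subrr add0r gtr0_norm.
  have -> : Complex x y + Complex 0 k = Complex x (y + k) by apply: complex_eq; rewrite /= ?addr0.
  by apply: low; rewrite ?subrr ?normr0 // addr_ge0 // ltW.
split.
- by apply: le_trans z2 _; lra.
- by apply: le_trans w2 _; lra.
- rewrite cabsN cabsM; apply: (@le_trans _ _ (B * t^-1)); last by lra.
  by apply: ler_pM; rewrite ?cabs_ge0.
set p := Complex x y - a in z1 z2 zt *; have pw : Complex x y + w - a = p + w by rewrite /p addrAC.
rewrite pw in w1 w2 *.
have p0 : p != 0 by apply/eqP => p0; move: z1; rewrite p0 cabs0 leNgt t0.
have pw0 : p + w != 0 by apply/eqP => q0; move: w1; rewrite q0 cabs0 leNgt t0.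
have -> : (p + w)^-1 - p^-1 - w * - (p^-1 * p^-1) = w * w * (p^-1 * p^-1 * (p + w)^-1).
  by field; rewrite p0 pw0.
rewrite !cabsM cw -expr2 ler_wpM2l ?sqr_ge0 //.
apply: (@le_trans _ _ (B * t^-1 ^+ 2)); last by lra.
by rewrite mulrC -!expr2; apply: ler_pM; rewrite ?cabs_ge0 ?sqr_ge0 // ler_pXn2r ?nnegrE ?cabs_ge0 // ltW.
Qed.

End Taylor.

(** * Exponentials over resolvents and their stability *)

Section Hardy.
Variable R : realType.
Local Notation mu := (@lebesgue_measure R).
Implicit Types (f g : cfun R) (z w a b : R[i]).

(** The entire function e^(ilz), written as modulus times phase, so that its bound by 1 on the upper
    half-plane for [0 <= l] is immediate. *)
Definition zexp (l : R) z : R[i] := rc (expR (- (l * complex.Im z))) * cexp (l * complex.Re z).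

Lemma zexpD l z w : zexp l (z + w) = zexp l z * zexp l w.
Proof.
rewrite /zexp cImD cReD !mulrDr opprD expRD cexpD.
have -> : rc (expR (- (l * complex.Im z)) * expR (- (l * complex.Im w))) =
    rc (expR (- (l * complex.Im z))) * rc (expR (- (l * complex.Im w))).
  by apply: complex_eq; rewrite !cE /= ?mulr0 ?mul0r ?subr0 ?addr0.
by ring.
Qed.

Lemma cabs_zexp l z : 0 <= l -> 0 <= complex.Im z -> cabs (zexp l z) <= 1.
Proof.
move=> l0 z0; rewrite /zexp cabsM cabs_cexp mulr1 cabs_rc ?expR_ge0 //.
by rewrite -expR0 ler_expR oppr_le0 mulr_ge0.
Qed.

Lemma expR_taylor (t : R) : 0 <= t -> t <= 1 -> `|expR (- t) - 1 + t| <= t ^+ 2.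
Proof.
move=> t0 t1; have h1 := expR_ge1Dx (- t); have h2 := expR_ge1Dx t.
have e0 := expR_gt0 (- t).
have e1 : expR (- t) * expR t = 1 by rewrite -expRD addNr expR0.
have h3 : expR (- t) * (1 + t) <= 1 by rewrite -[leRHS]e1 ler_pM2l.
have h4 : expR (- t) <= 1 - t + t ^+ 2.
  have : expR (- t) * (1 + t) <= (1 - t + t ^+ 2) * (1 + t).
    apply: le_trans h3 _; have -> : (1 - t + t ^+ 2) * (1 + t) = 1 + t ^+ 3 by ring.
    by rewrite lerDl exprn_ge0.
  by rewrite ler_pM2r // ltr_wpDr.
by rewrite ger0_norm; lra.
Qed.

Lemma tay_zexp (l k : R) z : 0 <= l -> 0 <= complex.Im z -> 0 < k -> k * (1 + l) <= 1 ->
  tay (1 + l + l ^+ 2) k (zexp l) (fun z => Complex 0 l * zexp l z) z.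
Proof.
move=> l0 z0 k0 kl w hw; have l2 := sqr_ge0 l; have lk0 : 0 <= l * k by rewrite mulr_ge0 // ltW.
have lk1 : l * k <= 1 by move: kl; rewrite mulrDr mulr1 mulrC; lra.
have h1 := cabs_zexp l0 z0.
have w0 : 0 <= complex.Im (z + w).
  by case: hw => ->; rewrite cImD /= ?addr0 // addr_ge0 // ltW.
have il : cabs (Complex 0 l) = l.
  by rewrite /cabs /csq /= expr0n add0r sqrtr_sqr ger0_norm.
split.
- by apply: le_trans h1 _; lra.
- by apply: le_trans (cabs_zexp l0 w0) _; lra.
- rewrite cabsM il; apply: (@le_trans _ _ (l * 1)); last by lra.
  by rewrite ler_wpM2l.
have -> : zexp l (z + w) - zexp l z - w * (Complex 0 l * zexp l z) =
    zexp l z * (zexp l w - 1 - w * Complex 0 l) by rewrite zexpD; ring.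
have -> : k ^+ 2 * (1 + l + l ^+ 2) = k ^+ 2 * (1 + l) + (l * k) ^+ 2 by ring.
rewrite cabsM; apply: (@le_trans _ _ (1 * (l * k) ^+ 2)); last first.
  by rewrite mul1r lerDr mulr_ge0 ?sqr_ge0 // addr_ge0.
apply: ler_pM => //; rewrite ?cabs_ge0 //; case: hw => ->.
  have -> : zexp l (rc k) - 1 - rc k * Complex 0 l = cexp (l * k) - 1 - Complex 0 (l * k).
    rewrite /zexp /= mulr0 oppr0 expR0; apply: complex_eq; rewrite !cE /=; ring.
  by apply: cexp_taylor; rewrite ger0_norm.
have -> : zexp l (Complex 0 k) - 1 - Complex 0 k * Complex 0 l = rc (expR (- (l * k)) - 1 + l * k).
  rewrite /zexp /= mulr0 cexp0; apply: complex_eq; rewrite !cE /=; ring.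
by rewrite cabs_real; exact: expR_taylor.
Qed.

Section Integrals.
Variables (l : R) (a b : R[i]).
Hypotheses (l0 : 0 <= l) (a0 : complex.Im a < 0) (b0 : complex.Im b < 0).

Let H (z : R[i]) : R[i] := zexp l z * (z - a)^-1 * (z - b)^-1.
Let h (y x : R) : R[i] := H (Complex x y).
(** 32 = 2 * 4 * 4: a factor 4 from each of the two products and 2 from the Cauchy-Riemann
    difference. *)
Let K : R := 32 * (1 + l + l ^+ 2) * res_const (- complex.Im a) * res_const (- complex.Im b).
Let G (x : R) : R := K * (majorant a x * majorant b x).

Let tayH x y k : 0 <= y -> 0 < k -> k * (1 + l) <= 1 ->
  exists H', tay (4 * (4 * (1 + l + l ^+ 2) * (res_const (- complex.Im a) * majorant a x)) *
    (res_const (- complex.Im b) * majorant b x)) k H H' (Complex x y).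
Proof.
move=> y0 k0 kl; have k1 : k <= 1.
  by apply: le_trans kl; rewrite mulrDr mulr1 lerDl mulr_ge0 // ltW.
eexists; apply: tay_mul => //; last exact: tay_resolvent.
by apply: tay_mul => //; [exact: tay_zexp|exact: tay_resolvent].
Qed.

Let GE x : 4 * (4 * (1 + l + l ^+ 2) * (res_const (- complex.Im a) * majorant a x)) *
    (res_const (- complex.Im b) * majorant b x) = G x / 2.
Proof. by rewrite /G /K; field. Qed.

Let k0 : R := (1 + l)^-1.

Let k0_gt0 : 0 < k0.
Proof. by rewrite invr_gt0 ltr_wpDr. Qed.

Let kl k : k <= k0 -> k * (1 + l) <= 1.
Proof.
move=> kk; have p : 0 < 1 + l by rewrite ltr_wpDr.
by rewrite -ler_pdivlMr // div1r.
Qed.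

Let hG y x : 0 <= y -> cabs (h y x) <= G x.
Proof.
move=> y0; have [H' t] := tayH x y0 k0_gt0 (kl (lexx _)).
have [t1 _ _ _] := t _ (or_introl erefl); rewrite GE in t1.
have := le_trans (cabs_ge0 _) t1; rewrite /h; lra.
Qed.

Let hd y k x : 0 <= y -> 0 < k -> k <= k0 ->
  cabs (h (y + k) x - h y x - Complex 0 1 * (h y (x + k) - h y x)) <= k ^+ 2 * G x.
Proof.
move=> y0 kp /kl kk; have [H' t] := tayH x y0 kp kk; have := tay_cauchy_riemann t.
have -> : Complex x y + Complex 0 k = Complex x (y + k) by apply: complex_eq; rewrite /= ?addr0.
have -> : Complex x y + rc k = Complex (x + k) y by apply: complex_eq; rewrite /= ?addr0.
by rewrite GE; have -> : 2 * (G x / 2) = G x by field.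
Qed.

Let iG : rinteg G.
Proof.
have := L2_mul (L2_shift (complex.Re a) (L2_decay R)) (L2_shift (complex.Re b) (L2_decay R)).
move=> /(rintegZ K); congr rinteg; apply/funext => x.
by rewrite !cabs_rc ?ltW ?decay_gt0.
Qed.

Let cmeas_res y c : 0 <= y -> complex.Im c < 0 -> cmeas (fun x : R => (Complex x y - c)^-1).
Proof.
move=> y0 c0; have -> : (fun x : R => (Complex x y - c)^-1) = fres (c - Complex 0 y).
  by apply/funext => x; rewrite /fres; congr (_^-1); apply: complex_eq; rewrite !cE /=; ring.
apply: cmeas_fres; rewrite !cE /= lt_eqF //; lra.
Qed.

Let mh y : 0 <= y -> cmeas (h y).
Proof.
move=> y0; apply: cmeasM; last exact: cmeas_res.
apply: cmeasM; last exact: cmeas_res.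
have mE : cmeas (fun x : R => rc (expR (- (l * y))) * cexp (l * x)); last exact: mE.
by apply: cmeasM; [exact: cmeas_cst|apply: cmeas_cexp; exact: measurable_funM].
Qed.

Let res_le (y x : R) c : 0 <= y -> complex.Im c < 0 -> cabs (Complex x y - c)^-1 <= (y - complex.Im c)^-1.
Proof.
move=> y0 c0; have p : 0 < y - complex.Im c by lra.
have := Im_le_cabs (Complex x y - c); rewrite !cE /= => h1.
have h2 := le_trans (ler_norm _) h1.
by rewrite cabsV lef_pV2 ?posrE // (lt_le_trans p).
Qed.

Let hl x : clim (fun n => h n%:R x) 0.
Proof.
apply/climP => e e0; have q0 : 0 < (- complex.Im b)^-1 by rewrite invr_gt0 oppr_gt0.
exists (Num.truncn ((- complex.Im b)^-1 / e)).+1 => n nn; rewrite subr0 /h /H cabsM.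
have n0 : 0 < n%:R :> R by rewrite ltr0n; apply: leq_trans nn.
have hn : (- complex.Im b)^-1 / e < n%:R by apply: lt_le_trans (truncnS_gt _) _; rewrite ler_nat.
have h1 : cabs (zexp l (Complex x n%:R)) <= 1 by exact: cabs_zexp.
have h2 : cabs (Complex x n%:R - a)^-1 <= n%:R^-1.
  by apply: le_trans (res_le _ (ltW n0) a0) _; rewrite lef_pV2 ?posrE //; rewrite ?ltr_wpDl ?lerDr ?lerDl ?oppr_ge0 ?oppr_gt0 ?subr_gt0 ?(ltW a0) ?(lt_trans a0 n0) ?(lt_trans b0 n0) ?(ltW n0).
have h3 : cabs (Complex x n%:R - b)^-1 <= (- complex.Im b)^-1.
  by apply: le_trans (res_le _ (ltW n0) b0) _; rewrite lef_pV2 ?posrE //; rewrite ?lerDr ?oppr_gt0 ?subr_gt0 ?(lt_trans b0 n0) ?(ltW n0).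
have h12 : cabs (zexp l (Complex x n%:R) * (Complex x n%:R - a)^-1) <= n%:R^-1.
  by rewrite [leLHS]cabsM -[leRHS]mul1r; apply: ler_pM; rewrite ?cabs_ge0.
apply: (@le_lt_trans _ _ (n%:R^-1 * (- complex.Im b)^-1)).
  by apply: ler_pM; rewrite ?cabs_ge0.
by rewrite ltr_pdivrMl // mulrC -ltr_pdivrMl // mulrC.
Qed.

(** Both poles lie below the axis, so the line of integration can be pushed upwards, where the
    exponential stays bounded and the resolvents tend to 0. *)
Lemma cint_exp_resolvents : cint (fun x => cexp (l * x) * fres a x * fres b x) = 0.
Proof.
rewrite -[RHS](contour_shift k0_gt0 mh iG hG hd hl); apply: cint_ext => x.
rewrite /h /H /zexp /= mulr0 oppr0 expR0 /fres.
have -> : rc 1 * cexp (l * x) = cexp (l * x) by apply: complex_eq; rewrite !cE /=; ring.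
by [].
Qed.

End Integrals.

(** A concrete part of the Hardy space of the upper half-plane. Finite combinations suffice: the
    class contains the resolvents with pole below the axis and is stable under the generators. *)
Inductive hardy : cfun R -> Prop :=
| hardy_base l a : 0 <= l -> complex.Im a < 0 -> hardy (fun x => cexp (l * x) * fres a x)
| hardy_add f g : hardy f -> hardy g -> hardy (fun x => f x + g x)
| hardy_scale c f : hardy f -> hardy (fun x => c * f x).

Lemma hardy_fres a : complex.Im a < 0 -> hardy (fres a).
Proof.
move=> a0; have := hardy_base (lexx 0) a0; congr hardy; apply/funext => x.
by rewrite mul0r cexp0 mul1r.
Qed.

Lemma hardy_L2 f : hardy f -> L2 f.
Proof.
elim=> [l a _ a0|f' g _ Lf _ Lg|c f' _ Lf]; [|exact: L2D|exact: L2Z].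
have a0' : complex.Im a != 0 by rewrite lt_eqF.
apply: (@L2M R (fun x => cexp (l * x)) 1 _ _ _ (L2_fres a0')).1.
  by apply: cmeas_cexp; apply: measurable_funM.
by move=> x; rewrite cabs_cexp.
Qed.

Lemma hardy_orth f b : hardy f -> complex.Im b < 0 -> cint (fun x => f x * fres b x) = 0.
Proof.
move=> hf b0; have Lb : L2 (fres b) by apply: L2_fres; rewrite lt_eqF.
elim: hf => [l a l0 a0|f' g hf1 h1 hg1 h2|c f' hf1 h1].
- exact: cint_exp_resolvents.
- under cint_ext do rewrite mulrDl.
  rewrite cintD ?h1 ?h2 ?addr0 //; apply: cinteg_mul => //; exact: hardy_L2.
- under cint_ext do rewrite -mulrA.
  by rewrite cintZ ?h1 ?mulr0 //; apply: cinteg_mul => //; exact: hardy_L2.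
Qed.

(** Multiplication raises the frequency; translation moves the pole parallel to the axis and
    contributes a constant phase. *)
Lemma gen_alg_hardy S f : gen_alg S -> hardy f -> hardy (S f).
Proof.
move=> gS; elim: gS f => [m m0|m m0|S1 S2 _ h1 _ h2|c S1 _ h1|S1 S2 _ h1 _ h2] f hf.
- elim: hf => [l a l0 a0|f' g _ h1 _ h2|c f' _ h1].
  + have := hardy_base (addr_ge0 m0 l0) a0; congr hardy; apply/funext => x.
    by rewrite /mult_op mulrDl cexpD mulrA.
  + by have := hardy_add h1 h2; congr hardy; apply/funext => x; rewrite /mult_op mulrDr.
  + by have := hardy_scale c h1; congr hardy; apply/funext => x; rewrite /mult_op mulrCA.
- elim: hf => [l a l0 a0|f' g _ h1 _ h2|c f' _ h1]; last 2 first.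
  + exact: (hardy_add h1 h2).
  + exact: (hardy_scale c h1).
  have am : complex.Im (a + rc m) < 0 by rewrite cImD /= addr0.
  have := hardy_scale (cexp (- (l * m))) (hardy_base l0 am); congr hardy; apply/funext => x.
  rewrite /transl_op mulrA -cexpD mulrBr addrC; congr (_ * _).
  by rewrite /fres; congr (_^-1); apply: complex_eq; rewrite !cE /=; ring.
- exact: (hardy_add (h1 _ hf) (h2 _ hf)).
- exact: (hardy_scale _ (h1 _ hf)).
- exact: (h1 _ (h2 _ hf)).
Qed.

End Hardy.

(** * Locality and scalars *)

Section Locality.
Variable R : realType.
Local Notation mu := (@lebesgue_measure R).
Implicit Types (f g : cfun R) (S : op R) (a b z : R[i]) (u : R -> R[i]).

(** Vanishing of one fixed pairing is a weakly closed condition, tested by a neighbourhood with a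
    single pair. *)
Lemma wot_orth S f g : Ap S -> L2 f -> L2 g -> (forall S', gen_alg S' -> ip (S' f) g = 0) ->
  ip (S f) g = 0.
Proof.
move=> [_ h] Lf Lg k; apply/cabs0_eq0/eqP; rewrite eq_le cabs_ge0 andbT.
apply/ler_addgt0Pr => e e0; rewrite add0r.
have [S' [gS' /(_ 0%N isT)]] := h 1%N (fun=> f) (fun=> g) e e0 (fun=> conj Lf Lg).
by rewrite /= (k _ gS') subr0 => /ltW.
Qed.

Lemma gen_alg_support S (t : R) f : gen_alg S -> (forall x, x < t -> f x = 0) ->
  forall x, x < t -> S f x = 0.
Proof.
move=> gS; elim: gS f => [m m0|m m0|S1 S2 _ h1 _ h2|c S1 _ h1|S1 S2 _ h1 _ h2] f hf x xt.
- by rewrite /mult_op hf // mulr0.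
- by rewrite /transl_op hf // (le_lt_trans _ xt) // gerBl.
- by rewrite /op_add h1 // h2 // addr0.
- by rewrite /op_scale h1 // mulr0.
- by rewrite /op_comp; apply: h1 xt => y yt; exact: h2.
Qed.

Definition ray (t x : R) : R[i] := if t <= x then 1 else 0.

Lemma cmeas_ray t : cmeas (ray t).
Proof.
rewrite (_ : ray t = fun x => rc (\1_(`[t, +oo[%classic) x)).
  by apply: cmeas_real; exact: measurable_indic.
apply/funext => x; rewrite /ray indicE; case: ifP => h; first by rewrite mem_set //= in_itv /= h.
by rewrite memNset //= in_itv /= h.
Qed.

Lemma cabs_ray t x : cabs (ray t x) <= 1.
Proof. by rewrite /ray; case: ifP; rewrite ?cabs0 ?cabs1. Qed.

Lemma conj_ray t x : (ray t x)^* = ray t x.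
Proof. by rewrite /ray; case: ifP; rewrite ?conjC0 ?conjC1. Qed.

Lemma ray_orth S t f g : Ap S -> L2 f -> L2 g ->
  ip (S (fun x => ray t x * f x)) (fun x => (1 - ray t x) * g x) = 0.
Proof.
move=> aS Lf Lg; have Lr f' : L2 f' -> L2 (fun x => ray t x * f' x).
  by move=> Lf'; exact: (L2M (cmeas_ray t) (cabs_ray t) Lf').1.
apply: (wot_orth aS (Lr _ Lf)).
  by under eq_fun do rewrite mulrBl mul1r; apply: L2B => //; exact: Lr.
move=> S' gS'; rewrite -[RHS]cint0; apply: cint_ext => x; rewrite /ray.
case: ifPn => [_|]; first by rewrite subrr mul0r conjC0 mulr0.
rewrite -ltNge => xt; rewrite (gen_alg_support (t := t) gS') ?mul0r // => y yt.
by rewrite leNgt yt mul0r.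
Qed.

Section Adjoint.
Variables (A T : op R).
Hypotheses (aA : Ap A) (aT : Ap T).
Hypothesis adj : forall f g, L2 f -> L2 g -> ip (A f) g = ip f (T g).

Let bA := aA.1.
Let bT := aT.1.

Let LA f : L2 f -> L2 (A f).
Proof. by case: bA => h _; exact: h. Qed.

Let LT f : L2 f -> L2 (T f).
Proof. by case: bT => h _; exact: h. Qed.

Let B_lin (c : R[i]) f g h : L2 f -> L2 g -> L2 h ->
  ip (A (fun x => c * f x + g x)) h = c * ip (A f) h + ip (A g) h.
Proof.
move=> Lf Lg Lh; case: bA => _ [_ [lin _]].
have L1 := LA (L2D (L2Z c Lf) Lg); have LAf := LA Lf; have LAg := LA Lg.
have L2' := L2D (L2Z c LAf) LAg.
rewrite (ip_ae L1 Lh (L2_cmeas L2') (L2_cmeas Lh) (lin c f g Lf Lg) (aeeq_refl _)).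
by rewrite (ipDl (L2Z c LAf) LAg Lh) (ipZl c LAf Lh).
Qed.

Let B_D f g h : L2 f -> L2 g -> L2 h ->
  ip (A (fun x => f x + g x)) h = ip (A f) h + ip (A g) h.
Proof. by move=> Lf Lg Lh; have := B_lin 1 Lf Lg Lh; under eq_fun do rewrite mul1r; rewrite mul1r. Qed.

Let B_0 h : L2 h -> ip (A (fun=> 0)) h = 0.
Proof.
move=> Lh; have := B_lin (-1) (L2_0 R) (L2_0 R) Lh; under eq_fun do rewrite mulr0 addr0.
by rewrite mulN1r addNr.
Qed.

Let B_Z (c : R[i]) f h : L2 f -> L2 h -> ip (A (fun x => c * f x)) h = c * ip (A f) h.
Proof.
move=> Lf Lh; have := B_lin c Lf (L2_0 R) Lh; under eq_fun do rewrite addr0.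
by rewrite B_0 // addr0.
Qed.

Let bound : exists2 C, 0 <= C & forall f g, L2 f -> L2 g ->
  cabs (ip (A f) g) <= C * (l2norm f * l2norm g).
Proof.
case: bA => _ [_ [_ [C hC]]]; exists `|C| => // f g Lf Lg.
apply: le_trans (cauchy_schwarz (LA Lf) Lg) _; rewrite mulrA ler_wpM2r ?l2norm_ge0 //.
by apply: le_trans (hC f Lf) _; rewrite ler_wpM2r ?l2norm_ge0 // ler_norm.
Qed.

(** Multiplication by [u] commutes with [A]. This is tested through inner products because [A] is
    linear only up to almost everywhere equality. *)
Definition local u := [/\ cmeas u, exists K, forall x, cabs (u x) <= K &
  forall f g, L2 f -> L2 g ->
    ip (A (fun x => u x * f x)) g = ip (A f) (fun x => (u x)^* * g x)].

Let L_u u f : cmeas u -> (exists K, forall x, cabs (u x) <= K) -> L2 f ->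
  L2 (fun x => u x * f x) /\ L2 (fun x => (u x)^* * f x).
Proof.
move=> mu_ [K hK] Lf; split; first exact: (L2M mu_ hK Lf).1.
by apply: (L2M (cmeas_conj mu_) (C := K) _ Lf).1 => x; rewrite cabs_conj.
Qed.

(** A subspace invariant under an operator and its adjoint reduces it: [ray_orth] for [A] removes
    one off-diagonal corner and [ray_orth] for [T] the other, so [A] commutes with the
    projection. *)
Lemma local_ray t : local (ray t).
Proof.
split; [exact: cmeas_ray|by exists 1 => x; exact: cabs_ray|move=> f g Lf Lg].
have Lr f' : L2 f' -> L2 (fun x => ray t x * f' x).
  by move=> Lf'; exact: (L2M (cmeas_ray t) (cabs_ray t) Lf').1.
have Lq f' : L2 f' -> L2 (fun x => (1 - ray t x) * f' x).
  by move=> Lf'; under eq_fun do rewrite mulrBl mul1r; apply: L2B => //; exact: Lr.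
have sp f' : f' = fun x => ray t x * f' x + (1 - ray t x) * f' x.
  by apply/funext => x; rewrite -mulrDl addrCA subrr addr0 mul1r.
under [in RHS]eq_fun do rewrite conj_ray.
rewrite {1}(sp g) (ipDr (Lr _ Lg) (Lq _ Lg) (LA (Lr _ Lf))) ray_orth // addr0.
rewrite {2}(sp f) (B_D (Lr _ Lf) (Lq _ Lf) (Lr _ Lg)).
suff -> : ip (A (fun x => (1 - ray t x) * f x)) (fun x => ray t x * g x) = 0 by rewrite addr0.
rewrite adj; [|exact: Lq|exact: Lr].
by rewrite (ipC (LT (Lr _ Lg)) (Lq _ Lf)) ray_orth // conjC0.
Qed.

Lemma local_cst c : local (fun=> c).
Proof.
split; [exact: cmeas_cst|by exists (cabs c)|move=> f g Lf Lg].
by rewrite B_Z // (ipZr _ Lg (LA Lf)) conjCK.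
Qed.

Lemma local_lin c u u' : local u -> local u' -> local (fun x => c * u x + u' x).
Proof.
move=> [m1 b1 l1] [m2 b2 l2]; have [K1 k1] := b1; have [K2 k2] := b2; split.
- by apply: cmeasD => //; apply: cmeasM => //; exact: cmeas_cst.
- exists (cabs c * K1 + K2) => x; apply: le_trans (cabsD _ _) _.
  by rewrite cabsM lerD // ler_wpM2l ?cabs_ge0.
move=> f g Lf Lg; have [Lf1 _] := L_u m1 b1 Lf; have [Lf2 _] := L_u m2 b2 Lf.
have [_ Lg1] := L_u m1 b1 Lg; have [_ Lg2] := L_u m2 b2 Lg.
rewrite (_ : (fun x => _ * f x) = fun x => c * (u x * f x) + u' x * f x); last first.
  by apply/funext => x; rewrite mulrDl mulrA.
rewrite (_ : (fun x => _^* * g x) = fun x => c^* * ((u x)^* * g x) + (u' x)^* * g x); last first.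
  by apply/funext => x; rewrite rmorphD rmorphM mulrDl mulrA.
have LAf := LA Lf.
by rewrite (B_lin c Lf1 Lf2 Lg) (ipDr (L2Z _ Lg1) Lg2 LAf) (ipZr _ Lg1 LAf) conjCK l1 // l2.
Qed.

(** Both sides of the commutation relation depend continuously on [u] in the uniform norm, with a
    constant from the bound on [A]. *)
Lemma local_limit u : cmeas u -> (exists K, forall x, cabs (u x) <= K) ->
  (forall e, 0 < e -> exists2 v, local v & forall x, cabs (u x - v x) <= e) -> local u.
Proof.
move=> mu_ bu hu; split => // f g Lf Lg; have [C C0 hC] := bound.
have [Lf1 _] := L_u mu_ bu Lf; have [_ Lg1] := L_u mu_ bu Lg.
apply/eqP; rewrite -subr_eq0; apply/eqP/cabs0_eq0/eqP; rewrite eq_le cabs_ge0 andbT.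
apply/ler_addgt0Pr => e e0; rewrite add0r.
pose D := 2 * C * (l2norm f * l2norm g) + 1.
have n0 : 0 <= l2norm f * l2norm g by rewrite mulr_ge0 ?l2norm_ge0.
have D0 : 0 < D by rewrite ltr_wpDl // !mulr_ge0 ?l2norm_ge0.
have d0 : 0 < e / D by rewrite divr_gt0.
have [v [mv bv lv] uv] := hu _ d0; set d := e / D in d0 uv.
have [Lf2 _] := L_u mv bv Lf; have [_ Lg2] := L_u mv bv Lg.
have md : cmeas (fun x => u x - v x) by exact: cmeasB.
have Lfd := L2M md uv Lf.
have uv' x : cabs (u x - v x)^* <= d by rewrite cabs_conj.
have Lgd := L2M (cmeas_conj md) uv' Lg.
have -> : ip (A (fun x => u x * f x)) g - ip (A f) (fun x => (u x)^* * g x) =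
    ip (A (fun x => (u x - v x) * f x)) g - ip (A f) (fun x => (u x - v x)^* * g x).
  have -> : (fun x => u x * f x) = fun x => (u x - v x) * f x + v x * f x.
    by apply/funext => x; rewrite -mulrDl subrK.
  have -> : (fun x => (u x)^* * g x) = fun x => (u x - v x)^* * g x + (v x)^* * g x.
    by apply/funext => x; rewrite -mulrDl -rmorphD subrK.
  by rewrite (B_D Lfd.1 Lf2 Lg) (ipDr Lgd.1 Lg2 (LA Lf)) lv // opprD addrACA subrr addr0.
apply: le_trans (cabsD _ _) _; rewrite cabsN.
have h1 : cabs (ip (A (fun x => (u x - v x) * f x)) g) <= C * (d * (l2norm f * l2norm g)).
  apply: le_trans (hC _ _ Lfd.1 Lg) _; rewrite ler_wpM2l // mulrA ler_wpM2r ?l2norm_ge0 //.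
  exact: Lfd.2.
have h2 : cabs (ip (A f) (fun x => (u x - v x)^* * g x)) <= C * (d * (l2norm f * l2norm g)).
  apply: le_trans (hC _ _ Lf Lgd.1) _; rewrite ler_wpM2l // mulrCA ler_wpM2l ?l2norm_ge0 //.
  exact: Lgd.2.
apply: le_trans (lerD h1 h2) _.
have -> : C * (d * (l2norm f * l2norm g)) + C * (d * (l2norm f * l2norm g)) = d * (D - 1).
  by rewrite /D; ring.
have -> : e = d * D by rewrite /d divfK // gt_eqF.
by rewrite ler_wpM2l ?(ltW d0) // gerBl.
Qed.

Lemma local_icc s t : s <= t -> local (icc s t).
Proof.
move=> st; have := local_lin (-1) (local_ray t) (local_ray s); congr local.
apply/funext => x; rewrite /icc /ray mulN1r.
have [tx|xt] := leP t x; first by rewrite (le_trans st tx) andbF addNr.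
by rewrite andbT oppr0 add0r.
Qed.

(* Uniform approximation by step functions. *)
Lemma local_lipschitz u (L : R) : cmeas u -> (exists K, forall x, cabs (u x) <= K) -> 0 < L ->
  (forall x y, cabs (u x - u y) <= L * `|x - y|) ->
  (forall e, 0 < e -> exists M, forall x, M <= `|x| -> cabs (u x) <= e) -> local u.
Proof.
move=> mu_ bu L0 hL dec; apply: local_limit => // e e0; have [M hM] := dec e e0.
pose s := e / L; have s0 : 0 < s by rewrite divr_gt0.
pose m := (Num.truncn (2 * M / s)).+1.
pose xj (j : nat) : R := - M + j%:R * s.
have xjS j : xj j.+1 = xj j + s by rewrite /xj -natr1; ring.
pose v k x := \sum_(j < k) u (xj j) * icc (xj j) (xj j.+1) x.
have lv k : local (v k).
  elim: k => [|k ih].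
    by have := local_cst 0; congr local; apply/funext => x; rewrite /v big_ord0.
  have li : local (icc (xj k) (xj k.+1)) by apply: local_icc; rewrite xjS lerDl ltW.
  have := local_lin (u (xj k)) li ih; congr local; apply/funext => x.
  by rewrite /v big_ord_recr addrC.
exists (v m) => // x; have mono p q : xj p <= x -> x < xj q.+1 -> (p <= q)%N.
  move=> v1 v2; have : xj p < xj q.+1 by exact: le_lt_trans v1 v2.
  by rewrite /xj ltrD2l ltr_pM2r // ltr_nat ltnS.
have [/existsP[j /andP[j1 j2]]|] := boolP [exists j : 'I_m, xj j <= x < xj j.+1].
  have -> : v m x = u (xj j).
    rewrite /v (bigD1 j) //= [X in _ + X]big1 ?addr0; last first.
      move=> i ij; rewrite /icc; case: ifP => [/andP[u1 u2]|]; last by rewrite mulr0.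
      by case/negP: ij; apply/eqP/val_inj/eqP; rewrite eqn_leq !mono.
    by rewrite /icc j1 j2 mulr1.
  apply: le_trans (hL _ _) _; rewrite mulrC -ler_pdivlMr // -/s.
  by rewrite ger0_norm ?subr_ge0 //; rewrite xjS in j2; lra.
rewrite negb_exists => /forallP no.
have -> : v m x = 0.
  by rewrite /v big1 // => j _; rewrite /icc (negbTE (no j)) mulr0.
rewrite subr0; apply: hM; rewrite leNgt; apply/negP; rewrite ltr_norml => /andP[x1 x2].
have p0 : 0 <= (x + M) / s by rewrite divr_ge0 ?(ltW s0) //; lra.
have /andP[l1 l2] := truncn_itv p0; set j0 := Num.truncn ((x + M) / s) in l1 l2.
have jm : (j0 < m)%N.
  by rewrite ltnS; apply: le_truncn; rewrite ler_pM2r ?invr_gt0 //; lra.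
case/negP: (no (Ordinal jm)); apply/andP; split => /=.
  by rewrite /xj addrC lerBlDr -ler_pdivlMr.
by rewrite /xj addrC ltrBrDr -ltr_pdivrMr.
Qed.

End Adjoint.

End Locality.

(** * Adjoint pairs inside the algebra are scalar *)

Section SelfAdjointPart.
Variable R : realType.
Local Notation mu := (@lebesgue_measure R).
Implicit Types (f g v : cfun R) (A T : op R) (a b z : R[i]).

Lemma fres_conj b x : (fres b x)^* = fres b^* x.
Proof. by rewrite /fres fmorphV rmorphB /= rc_conj. Qed.

Lemma rc_sub_neq0 a x : complex.Im a != 0 -> rc x - a != 0.
Proof.
move=> a0; apply/eqP => /(congr1 (@complex.Im R)); rewrite !cE /= sub0r => /eqP.
by rewrite oppr_eq0; exact/negP.
Qed.

Lemma fres_le a x : complex.Im a != 0 -> cabs (fres a x) <= `|complex.Im a|^-1.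
Proof.
move=> a0; have i0 : 0 < `|complex.Im a| by rewrite normr_gt0.
have h := Im_le_cabs (rc x - a); rewrite !cE /= sub0r normrN in h.
by rewrite /fres cabsV lef_pV2 ?posrE // (lt_le_trans i0).
Qed.

Lemma fres_mul a b x : complex.Im a != 0 -> complex.Im b != 0 ->
  fres a x - fres b x = (a - b) * (fres a x * fres b x).
Proof.
move=> /(rc_sub_neq0 x) a0 /(rc_sub_neq0 x) b0.
by rewrite /fres; field; rewrite a0 b0.
Qed.

Lemma Ap_scalar (c : R[i]) : Ap (op_scale c (@op_id R)).
Proof.
have E : op_scale c (@op_id R) = op_scale c (mult_op 0).
  apply/funext => f; apply/funext => x; rewrite /op_scale /op_id /mult_op mul0r cos0 sin0.
  by rewrite mul1r.
have gS : gen_alg (op_scale c (@op_id R)) by rewrite E; apply: ga_scale; exact: ga_M.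
split; first by have [C sS] := gen_alg_strong gS; exact: (strong_bounded sS).
move=> n fs gs e e0 _; exists (op_scale c (@op_id R)); split => // i _.
by rewrite subrr cabs0.
Qed.

Section Adjoint.
Variables A T : op R.
Hypotheses (aA : Ap A) (aT : Ap T).
Hypothesis adj : forall f g, L2 f -> L2 g -> ip (A f) g = ip f (T g).

Let LA f : L2 f -> L2 (A f).
Proof. by case: aA => -[h _] _; exact: h. Qed.

Let LT f : L2 f -> L2 (T f).
Proof. by case: aT => -[h _] _; exact: h. Qed.

Lemma local_fres a : complex.Im a != 0 -> local A (fres a).
Proof.
move=> a0; have i0 : 0 < `|complex.Im a| by rewrite normr_gt0.
have ii0 : 0 < `|complex.Im a|^-1 by rewrite invr_gt0.
apply: (local_lipschitz aA aT adj (cmeas_fres a0) (L := `|complex.Im a|^-1 * `|complex.Im a|^-1)).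
- by exists `|complex.Im a|^-1 => x; exact: fres_le.
- exact: mulr_gt0.
- move=> x y.
  have -> : fres a x - fres a y = rc (y - x) * (fres a x * fres a y).
    have x0 := rc_sub_neq0 x a0; have y0 := rc_sub_neq0 y a0.
    have -> : rc (y - x) = (rc y - a) - (rc x - a) by apply: complex_eq; rewrite !cE /=; ring.
    rewrite /fres; move: (rc x - a) (rc y - a) x0 y0 => p q p0 q0.
    by field; rewrite p0 q0.
  rewrite cabsM cabs_real [fres a x * _]mulrC cabsM distrC mulrC ler_wpM2r //.
  by apply: ler_pM; rewrite ?cabs_ge0 // fres_le.
move=> e e0; pose K := 1 + `|complex.Im a|^-1; have K0 : 0 < K by rewrite addr_gt0.
exists (`|complex.Re a| + K / e) => x hx; apply: le_trans (cabs_fres x a0) _.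
rewrite /decay -/K ler_pdivrMr ?ltr_wpDr // mulrC -ler_pdivrMr //.
by have := lerB_dist x (complex.Re a); lra.
Qed.

(** Below the axis, [A] keeps [fres a] orthogonal to what annihilates the class [hardy]. Above it,
    passing to the adjoint and conjugating the resolvents brings the poles below the axis, with [T]
    in place of [A]. *)
Let half_plane a b : (complex.Im a < 0 /\ complex.Im b < 0) \/
  (0 < complex.Im a /\ 0 < complex.Im b) -> ip (A (fres a)) (fun x => (fres b x)^*) = 0.
Proof.
have low S c d : Ap S -> complex.Im c < 0 -> complex.Im d < 0 ->
    ip (S (fres c)) (fun x => (fres d x)^*) = 0.
  move=> aS c0 d0; apply: (wot_orth aS).
  - by apply: L2_fres; rewrite lt_eqF.
  - by apply/L2_conj/L2_fres; rewrite lt_eqF.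
  move=> S' gS'; rewrite /ip; under cint_ext do rewrite conjCK.
  exact: (hardy_orth (gen_alg_hardy gS' (hardy_fres c0))).
case=> -[a0 b0]; first exact: low.
have La : L2 (fres a) by apply: L2_fres; rewrite gt_eqF.
have Lb : L2 (fun x => (fres b x)^*) by apply/L2_conj/L2_fres; rewrite gt_eqF.
rewrite adj // (ipC (LT Lb) La).
have -> : (fun x => (fres b x)^*) = fres b^* by apply/funext => x; rewrite fres_conj.
have -> : fres a = fun x => (fres a^* x)^* by apply/funext => x; rewrite fres_conj conjCK.
by rewrite low ?conjC0 // cIm_conj oppr_lt0.
Qed.

Let p : R[i] := Complex 0 (-1).
Let q : R[i] := Complex 0 1.

Let p0 : complex.Im p != 0.
Proof. by rewrite /= oppr_eq0 oner_neq0. Qed.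

Let Lp : L2 (fres p) := L2_fres p0.

(** The resolvent identity makes every resolvent a multiple of the single function [fres p], by a
    factor that commutes with [A]; on resolvents [A] is thus determined by [A (fres p)]. *)
Let fres_factor a : complex.Im a != 0 -> fres a = fun x => (1 + (a - p) * fres a x) * fres p x.
Proof.
move=> a0; apply/funext => x; rewrite mulrDl mul1r -mulrA -fres_mul //.
by rewrite addrCA subrr addr0.
Qed.

Let local_factor a : complex.Im a != 0 -> local A (fun x => 1 + (a - p) * fres a x).
Proof.
move=> a0; have := local_lin aA (a - p) (local_fres a0) (local_cst aA 1).
by congr local; apply/funext => x; rewrite addrC.
Qed.

(* With [V b] the integral of [A (fres p) * fres b]: [V = 0] below the axis, and above it
   [V] is determined by [V q] in a way that does not depend on [A]. *)
Lemma resolvent_image_low b : complex.Im b < 0 -> cint (fun x => A (fres p) x * fres b x) = 0.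
Proof.
move=> b0; have pl : complex.Im p < 0 by rewrite /= oppr_lt0 ltr01.
rewrite -[RHS](half_plane (or_introl (conj pl b0))).
by apply: cint_ext => x; rewrite conjCK.
Qed.

Lemma resolvent_image_high b : 0 < complex.Im b ->
  (b - p) * cint (fun x => A (fres p) x * fres b x) =
  (q - p) * cint (fun x => A (fres p) x * fres q x).
Proof.
move=> b0; have [->//|bq] := eqVneq b q.
have q0 : 0 < complex.Im q by rewrite /= ltr01.
have q0' : complex.Im q != 0 by rewrite gt_eqF.
have b0' : complex.Im b != 0 by rewrite gt_eqF.
have Lb := L2_fres b0'; have Lq := L2_fres q0'; have Lv := LA Lp.
have bq0 : b - q != 0 by rewrite subr_eq0.
(* Locality turns [A (fres q)] into [1 + (q - p) * fres q] times [A (fres p)]. Partial fractions of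
   [fres q * fres b] then leave only the integrals against [fres b] and [fres q], in a combination
   equal to 0. *)
have := half_plane (or_intror (conj q0 b0)); rewrite {1}(fres_factor q0').
have [_ _ ->] := local_factor q0'; [|exact: Lp|exact: L2_conj].
set v := A (fres p) in Lv *.
have i1 : cinteg (fun x => v x * fres b x) by exact: cinteg_mul.
have i2 : cinteg (fun x => v x * fres q x) by exact: cinteg_mul.
have -> : ip v (fun x => (1 + (q - p) * fres q x)^* * (fres b x)^*) =
    cint (fun x => (b - p) / (b - q) * (v x * fres b x) -
      (q - p) / (b - q) * (v x * fres q x)).
  apply: cint_ext => x; rewrite -rmorphM conjCK.
  have := fres_mul x b0' q0'; move: (fres b x) (fres q x) (v x) => s t w E.
  have {}E : t * s = (s - t) / (b - q) by rewrite E [_ * (s * t)]mulrC mulfK // mulrC.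
  have -> : (1 + (q - p) * t) * s = s + (q - p) * (t * s) by ring.
  by rewrite E; field.
rewrite cintB; [|exact: cintegZ..]; rewrite !cintZ // => /eqP; rewrite subr_eq0 => /eqP.
move=> /(congr1 (fun z => (b - q) * z)).
have E (s t : R[i]) : (b - q) * (s / (b - q) * t) = s * t by field.
by rewrite !E.
Qed.

End Adjoint.
Let p : R[i] := Complex 0 (-1).
Let q : R[i] := Complex 0 1.

(** The identity obeys the same equations for the resolvent integrals and supplies the values to
    compare with, so [A (fres p)] is [c] times [fres p], and locality extends this to all
    resolvents. Pairing these with [T g] for arbitrary [g] and using uniqueness once more settles
    [T], with the conjugate scalar. *)
Lemma adjoint_pair_scalar A T : Ap A -> Ap T ->
  (forall f g, L2 f -> L2 g -> ip (A f) g = ip f (T g)) ->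
  exists c, opeq T (op_scale c (@op_id R)).
Proof.
move=> aA aT adj.
have id1 : op_scale 1 (@op_id R) = @op_id R.
  by apply/funext => f; apply/funext => x; rewrite /op_scale mul1r.
have aI := Ap_scalar 1; rewrite id1 in aI.
have adjI f g : L2 f -> L2 g -> ip (@op_id R f) g = ip f (@op_id R g) by [].
have p0 : complex.Im p != 0 by rewrite /= oppr_eq0 oner_neq0.
have Lp := L2_fres p0; have Lv : L2 (A (fres p)) by case: (aA) => -[h _] _; exact: h.
set v := A (fres p) in Lv.
pose V w b := cint (fun x => w x * fres b x).
have lowA b : complex.Im b < 0 -> V v b = 0 by exact: (resolvent_image_low aA aT adj).
have lowI b : complex.Im b < 0 -> V (fres p) b = 0 by exact: (resolvent_image_low aI aI adjI).
have highA b : 0 < complex.Im b -> (b - p) * V v b = (q - p) * V v q.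
  exact: (resolvent_image_high aA aT adj).
have highI b : 0 < complex.Im b -> (b - p) * V (fres p) b = (q - p) * V (fres p) q.
  exact: (resolvent_image_high aI aI adjI).
(* Otherwise all resolvent integrals of [fres p] vanish and it is null, although its squared norm is
   the integral of 1/(1 + t^2). *)
have Vq : V (fres p) q != 0.
  apply/eqP => V0; have : aeeq (fres p) (fun=> 0).
    apply: resolvent_unique => // b b0; case: (ltgtP (complex.Im b) 0) (b0) => // hb _.
      exact: lowI.
    have := highI b hb; rewrite V0 mulr0 => /eqP; rewrite mulf_eq0 => /orP[|/eqP //].
    rewrite subr_eq0 => /eqP bp; move: hb; rewrite bp /= oppr_gt0 ltr10 //.
  move=> /(l2norm_ae (L2_cmeas Lp) (cmeas_cst 0)); rewrite l2norm0 => n0.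
  have := l2norm_sq (fres p); rewrite n0 expr0n /= => E.
  have : 1 / 2 <= \int[mu]_t csq (fres p t).
    apply: le_trans (Rint_oneDsqr_ge R) _; rewrite le_eqVlt; apply/orP; left; apply/eqP.
    apply: eq_Rintegral => t _; rewrite /p fresE /csq /= subr0 sqrrN expr1n.
    have t1 : t ^+ 2 + 1 != 0 by rewrite gt_eqF // ltr_wpDl ?sqr_ge0.
    have t2 : 1 + t ^+ 2 != 0 by rewrite addrC.
    by field; rewrite ?t1 ?t2.
  by rewrite -E div1r invr_le0 lern0.
pose c := V v q / V (fres p) q.
have cv : aeeq v (fun x => c * fres p x).
  have Lr : L2 (fun x => v x - c * fres p x) := L2B Lv (L2Z c Lp).
  have r0 : aeeq (fun x => v x - c * fres p x) (fun=> 0).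
    apply: resolvent_unique => // b b0; have Lb := L2_fres b0.
    have -> : cint (fun x => (v x - c * fres p x) * fres b x) = V v b - c * V (fres p) b.
      under cint_ext do rewrite mulrBl -mulrA.
      have ip_ := cinteg_mul Lp Lb.
      by rewrite (cintB (cinteg_mul Lv Lb) (cintegZ c ip_)) (cintZ c ip_).
    case: (ltgtP (complex.Im b) 0) (b0) => // hb _; first by rewrite lowA // lowI // mulr0 subrr.
    have bp : b - p != 0.
      by rewrite subr_eq0; apply/eqP => bp; move: hb; rewrite bp /= oppr_gt0 ltr10.
    apply: (mulfI bp); rewrite mulr0 mulrBr mulrCA highA // highI //.
    by rewrite /c mulrCA divfK // subrr.
  by apply: ae_mono r0 => x /eqP; rewrite subr_eq0 => /eqP.
exists c^* => g Lg; have LTg : L2 (T g) by case: (aT) => -[h _] _; exact: h.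
have Lcg : L2 (fun x => c^* * g x) := L2Z _ Lg.
have Lr : L2 (fun x => T g x - c^* * g x) := L2B LTg Lcg.
suff : aeeq (fun x => (T g x - c^* * g x)^*) (fun=> 0).
  apply: ae_mono => x /eqP; rewrite conjC_eq0 subr_eq0 => /eqP.
  by rewrite /op_scale /op_id.
apply: resolvent_unique; first exact: L2_conj.
move=> a a0; have La := L2_fres a0.
have -> : cint (fun x => (T g x - c^* * g x)^* * fres a x) =
    ip (fres a) (fun x => T g x - c^* * g x) by apply: cint_ext => x; rewrite mulrC.
rewrite (ipBr LTg Lcg La) -adj // (ipZr _ Lg La) conjCK.
have fa : fres a = fun x => (1 + (a - p) * fres a x) * fres p x.
  apply/funext => x; rewrite mulrDl mul1r -mulrA -fres_mul //.
  by rewrite addrCA subrr addr0.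
have lu : local A (fun x => 1 + (a - p) * fres a x).
  have := local_lin aA (a - p) (local_fres aA aT adj a0) (local_cst aA 1).
  by congr local; apply/funext => x; rewrite addrC.
have [mu_ [K hK] lu'] := lu.
have Lug : L2 (fun x => (1 + (a - p) * fres a x)^* * g x).
  by apply: (L2M (cmeas_conj mu_) (C := K) _ Lg).1 => x; rewrite cabs_conj.
rewrite {1}fa lu' // -/v (ip_ae Lv Lug (L2_cmeas (L2Z c Lp)) (L2_cmeas Lug) cv (aeeq_refl _)).
by rewrite ipZl // -ip_Mop -fa subrr.
Qed.

End SelfAdjointPart.

Theorem theorem6p3 (R : realType) :
  ((forall T : op R, plusK (@Ap_cap_Apstar R) T -> QAp T) /\
   (exists T : op R, QAp T /\ ~ plusK (@Ap_cap_Apstar R) T)) /\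
  (forall T : op R, plusK (@Ap_cap_Apstar R) T <-> scalar_plusK T).
Proof.
(* An element of the intersection lies in the algebra and is also the adjoint of some [A] in it,
   which is the position of [T] in [adjoint_pair_scalar]. The same implication later excludes the
   witness. *)
have scalarE (T : op R) : plusK (@Ap_cap_Apstar R) T -> scalar_plusK T.
  move=> [bT [B [K [[aB [A [aA [_ adj]]]] [cK TE]]]]]; split => //.
  have [c BE] := adjoint_pair_scalar aA aB adj; exists c, K; split => // f Lf.
  by apply: ae_mono2 (BE f Lf) (TE f Lf) => x Bx ->; rewrite /op_add Bx.
split; first split.
- move=> T [bT [B [K [[aB sB] [cK TE]]]]].
  by split; split => //; exists B, K.
- have [N [d h]] := block_sequence R.
  have N0 n : (0 < N n)%N by case: (h n).
  have d0 n : 0 < d n by case: (h n).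
  have ds n : d n * scale R (N n) * scale R (N n) <= qq R n by case: (h n).
  have err n : Num.sqrt (20 / (N n)%:R) + d n * scale R (N n) * scale R (N n) +
    64 / (N n)%:R <= qq R n by case: (h n).
  exists (opT N d); split; first exact: QAp_opT.
  by move=> /scalarE; exact: (not_scalar_opT N0 d0 ds err).
- move=> T; split; first exact: scalarE.
  move=> [bT [c [K [cK TE]]]]; split => //; exists (op_scale c (@op_id R)), K; split => //.
  split; first exact: Ap_scalar.
  exists (op_scale c^* (@op_id R)); split; first exact: Ap_scalar.
  split; first exact: (Ap_scalar c).1.
  by move=> f g Lf Lg; rewrite /op_scale /op_id ipZl // ipZr.
Qed.
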